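(* Let $0<\mathbf{T}<\infty$, let $F$ and $G$ be differentiable matrix functions on $[0,\mathbf{T}]$ of sizes $r\times p$ and $p\times r$, respectively, such that $F(x)G(x)\equiv I_r$ for $0\le x\le\mathbf{T}$, and assume that the entries of $F'$ and $G'$ belong to $L^2(0,\mathbf{T})$. Define operators on $L^2_r(0,\mathbf{T})$ by $$(Kf)(x)=F(x)\int_0^xG(t)f(t)\,dt,\qquad (Af)(x)=\int_0^xf(t)\,dt.$$ Then $K$ is similar to $A$. More precisely, $K=EAE^{-1}$, where $E\in B(L^2_r(0,\mathbf{T}))$ is a (boundedly invertible) lower triangular operator of the form $$(Ef)(x)=\rho(x)\Big(f(x)+\int_0^xN(x,t)f(t)\,dt\Big),$$ $\rho$ is the $r\times r$ matrix function determined by $\frac{d}{dx}\rho=F'G\rho$, $\rho(0)=I_r$, and the matrix functions $\rho$, $\rho^{-1}$ and $N$ are measurable and uniformly bounded. Moreover, the operators $E$ and $E^{-1}$ map differentiable functions with a square-summable derivative into differentiable functions with a square-summable derivative.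
   Context: $L^2_r(0,\mathbf{T})$ is the Hilbert space of square-integrable $\mathbb{C}^r$-valued functions on $(0,\mathbf{T})$; $B(H)$ is the algebra of bounded linear operators on $H$. A matrix (vector) function is called square-summable if its entries belong to $L^2(0,\mathbf{T})$. ''Differentiable with a square-summable derivative'' is understood in the sense of absolutely continuous functions whose a.e. derivative is square-summable, i.e. functions $f(x)=f_0+\int_0^x\widetilde f(t)\,dt$ with $f_0$ constant and $\widetilde f$ square-summable; differential equations hold almost everywhere. $N(x,t)$ is an $r\times r$ matrix kernel on $0\le t\le x\le\mathbf{T}$. *)

(* Defs.v *)
From HB Require Import structures.
From mathcomp Require Import all_boot all_order all_algebra.
From mathcomp Require Import all_classical all_reals all_analysis.
From mathcomp Require Export complex.

Set Implicit Arguments.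
Unset Strict Implicit.
Unset Printing Implicit Defensive.

Import Order.TTheory GRing.Theory Num.Theory.
Import numFieldNormedType.Exports.

Local Open Scope classical_set_scope.
Local Open Scope ring_scope.
Local Open Scope complex_scope.

(* The analysis library integrates real-valued functions only, so that
   measurability and integration of complex matrix functions are spelled out
   on the real and imaginary parts of the entries. C^r is 'cV[R[i]]_r. *)
Section MatrixFunctions.
Context {R : realType}.
Local Notation mu := (@lebesgue_measure R).

Definition absc2 (z : R[i]) : R := complex.Re z ^+ 2 + complex.Im z ^+ 2.

Definition mx_measurable {d} {X : measurableType d} {m n : nat}
    (D : set X) (f : X -> 'M[R[i]]_(m, n)) : Prop :=
  forall i j, measurable_fun D (fun x => complex.Re (f x i j)) /\
              measurable_fun D (fun x => complex.Im (f x i j)).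

Definition mx_bounded {X : Type} {m n : nat}
    (D : set X) (f : X -> 'M[R[i]]_(m, n)) : Prop :=
  exists M : R, forall x, D x -> forall i j, Num.sqrt (absc2 (f x i j)) <= M.

Definition mx_integral {m n : nat} (D : set R) (f : R -> 'M[R[i]]_(m, n)) :
    'M[R[i]]_(m, n) :=
  \matrix_(i, j) ((\int[mu]_(t in D) complex.Re (f t i j)) +i*
                  (\int[mu]_(t in D) complex.Im (f t i j))).

Definition mx_integrable {m n : nat} (D : set R) (f : R -> 'M[R[i]]_(m, n)) :
    Prop :=
  forall i j, mu.-integrable D (fun x => (complex.Re (f x i j))%:E) /\
              mu.-integrable D (fun x => (complex.Im (f x i j))%:E).

Definition square_summable {m n : nat} (T : R) (f : R -> 'M[R[i]]_(m, n)) :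
    Prop :=
  mx_measurable `]0, T[ f /\
  forall i j, mu.-integrable `]0, T[ (fun x => (absc2 (f x i j))%:E).

(* f is absolutely continuous on [0, T] with a.e. derivative f'. *)
Definition ac_derivative {m n : nat} (T : R) (f f' : R -> 'M[R[i]]_(m, n)) :
    Prop :=
  mx_integrable `]0, T[ f' /\
  forall x, 0 <= x <= T -> f x = f 0 + mx_integral `[0, x] f'.

Definition L2_derivative {m n : nat} (T : R) (f f' : R -> 'M[R[i]]_(m, n)) :
    Prop :=
  ac_derivative T f f' /\ square_summable T f'.

Definition L2_differentiable {m n : nat} (T : R) (f : R -> 'M[R[i]]_(m, n)) :
    Prop :=
  exists f', L2_derivative T f f'.

(* rho solves rho' = B rho a.e. on (0, T), rho(0) = I, in the absolutely
   continuous sense. *)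
Definition cauchy_solution {r : nat} (T : R) (B rho : R -> 'M[R[i]]_r) : Prop :=
  rho 0 = 1%:M /\
  exists2 rho', ac_derivative T rho rho' &
    ae_eq mu `]0, T[%classic rho' (fun x => B x *m rho x).

End MatrixFunctions.

(* L^2_r(0, T) is handled as the functions satisfying [square_summable T],
   taken up to equality a.e. on (0, T); an operator on L^2_r(0, T) is a map on
   functions that is compatible with this equality. *)
Section Operators.
Context {R : realType} {r : nat}.
Local Notation mu := (@lebesgue_measure R).
Local Notation vfun := (R -> 'cV[R[i]]_r).

Definition L2eq (T : R) (f g : vfun) : Prop := ae_eq mu `]0, T[%classic f g.

Definition L2norm (T : R) (f : vfun) : R :=
  Num.sqrt (\int[mu]_(x in `]0, T[) \sum_(i < r) absc2 (f x i 0)).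

Record bounded_operator (T : R) (S : vfun -> vfun) : Prop := BoundedOperator {
  bounded_operator_L2 : forall f, square_summable T f ->
    square_summable T (S f) ;
  bounded_operator_eq : forall f g, square_summable T f ->
    square_summable T g -> L2eq T f g -> L2eq T (S f) (S g) ;
  bounded_operator_linear : forall (a : R[i]) f g, square_summable T f ->
    square_summable T g ->
    L2eq T (S (fun x => a *: f x + g x)) (fun x => a *: S f x + S g x) ;
  bounded_operator_bound : exists C : R, forall f, square_summable T f ->
    L2norm T (S f) <= C * L2norm T f }.

Definition operator_inverse (T : R) (E Einv : vfun -> vfun) : Prop :=
  forall f, square_summable T f ->
    L2eq T (E (Einv f)) f /\ L2eq T (Einv (E f)) f.

(* K = E A E^-1 in B(L^2_r(0, T)), with Einv in the role of E^-1. *)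
Definition similar_by (T : R) (K A E Einv : vfun -> vfun) : Prop :=
  [/\ bounded_operator T K /\ bounded_operator T A,
      bounded_operator T E /\ bounded_operator T Einv,
      operator_inverse T E Einv &
      forall f, square_summable T f -> L2eq T (K f) (E (A (Einv f)))].

(* An element of L^2_r(0, T) is differentiable when some representative is. *)
Definition preserves_L2_differentiable (T : R) (S : vfun -> vfun) : Prop :=
  forall f, L2_differentiable T f ->
    exists2 g, L2eq T (S f) g & L2_differentiable T g.

Definition opK {p : nat} (F : R -> 'M[R[i]]_(r, p)) (G : R -> 'M[R[i]]_(p, r))
    (f : vfun) : vfun :=
  fun x => F x *m mx_integral `[0, x] (fun t => G t *m f t).

Definition opA (f : vfun) : vfun := fun x => mx_integral `[0, x] f.

Definition opE (rho : R -> 'M[R[i]]_r) (N : R -> R -> 'M[R[i]]_r)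
    (f : vfun) : vfun :=
  fun x => rho x *m (f x + mx_integral `[0, x] (fun t => N x t *m f t)).

End Operators.

Definition triangle {R : realType} (T : R) : set (R * R) :=
  [set xt | 0 <= xt.2 /\ xt.2 <= xt.1 /\ xt.1 <= T].

(* Main.v *)
(* Idea. Let rho' = F'G rho, rho(0) = I, and let W' = -GF'W, W(0) = I. Solving
   y = F z, z' = G f for f shows that K^-1 = d/dx - F'G + F'W (int_0^x) b0 with
   b0 = W^-1 (GF'G + G'); conjugation by rho gives
     rho^-1 K^-1 rho = d/dx + V,   (V f)(x) = a(x) int_0^x b(t) f(t) dt,
   with a = rho^-1 F'W and b = b0 rho square-summable. It remains to find a
   bounded Volterra kernel N with (d/dx + V)(I + N) = (I + N) d/dx, that is
   (d/dx + d/ds) N = - a(x) (b(s) + int_s^x b(t) N(t, s) dt), N(x, 0) = 0.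
   Integrated along the characteristics x - s = const, this is a fixed-point
   equation which is a contraction for a norm with exponential weight. Then
   E = rho (I + N), and the same intertwining relation, used backwards and
   forwards, shows that E and E^-1 preserve differentiability. *)
Require Import Defs.
From mathcomp Require Import all_boot all_order all_algebra.
From mathcomp Require Import all_classical all_reals all_analysis.
From mathcomp Require Import measurable_realfun ring lra.
Set Implicit Arguments.
Unset Strict Implicit.
Unset Printing Implicit Defensive.
Import Order.TTheory GRing.Theory Num.Theory.
Import numFieldNormedType.Exports.
Local Open Scope classical_set_scope.
Local Open Scope ring_scope.
Local Open Scope complex_scope.

(** * Coordinates and norm of complex matrices *)

Section Coordinates.
Context {R : realType}.

(** The obstacle is that [a] and [b] are merely square-summable, so a kernel like a(x)b(s) is
    unbounded, whereas N must be bounded. Integration along x - s = const repairs this: the integral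
    of a(y)b(y - v) over y is bounded uniformly in v by the L^2 norms of [a] and [b]. The condition
    N(x, 0) = 0 removes the boundary term N(x, 0)f(0), so that the intertwining relation holds for
    every f with square-summable derivative, not only when f(0) = 0; preservation of
    differentiability rests on this. No unbounded operator occurs: d/dx + V appears only in integral
    equations y = c + int_0^x (h - Vy), and K = E A E^-1 holds because both sides, multiplied by
    rho^-1, solve one such equation, whose solution is unique. V is there because z cannot be
    recovered from y = Fz when p > r: the defect z - Gy lies in the kernel of F and solves a linear
    system with fundamental matrix W, driven by y. Functions are total on the line: derivatives are
    extended by zero, primitives by constants. Kernels are bounded functions defined at every point,
    not classes, so that values on diagonals make sense. *)

Definition co {m n} (M : 'M[R[i]]_(m, n)) (k : bool * ('I_m * 'I_n)) : R :=
  if k.1 then complex.Re (M k.2.1 k.2.2) else complex.Im (M k.2.1 k.2.2).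

Definition of_co {m n} (c : bool * ('I_m * 'I_n) -> R) : 'M[R[i]]_(m, n) :=
  \matrix_(i, j) (c (true, (i, j)) +i* c (false, (i, j))).

Lemma of_coK m n (c : bool * ('I_m * 'I_n) -> R) k : co (of_co c) k = c k.
Proof. by case: k => [[] [i j]]; rewrite /co /= mxE. Qed.

Lemma co_inj m n (M N : 'M[R[i]]_(m, n)) : (forall k, co M k = co N k) -> M = N.
Proof.
move=> MN; apply/matrixP => i j.
have := MN (true, (i, j)); have := MN (false, (i, j)); rewrite /co /=.
by case: (M i j) => a b; case: (N i j) => c d /= -> ->.
Qed.

Lemma coD m n (M N : 'M[R[i]]_(m, n)) k : co (M + N) k = co M k + co N k.
Proof.
by case: k => [[] [i j]]; rewrite /co /= mxE;
  case: (M i j) => a b; case: (N i j) => c d.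
Qed.

Lemma coN m n (M : 'M[R[i]]_(m, n)) k : co (- M) k = - co M k.
Proof. by case: k => [[] [i j]]; rewrite /co /= mxE; case: (M i j). Qed.

Lemma coB m n (M N : 'M[R[i]]_(m, n)) k : co (M - N) k = co M k - co N k.
Proof. by rewrite coD coN. Qed.

Lemma co0 m n k : co (0 : 'M[R[i]]_(m, n)) k = 0.
Proof. by case: k => [[] [i j]]; rewrite /co /= mxE. Qed.

Lemma co_tr m n (M : 'M[R[i]]_(m, n)) k :
  co M^T k = co M (k.1, (k.2.2, k.2.1)).
Proof. by case: k => [[] [i j]]; rewrite /co /= mxE. Qed.

Definition csign (b : bool) : R := if b then -1 else 1.

(** One formula serves both parts of a complex product, with [csign] carrying the minus sign of the
    real part. Coordinates of a matrix product become finite sums of products of real functions, to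
    which real measurability and linearity of the integral apply. *)
Lemma coM m n p (A : 'M[R[i]]_(m, n)) (M : 'M[R[i]]_(n, p)) k :
  co (A *m M) k = \sum_l
    (co A (k.1, (k.2.1, l)) * co M (true, (l, k.2.2)) +
     csign k.1 * co A (~~ k.1, (k.2.1, l)) * co M (false, (l, k.2.2))).
Proof.
case: k => [b [i j]]; rewrite /co /= mxE.
have -> : (if b then complex.Re (\sum_l A i l * M l j)
           else complex.Im (\sum_l A i l * M l j)) =
   \sum_l (if b then complex.Re (A i l * M l j) else complex.Im (A i l * M l j)).
  by case: b; elim/big_ind2 : _ => // x1 [? ?] x2 [? ?] /= -> ->.
apply: eq_bigr => l _; rewrite /csign; case: b => /=;
  case: (A i l) => a b; case: (M l j) => c d /=; ring.
Qed.

(** The l^1 norm on C = R^2 replaces the modulus: it is subadditive and submultiplicative by the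
    real triangle inequality, with no square roots. *)
Definition cabs (z : R[i]) : R := `|complex.Re z| + `|complex.Im z|.

Lemma cabs_ge0 z : 0 <= cabs z. Proof. by rewrite /cabs addr_ge0. Qed.

Lemma cabsD z w : cabs (z + w) <= cabs z + cabs w.
Proof.
case: z w => [a b] [c d]; rewrite /cabs /=.
have := ler_normD a c; have := ler_normD b d; lra.
Qed.

Lemma cabsM z w : cabs (z * w) <= cabs z * cabs w.
Proof.
case: z w => [a b] [c d]; rewrite /cabs /=.
have := ler_normB (a * c) (b * d); have := ler_normD (a * d) (b * c).
rewrite !normrM; lra.
Qed.

(** The l^1 norm of all real coordinates, chosen because it is submultiplicative with constant 1 for
    rectangular products and dominates each coordinate. *)
Definition nm {m n} (M : 'M[R[i]]_(m, n)) : R := \sum_i \sum_j cabs (M i j).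

Lemma nmE m n (M : 'M[R[i]]_(m, n)) : nm M = \sum_k `|co M k|.
Proof.
rewrite /nm pair_big /= -(pair_big predT predT (fun b ij => `|co M (b, ij)|)) /=.
rewrite exchange_big /=.
by apply: eq_bigr => -[i j] _; rewrite big_bool.
Qed.

Lemma nm_ge0 m n (M : 'M[R[i]]_(m, n)) : 0 <= nm M.
Proof. by rewrite nmE sumr_ge0. Qed.

Lemma co_le m n (M : 'M[R[i]]_(m, n)) k : `|co M k| <= nm M.
Proof. by rewrite nmE (bigD1 k) //= lerDl sumr_ge0. Qed.

Lemma nm0 m n : nm (0 : 'M[R[i]]_(m, n)) = 0.
Proof. by rewrite nmE big1 // => k _; rewrite co0 normr0. Qed.

Lemma nmD m n (M N : 'M[R[i]]_(m, n)) : nm (M + N) <= nm M + nm N.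
Proof.
by rewrite !nmE -big_split /= ler_sum // => k _; rewrite coD ler_normD.
Qed.

Lemma nmN m n (M : 'M[R[i]]_(m, n)) : nm (- M) = nm M.
Proof. by rewrite !nmE; apply: eq_bigr => k _; rewrite coN normrN. Qed.

Lemma nmB m n (M N : 'M[R[i]]_(m, n)) : nm (M - N) <= nm M + nm N.
Proof. by rewrite (le_trans (nmD _ _)) // nmN. Qed.

Lemma nm_tr m n (M : 'M[R[i]]_(m, n)) : nm M^T = nm M.
Proof.
rewrite /nm exchange_big; apply: eq_bigr => i _; apply: eq_bigr => j _.
by rewrite mxE.
Qed.

Lemma nm_le0 m n (M : 'M[R[i]]_(m, n)) : nm M <= 0 -> M = 0.
Proof.
move=> M0; apply: co_inj => k; rewrite co0; apply/eqP; rewrite -normr_le0.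
exact: le_trans (co_le _ _) M0.
Qed.

Lemma nmM m n p (A : 'M[R[i]]_(m, n)) (B : 'M[R[i]]_(n, p)) :
  nm (A *m B) <= nm A * nm B.
Proof.
rewrite {1}/nm.
apply: (@le_trans _ _ (\sum_i \sum_j \sum_l cabs (A i l) * cabs (B l j))).
  apply: ler_sum => i _; apply: ler_sum => j _; rewrite mxE.
  elim/big_ind2 : _ => [|x1 x2 y1 y2 h1 h2|l _].
  - by rewrite /cabs /= normr0 addr0.
  - by rewrite (le_trans (cabsD _ _)) // lerD.
  - exact: cabsM.
have -> : \sum_i \sum_j \sum_l cabs (A i l) * cabs (B l j) =
    \sum_l (\sum_i cabs (A i l)) * (\sum_j cabs (B l j)).
  rewrite (eq_bigr (fun i => \sum_l cabs (A i l) * \sum_j cabs (B l j))).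
    by rewrite exchange_big; apply: eq_bigr => l _; rewrite mulr_suml.
  move=> i _; rewrite exchange_big; apply: eq_bigr => l _.
  by rewrite mulr_sumr.
rewrite /nm [X in _ <= X * _]exchange_big /= mulr_suml ler_sum // => l _.
rewrite ler_wpM2l ?sumr_ge0 // => [i _|]; first exact: cabs_ge0.
by rewrite (bigD1 l) //= lerDl sumr_ge0 // => i _; rewrite sumr_ge0 // => j _;
  exact: cabs_ge0.
Qed.

Lemma nmS m n (M : 'M[R[i]]_(m, n)) d :
  (forall k, `|co M k| <= d) -> nm M <= (m * n).*2%:R * d.
Proof.
move=> Md; rewrite nmE (le_trans (ler_sum _ (fun k _ => Md k))) //.
rewrite sumr_const !card_prod card_bool !card_ord mulr_natl.
by rewrite mul2n.
Qed.

(** Cauchy-Schwarz over the 2mn real coordinates, through |xy| <= (x^2 + y^2)/2. With [absc2_le] it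
    makes [nm] equivalent to the Euclidean norm in which [L2norm] and [square_summable] are
    stated. *)
Lemma nm_sqr_le m n (M : 'M[R[i]]_(m, n)) :
  nm M ^+ 2 <= (m * n).*2%:R * \sum_i \sum_j absc2 (M i j).
Proof.
have -> : \sum_i \sum_j absc2 (M i j) = \sum_k co M k ^+ 2.
  rewrite pair_big /= -(pair_big predT predT (fun b ij => co M (b, ij) ^+ 2)).
  rewrite /= exchange_big /=.
  by apply: eq_bigr => -[i j] _; rewrite big_bool.
rewrite nmE expr2 mulr_suml.
apply: (@le_trans _ _ (\sum_k \sum_l (co M k ^+ 2 / 2 + co M l ^+ 2 / 2))).
  apply: ler_sum => k _; rewrite mulr_sumr; apply: ler_sum => l _.
  have := sqr_ge0 (`|co M k| - `|co M l|).
  rewrite sqrrB !real_normK ?num_real // => ?.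
  by rewrite -mulrDl ler_pdivlMr // mulr_natr -subr_ge0 addrAC.
rewrite (eq_bigr (fun k => (co M k ^+ 2 / 2) *+ (m * n).*2 +
   \sum_l (co M l ^+ 2 / 2))); last first.
  move=> k _; rewrite big_split /= sumr_const !card_prod card_bool !card_ord.
  by rewrite mul2n.
rewrite big_split /= sumr_const !card_prod card_bool !card_ord mul2n.
by rewrite sumrMnl -mulr_suml -mulrnDl -splitr mulr_natl.
Qed.

Lemma absc2_le m n (M : 'M[R[i]]_(m, n)) i j : absc2 (M i j) <= nm M ^+ 2.
Proof.
have h1 : cabs (M i j) <= nm M.
  rewrite /nm (bigD1 i) //= (bigD1 j) //= -addrA lerDl addr_ge0 ?sumr_ge0 //.
    by move=> *; exact: cabs_ge0.
  by move=> *; rewrite sumr_ge0 // => *; exact: cabs_ge0.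
apply: (@le_trans _ _ (cabs (M i j) ^+ 2)); last first.
  by rewrite ler_pXn2r // ?nnegrE ?cabs_ge0 ?nm_ge0.
rewrite /absc2 /cabs.
rewrite -(real_normK (num_real (complex.Re (M i j)))).
rewrite -(real_normK (num_real (complex.Im (M i j)))).
by rewrite sqrrD [leRHS]addrAC lerDl mulrn_wge0 ?mulr_ge0.
Qed.

Lemma absc2_ge0 (z : R[i]) : 0 <= absc2 z.
Proof. by rewrite /absc2 addr_ge0 ?sqr_ge0. Qed.

End Coordinates.

(** * Measurable and integrable matrix functions *)

Section Measurability.
Context {R : realType}.

(** Measurability on the whole space: functions given on an interval are first extended by zero, so
    that no domain has to be carried along. *)
Definition mxmeas {d} {X : measurableType d} {m n}
  (f : X -> 'M[R[i]]_(m, n)) := forall k, measurable_fun setT (fun x => co (f x) k).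

Lemma mx_measurableP d (X : measurableType d) m n (D : set X)
    (f : X -> 'M[R[i]]_(m, n)) :
  mx_measurable D f <-> forall k, measurable_fun D (fun x => co (f x) k).
Proof.
split=> [mf [[] [i j]]|mf i j]; [exact: (mf i j).1|exact: (mf i j).2|].
by split; [exact: (mf (true, (i, j)))|exact: (mf (false, (i, j)))].
Qed.

Context {d} {X : measurableType d}.

Lemma mxmeas_cst m n (M : 'M[R[i]]_(m, n)) : mxmeas (fun _ : X => M).
Proof. by move=> k; exact: measurable_cst. Qed.

Lemma mxmeasD m n (f g : X -> 'M[R[i]]_(m, n)) :
  mxmeas f -> mxmeas g -> mxmeas (fun x => f x + g x).
Proof.
move=> mf mg k; under eq_fun do rewrite coD; exact: measurable_funD.
Qed.

Lemma mxmeasN m n (f : X -> 'M[R[i]]_(m, n)) :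
  mxmeas f -> mxmeas (fun x => - f x).
Proof. move=> mf k; under eq_fun do rewrite coN; exact: measurable_funN. Qed.

Lemma mxmeasB m n (f g : X -> 'M[R[i]]_(m, n)) :
  mxmeas f -> mxmeas g -> mxmeas (fun x => f x - g x).
Proof. by move=> mf mg; apply: mxmeasD => //; exact: mxmeasN. Qed.

Lemma mxmeasM m n p (f : X -> 'M[R[i]]_(m, n)) (g : X -> 'M[R[i]]_(n, p)) :
  mxmeas f -> mxmeas g -> mxmeas (fun x => f x *m g x).
Proof.
move=> mf mg k; under eq_fun do rewrite coM.
apply: measurable_sum => l; apply: measurable_funD; apply: measurable_funM => //.
exact: measurable_funM.
Qed.

Lemma mxmeas_tr m n (f : X -> 'M[R[i]]_(m, n)) :
  mxmeas f -> mxmeas (fun x => (f x)^T).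
Proof. by move=> mf k; under eq_fun do rewrite co_tr; exact: mf. Qed.

Lemma mxmeas_if m n (b : X -> bool) (f g : X -> 'M[R[i]]_(m, n)) :
  measurable_fun setT b -> mxmeas f -> mxmeas g ->
  mxmeas (fun x => if b x then f x else g x).
Proof.
move=> mb mf mg k.
rewrite [X in measurable_fun _ X](_ : _ =
  (fun x => if b x then co (f x) k else co (g x) k)).
  exact: measurable_fun_ifT.
by apply/funext => x; case: (b x).
Qed.

Lemma mxmeas_comp d' (Y : measurableType d') m n (h : Y -> X)
    (f : X -> 'M[R[i]]_(m, n)) :
  measurable_fun setT h -> mxmeas f -> mxmeas (fun y => f (h y)).
Proof. by move=> mh mf k; exact: (measurableT_comp (mf k) mh). Qed.

Lemma measurable_co_norm m n (f : X -> 'M[R[i]]_(m, n)) k :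
  mxmeas f -> measurable_fun setT (fun x => `|co (f x) k|).
Proof. by move=> mf; apply: measurableT_comp => //; exact: mf. Qed.

Lemma measurable_nm m n (f : X -> 'M[R[i]]_(m, n)) :
  mxmeas f -> measurable_fun setT (fun x => nm (f x)).
Proof.
move=> mf; under eq_fun do rewrite nmE.
by apply: measurable_sum => k; apply: measurableT_comp => //; exact: (mf k).
Qed.

Lemma mxmeas_cvg m n (u : nat -> X -> 'M[R[i]]_(m, n)) f :
  (forall k, mxmeas (u k)) ->
  (forall x k, (fun n => co (u n x) k) @ \oo --> co (f x) k) -> mxmeas f.
Proof.
move=> mu cu k.
apply: (measurable_fun_cvg (h := fun n x => co (u n x) k)) => [l|x _].
  exact: mu.
exact: cu.
Qed.

End Measurability.

(** * Entrywise integrals over the line *)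

Section Integral.
Context {R : realType}.
Local Notation mu := (@lebesgue_measure R).

Definition Int {m n} (f : R -> 'M[R[i]]_(m, n)) := mx_integral setT f.

Lemma measurable_EFinT d (X : measurableType d) (g : X -> R) :
  measurable_fun setT g -> measurable_fun setT (fun x => (g x)%:E).
Proof. by move=> mg; apply/measurable_EFinP. Qed.

Lemma co_Int m n (f : R -> 'M[R[i]]_(m, n)) k :
  co (Int f) k = \int[mu]_x co (f x) k.
Proof. by case: k => [[] [i j]]; rewrite /Int /co mxE. Qed.

Definition L1 {m n} (f : R -> 'M[R[i]]_(m, n)) :=
  mxmeas f /\ (\int[mu]_x (nm (f x))%:E < +oo)%E.

Lemma L1_co m n (f : R -> 'M[R[i]]_(m, n)) k : L1 f ->
  mu.-integrable setT (EFin \o (fun x => co (f x) k)).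
Proof.
move=> [mf fi]; apply/integrableP; split; first by apply/measurable_EFinP; exact: (mf k).
apply: le_lt_trans fi; apply: ge0_le_integral => //=.
- by apply: measurable_EFinT; exact: measurable_co_norm.
- by apply: measurable_EFinT; exact: measurable_nm.
- by move=> x _; rewrite lee_fin co_le.
Qed.

Lemma L1P m n (f : R -> 'M[R[i]]_(m, n)) :
  L1 f <-> forall k, mu.-integrable setT (EFin \o (fun x => co (f x) k)).
Proof.
split=> [fi k|fi]; first exact: L1_co.
have mf : mxmeas f by move=> k; apply/measurable_EFinP; exact: measurable_int (fi k).
split=> //.
under eq_integral do rewrite nmE -sumEFin.
rewrite ge0_integral_sum //=; last first.
  by move=> k; apply: measurable_EFinT; exact: measurable_co_norm.
apply: lte_sum_pinfty => k _.
by have /integrableP[] := fi k.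
Qed.

Lemma eq_Int m n (f g : R -> 'M[R[i]]_(m, n)) : f =1 g -> Int f = Int g.
Proof. by move=> fg; congr Int; apply/funext. Qed.

Lemma Int0 m n : Int (fun _ => 0 : 'M[R[i]]_(m, n)) = 0.
Proof.
apply: co_inj => k; rewrite co_Int co0.
by rewrite Rintegral_cst // mul0r.
Qed.

Lemma IntD m n (f g : R -> 'M[R[i]]_(m, n)) : L1 f -> L1 g ->
  Int (fun x => f x + g x) = Int f + Int g.
Proof.
move=> fi gi; apply: co_inj => k; rewrite coD !co_Int.
under eq_Rintegral do rewrite coD.
by rewrite RintegralD //; exact: L1_co.
Qed.

Lemma IntN m n (f : R -> 'M[R[i]]_(m, n)) : L1 f ->
  Int (fun x => - f x) = - Int f.
Proof.
move=> fi; apply: co_inj => k; rewrite coN !co_Int.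
under eq_Rintegral do rewrite coN -mulN1r.
by rewrite RintegralZl ?mulN1r //; exact: L1_co.
Qed.

Lemma L1D m n (f g : R -> 'M[R[i]]_(m, n)) : L1 f -> L1 g ->
  L1 (fun x => f x + g x).
Proof.
move=> /L1P fi /L1P gi; apply/L1P => k.
rewrite [X in _.-integrable _ X](_ : _ =
  ((EFin \o (fun x => co (f x) k)) \+ (EFin \o (fun x => co (g x) k)))%E).
  exact: integrableD.
by apply/funext => x /=; rewrite coD.
Qed.

Lemma L1N m n (f : R -> 'M[R[i]]_(m, n)) : L1 f -> L1 (fun x => - f x).
Proof.
move=> [mf fi]; split; first exact: mxmeasN.
by under eq_integral do rewrite nmN.
Qed.

Lemma L1B m n (f g : R -> 'M[R[i]]_(m, n)) : L1 f -> L1 g ->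
  L1 (fun x => f x - g x).
Proof. by move=> fi gi; apply: L1D => //; exact: L1N. Qed.

Lemma IntB m n (f g : R -> 'M[R[i]]_(m, n)) : L1 f -> L1 g ->
  Int (fun x => f x - g x) = Int f - Int g.
Proof. by move=> fi gi; rewrite IntD ?IntN //; exact: L1N. Qed.

Lemma nm_Int m n (f : R -> 'M[R[i]]_(m, n)) : mxmeas f ->
  ((nm (Int f))%:E <= \int[mu]_x (nm (f x))%:E)%E.
Proof.
move=> mf; have [fi|] := ltP (\int[mu]_x (nm (f x))%:E)%E +oo%E; last first.
  by rewrite leye_eq => /eqP ->; rewrite leey.
rewrite nmE; under eq_integral do rewrite nmE -sumEFin.
rewrite ge0_integral_sum //=; last first.
  by move=> k; apply: measurable_EFinT; exact: measurable_co_norm.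
rewrite -sumEFin; apply: lee_sum => k _; rewrite co_Int.
have fk := L1_co k (conj mf fi).
rewrite EFin_normr_Rintegral //; apply: le_abse_integral => //.
exact: measurable_int fk.
Qed.

Lemma Rintegral_sum (I : finType) (f : I -> R -> R) :
  (forall l, mu.-integrable setT (EFin \o f l)) ->
  \int[mu]_x (\sum_l f l x) = \sum_l \int[mu]_x f l x.
Proof.
move=> fi; rewrite /Rintegral.
under eq_integral do rewrite -sumEFin.
rewrite integral_sum // -sum_fine // => l _.
exact: integrable_fin_num (fi l).
Qed.

Lemma L1Ml m n p (A : 'M[R[i]]_(m, n)) (f : R -> 'M[R[i]]_(n, p)) :
  L1 f -> L1 (fun x => A *m f x).
Proof.
move=> [mf fi]; split; first exact: mxmeasM (mxmeas_cst _) mf.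
apply: (@le_lt_trans _ _ (\int[mu]_x ((nm A)%:E * (nm (f x))%:E))%E).
  apply: ge0_le_integral => //=.
  - by move=> x _; rewrite lee_fin nm_ge0.
  - by apply: measurable_EFinT; apply: measurable_nm; exact: mxmeasM (mxmeas_cst _) mf.
  - apply: measurable_funeM; apply: measurable_EFinT; exact: measurable_nm.
  - by move=> x _; rewrite -EFinM lee_fin nmM.
rewrite ge0_integralZl_EFin ?nm_ge0 //.
- by rewrite lte_mul_pinfty // lee_fin nm_ge0.
- by move=> x _; rewrite lee_fin nm_ge0.
- apply: measurable_EFinT; exact: measurable_nm.
Qed.

Lemma IntMl m n p (A : 'M[R[i]]_(m, n)) (f : R -> 'M[R[i]]_(n, p)) :
  L1 f -> Int (fun x => A *m f x) = A *m Int f.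
Proof.
move=> fi; apply: co_inj => k; rewrite co_Int coM.
under eq_Rintegral do rewrite coM.
have fZ c j : mu.-integrable setT (EFin \o (fun x => c * co (f x) j)).
  rewrite [X in _.-integrable _ X](_ : _ =
    (fun x => c%:E * (EFin \o (fun x => co (f x) j)) x)%E) //.
  by apply: integrableZl => //; exact: L1_co.
rewrite Rintegral_sum => [|l]; last first.
  exact: (integrableD measurableT (fZ (co A (k.1, (k.2.1, l))) (true, (l, k.2.2)))
    (fZ (csign k.1 * co A (~~ k.1, (k.2.1, l))) (false, (l, k.2.2)))).
apply: eq_bigr => l _.
by rewrite RintegralD // !RintegralZl //; try exact: L1_co; rewrite !co_Int.
Qed.

(** Transposition turns the statements about left multiplication into those about right
    multiplication. *)
Lemma Int_tr m n (f : R -> 'M[R[i]]_(m, n)) : Int (fun x => (f x)^T) = (Int f)^T.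
Proof.
apply: co_inj => k; rewrite co_Int co_tr co_Int.
by under eq_Rintegral do rewrite co_tr.
Qed.

Lemma L1_tr m n (f : R -> 'M[R[i]]_(m, n)) : L1 f -> L1 (fun x => (f x)^T).
Proof.
move=> [mf fi]; split; first exact: mxmeas_tr.
by under eq_integral do rewrite nm_tr.
Qed.

Lemma L1Mr m n p (A : 'M[R[i]]_(n, p)) (f : R -> 'M[R[i]]_(m, n)) :
  L1 f -> L1 (fun x => f x *m A).
Proof.
move=> /L1_tr /(L1Ml A^T) /L1_tr.
by under eq_fun do rewrite trmx_mul !trmxK.
Qed.

Lemma IntMr m n p (A : 'M[R[i]]_(n, p)) (f : R -> 'M[R[i]]_(m, n)) :
  L1 f -> Int (fun x => f x *m A) = Int f *m A.
Proof.
move=> fi; apply: trmx_inj; rewrite -Int_tr trmx_mul -Int_tr -IntMl.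
  by apply: eq_Int => x; rewrite trmx_mul.
exact: L1_tr.
Qed.

Lemma eq_Int_ae m n (f g : R -> 'M[R[i]]_(m, n)) : mxmeas f -> mxmeas g ->
  ae_eq mu setT f g -> Int f = Int g.
Proof.
move=> mf mg fg; apply: co_inj => k; rewrite !co_Int /Rintegral; congr fine.
apply: ae_eq_integral => //; try by apply/measurable_EFinP; first [exact: (mf k)|exact: (mg k)].
by apply: filterS fg => x /= fgx _; rewrite fgx.
Qed.

Lemma aeS (P Q : R -> Prop) : (forall x, P x -> Q x) ->
  {ae mu, forall x, P x} -> {ae mu, forall x, Q x}.
Proof.
move=> PQ [N [mN N0 PN]]; exists N; split => // x /= nQ.
by apply: PN => /= /PQ.
Qed.

Lemma ae_neq (c : R) : {ae mu, forall x, x != c}.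
Proof.
exists [set c]; split => //.
  by rewrite lebesgue_measure_set1.
by move=> x /= /negP; rewrite negbK => /eqP.
Qed.

(** Tonelli makes the parameter integrals of the positive and negative parts measurable. The
    integral is the finite part of their difference, also where a section is not integrable. *)
Lemma mxmeas_Int d (X : measurableType d) m n (f : X * R -> 'M[R[i]]_(m, n)) :
  mxmeas f -> mxmeas (fun x => Int (fun y => f (x, y))).
Proof.
move=> mf k.
pose g (z : X * R) := (co (f z) k)%:E.
have mg : measurable_fun setT g by apply: measurable_EFinT; exact: mf.
have -> : (fun x => co (Int (fun y => f (x, y))) k) = fine \o (fun x =>
    (\int[mu]_y (g^\+ (x, y)) - \int[mu]_y (g^\- (x, y)))%E).
  apply/funext => x /=; rewrite co_Int /Rintegral; congr fine.
  rewrite [LHS]integralE.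
  by congr (_ - _)%E; apply: eq_integral => y _; rewrite ?funeposE ?funenegE.
apply: measurableT_comp => //.
apply: emeasurable_funB.
- apply: (measurable_fun_fubini_tonelli_F (m2 := mu) g^\+)%E => //.
  exact: measurable_funepos.
- apply: (measurable_fun_fubini_tonelli_F (m2 := mu) g^\-)%E => //.
  exact: measurable_funeneg.
Qed.

(** Fubini for extended integrals, with a correction: the inner real integral is the finite part of
    the extended one, and the two are known to agree only for almost every section, where the
    section is integrable. *)
Lemma Rintegral_Fubini (f : R * R -> R) :
  (mu \x mu)%E.-integrable setT (EFin \o f) ->
  \int[mu]_x (\int[mu]_y f (x, y)) = \int[mu]_y (\int[mu]_x f (x, y)).
Proof.
move=> fi; rewrite /Rintegral; congr fine.
have h1 : (\int[mu]_x (fine (\int[mu]_y (f (x, y))%:E))%:E =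
    \int[mu]_x \int[mu]_y (f (x, y))%:E)%E.
  apply: ae_eq_integral => //.
  - apply/measurable_EFinP; apply: measurableT_comp => //.
    exact: measurable_fubini_F fi.
  - exact: measurable_fubini_F fi.
  - have := ae_integrable1 fi; apply: filterS => x /= fx _.
    by rewrite fineK //; exact: integrable_fin_num fx.
have h2 : (\int[mu]_y (fine (\int[mu]_x (f (x, y))%:E))%:E =
    \int[mu]_y \int[mu]_x (f (x, y))%:E)%E.
  apply: ae_eq_integral => //.
  - apply/measurable_EFinP; apply: measurableT_comp => //.
    exact: measurable_fubini_G fi.
  - exact: measurable_fubini_G fi.
  - have := ae_integrable2 fi; apply: filterS => x /= fx _.
    by rewrite fineK //; exact: integrable_fin_num fx.
by rewrite h1 h2; exact: Fubini fi.
Qed.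

Lemma Int_Fubini m n (f : R * R -> 'M[R[i]]_(m, n)) : mxmeas f ->
  (\int[mu]_x \int[mu]_y (nm (f (x, y)))%:E < +oo)%E ->
  Int (fun x => Int (fun y => f (x, y))) = Int (fun y => Int (fun x => f (x, y))).
Proof.
move=> mf fi; apply: co_inj => k; rewrite [LHS]co_Int [RHS]co_Int.
under eq_Rintegral do rewrite co_Int.
under [in RHS]eq_Rintegral do rewrite co_Int.
apply: (Rintegral_Fubini (f := fun z => co (f z) k)).
apply/integrable12ltyP; first by apply/measurable_EFinP; exact: (mf k).
apply: le_lt_trans fi.
have mnm : measurable_fun setT (fun z => (nm (f z))%:E).
  apply: measurable_EFinT; exact: measurable_nm.
have mco : measurable_fun setT (fun z => (`|co (f z) k|)%:E).
  by apply: measurable_EFinT; exact: measurable_co_norm.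
apply: ge0_le_integral => //=.
- by move=> x _; apply: integral_ge0.
- exact: (measurable_fun_fubini_tonelli_F (m2 := mu) (fun z => `|co (f z) k|%:E)).
- apply: (measurable_fun_fubini_tonelli_F (m2 := mu) (fun z => (nm (f z))%:E)) => //.
  by move=> z; rewrite lee_fin nm_ge0.
- move=> x _; apply: ge0_le_integral => //=.
  + exact: (measurableT_comp mco).
  + exact: (measurableT_comp mnm).
  + by move=> y _; rewrite lee_fin co_le.
Qed.

Lemma measurable_reflection (c : R) :
  measurable_fun setT ((fun x => c - x) : measurableTypeR R -> measurableTypeR R).
Proof. exact: measurable_funB. Qed.

(** By uniqueness of the measure that gives ]a, b] its length: the preimage [c - b, c - a[ has the
    same length. Reflections suffice, because a translation is the composite of two of them. *)
Lemma lebesgue_measure_reflection (c : R) (A : set R) : measurable A ->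
  pushforward mu ((fun x => c - x) : measurableTypeR R -> measurableTypeR R) A =
  mu A.
Proof.
move=> mA; apply/esym/(@lebesgue_measure_unique _
  (measure_function_pushforward__canonical__measure_function_Measure mu
    (measurable_reflection c))) => //= _ [[a b]] _ <-.
rewrite /pushforward /=.
have -> : (fun x => c - x) @^-1` `]a, b] = `[c - b, c - a[%classic :> set R.
  by apply/seteqP; split => x /=; rewrite !in_itv /=;
    move=> /andP[h1 h2]; apply/andP; split; lra.
rewrite !lebesgue_measure_itv/= !lte_fin ltrD2l ltrN2; case: ifP => // _.
by rewrite -!EFinD; congr EFin; ring.
Qed.

Lemma integral_reflection (c : R) (g : R -> \bar R) :
  measurable_fun setT g -> (forall x, 0 <= g x)%E ->
  (\int[mu]_x g x = \int[mu]_x g (c - x)%R)%E.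
Proof.
move=> mg g0.
transitivity (\int[pushforward mu
    ((fun x => c - x)%R : measurableTypeR R -> measurableTypeR R)]_x g x)%E.
  apply: eq_measure_integral; first exact: measurable_reflection.
  by move=> mc A mA _; exact/esym/lebesgue_measure_reflection.
by apply: (ge0_integral_pushforward (measurable_reflection c) mu measurableT).
Qed.

Lemma Int_reflection m n (c : R) (f : R -> 'M[R[i]]_(m, n)) : mxmeas f ->
  Int f = Int (fun x => f (c - x)).
Proof.
move=> mf; apply: co_inj => k; rewrite !co_Int /Rintegral; congr fine.
pose g x := (co (f x) k)%:E.
have mg : measurable_fun setT g by apply: measurable_EFinT; exact: mf.
have mgp : measurable_fun setT g^\+%E by exact: measurable_funepos.
have mgn : measurable_fun setT g^\-%E by exact: measurable_funeneg.
rewrite integralE [RHS]integralE; congr (_ - _)%E.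
- rewrite (integral_reflection c mgp) //.
  by apply: eq_integral => x _; rewrite ?funeposE.
- rewrite (integral_reflection c mgn) //.
  by apply: eq_integral => x _; rewrite ?funenegE.
Qed.

End Integral.

(** * Integrals of nonnegative functions and exponential weights *)

Section RealIntegrals.
Context {R : realType}.
Local Notation mu := (@lebesgue_measure R).

Implicit Types (g h : R -> R) (c : R).

Definition EI (g : R -> R) : \bar R := (\int[mu]_x (g x)%:E)%E.

Lemma EI_ge0 g : (forall x, 0 <= g x) -> (0 <= EI g)%E.
Proof. by move=> g0; apply: integral_ge0 => x _; rewrite lee_fin. Qed.

Lemma EI_le g h : measurable_fun setT g -> measurable_fun setT h ->
  (forall x, 0 <= g x <= h x) -> (EI g <= EI h)%E.
Proof.
move=> mg mh gh; apply: ge0_le_integral => //.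
- by move=> x _; rewrite lee_fin; case/andP: (gh x).
- exact: measurable_EFinT.
- exact: measurable_EFinT.
- by move=> x _; rewrite lee_fin; case/andP: (gh x).
Qed.

Lemma EI_D g h : measurable_fun setT g -> measurable_fun setT h ->
  (forall x, 0 <= g x) -> (forall x, 0 <= h x) ->
  EI (fun x => g x + h x) = (EI g + EI h)%E.
Proof.
move=> mg mh g0 h0; rewrite /EI -ge0_integralD //.
- by move=> x _; rewrite lee_fin.
- exact: measurable_EFinT.
- by move=> x _; rewrite lee_fin.
- exact: measurable_EFinT.
Qed.

Lemma EI_Z c g : measurable_fun setT g -> (forall x, 0 <= g x) -> 0 <= c ->
  EI (fun x => c * g x) = (c%:E * EI g)%E.
Proof.
move=> mg g0 c0; rewrite /EI -ge0_integralZl_EFin //.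
- by move=> x _; rewrite lee_fin.
- exact: measurable_EFinT.
Qed.

Lemma EI_reflection c g : measurable_fun setT g -> (forall x, 0 <= g x) ->
  EI g = EI (fun x => g (c - x)).
Proof.
move=> mg g0; rewrite /EI (@integral_reflection _ c) //.
exact: measurable_EFinT.
Qed.

Lemma EI_shift c g : measurable_fun setT g -> (forall x, 0 <= g x) ->
  EI (fun x => g (x - c)) = EI g.
Proof.
move=> mg g0; rewrite (EI_reflection 0 mg g0).
rewrite (@EI_reflection c) //.
  by congr EI; apply/funext => x; congr g; ring.
by apply: (measurableT_comp mg); exact: measurable_funB.
Qed.

Lemma EI_itv c (T : R) : 0 <= T -> 0 <= c ->
  EI (fun x => if 0 <= x <= T then c else 0) = (c * T)%:E.
Proof.
move=> T0 c0; rewrite /EI.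
transitivity (\int[mu]_(x in `[0%R, T]) c%:E)%E.
  rewrite [RHS]integral_mkcond; apply: eq_integral => x _.
  rewrite patchE; case: ifPn => [xT|]; first by rewrite mem_set //= in_itv.
  by move=> xT; rewrite memNset //= in_itv /=; exact/negP.
rewrite integral_cst //= lebesgue_measure_itv /= lte_fin.
have [_|] := ltP 0 T; first by rewrite oppr0 addr0 EFinM.
by move=> T0'; rewrite mule0 (_ : T = 0) ?mulr0 //; apply/le_anti/andP.
Qed.

Lemma measurable_itv_bool d (X : measurableType d) (f g : X -> R) :
  measurable_fun setT f -> measurable_fun setT g ->
  measurable_fun setT (fun x => 0 <= f x <= g x).
Proof. by move=> mf mg; apply: measurable_and; exact: measurable_fun_ler. Qed.

(** The origin of every contraction below, with w(x) = exp(la x) on [0, T]. Since h is only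
    square-integrable, 2uv <= u^2 + v^2 is used to bound h(t)exp(la t) by exp(la x) times the sum of
    h(t)^2/(2 la) and (la/2)exp(-2 la(x - t)). The first term has a small integral for large la, the
    second an integral of at most 1/4. *)
Lemma exp_weight (T : R) (h : R -> R) : 0 <= T -> measurable_fun setT h ->
  (forall x, 0 <= h x) -> (forall x, ~~ (0 <= x <= T) -> h x = 0) ->
  (EI (fun x => h x ^+ 2)%R < +oo)%E ->
  exists w : R -> R, [/\ measurable_fun setT w,
    forall x, 1 <= w x, exists C, forall x, w x <= C &
    forall x, (EI (fun t => if (0 <= t <= x)%R then h t * w t else 0)%R
               <= (w x / 2)%:E)%E].
Proof.
move=> T0 mh h0 hT h2.
have h20 : (0 <= EI (fun x => h x ^+ 2)%R)%E by apply: EI_ge0 => x; exact: sqr_ge0.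
pose S := fine (EI (fun x => h x ^+ 2)).
have SE : EI (fun x => h x ^+ 2) = S%:E by rewrite fineK // ge0_fin_numE.
have S0 : 0 <= S by exact: fine_ge0.
(* With this rate S/(2 la) + 1/4 <= 1/2, the slack being exactly 1/(2 la). *)
pose la := 2 * (S + 1).
have la0 : 0 < la by rewrite /la; lra.
(* Clamping x to [0, T] gives a weight that is defined on the whole line and bounded. *)
pose cl x := Num.min (Num.max x 0) T.
have cl0 x : 0 <= cl x.
  by rewrite /cl le_min T0 andbT le_max lexx orbT.
have clT x : cl x <= T by rewrite /cl ge_min lexx orbT.
exists (fun x => expR (la * cl x)); split.
- apply: measurableT_comp => //; apply: measurable_funM => //.
  by apply: measurable_minr => //; exact: measurable_maxr.
- by move=> x; rewrite -expR0 ler_expR mulr_ge0 // ltW.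
- by exists (expR (la * T)) => x; rewrite ler_expR ler_wpM2l // ltW.
move=> x.
set W := expR _.
(* The exponential density of rate 2 la, reflected at [cl x]: its total mass 1 supplies the integral
   of exp(-2 la(x - t)). *)
pose pd t := exponential_pdf (2 * la) (cl x - t).
have mpd : measurable_fun setT pd.
  apply: measurableT_comp; first exact: measurable_exponential_pdf.
  exact: measurable_funB.
have pd0 t : 0 <= pd t by rewrite exponential_pdf_ge0 // mulr_ge0 // ltW.
have Epd : EI pd = 1%E.
  rewrite -(@integral_exponential_pdf R (2 * la)); last by rewrite mulr_gt0.
  rewrite [RHS](@EI_reflection (cl x)) //.
    exact: measurable_exponential_pdf.
  by move=> t; rewrite exponential_pdf_ge0 // mulr_ge0 // ltW.
have mh2 : measurable_fun setT (fun t => h t ^+ 2) by exact: measurable_funX.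
have mW : measurable_fun setT (fun t => W * (la^-1 / 2 * h t ^+ 2 + 1 / 4 * pd t)).
  by apply: measurable_funM => //; apply: measurable_funD; exact: measurable_funM.
apply: (@le_trans _ _ (EI (fun t => W * (la^-1 / 2 * h t ^+ 2 + 1 / 4 * pd t)))).
  apply: EI_le => //.
    apply: measurable_fun_ifT => //; first exact: measurable_itv_bool.
    apply: measurable_funM => //; apply: measurableT_comp => //.
    apply: measurable_funM => //.
    by apply: measurable_minr => //; exact: measurable_maxr.
  move=> t; case: ifPn => [/andP[t0 tx]|_]; last first.
    rewrite lexx /= mulr_ge0 ?expR_ge0 // addr_ge0 // mulr_ge0 ?sqr_ge0 //.
    by rewrite divr_ge0 // invr_ge0 ltW.
  rewrite mulr_ge0 ?expR_ge0 //=.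
  have [tT|tT] := boolP (0 <= t <= T); last first.
    rewrite hT // mul0r expr0n /= mulr0 add0r mulr_ge0 ?expR_ge0 //.
    by rewrite mulr_ge0.
  case/andP: tT => t0' tT.
  have clt : cl t = t by rewrite /cl max_l // min_l.
  have tcl : t <= cl x.
    by rewrite /cl le_min tT andbT le_max tx.
  rewrite clt /pd exponential_pdfE ?subr_ge0 //.
  have -> : expR (la * t) = W * expR (la * (t - cl x)).
    by rewrite -expRD; congr expR; ring.
  have -> : expR (- (2 * la) * (cl x - t)) = expR (la * (t - cl x)) ^+ 2.
    by rewrite expr2 -expRD; congr expR; ring.
  rewrite mulrCA ler_wpM2l ?expR_ge0 //.
  set e := expR _.
  have := sqr_ge0 (h t - la * e); rewrite -subr_ge0.
  have -> : la^-1 / 2 * h t ^+ 2 + 1 / 4 * (2 * la * e ^+ 2) - h t * e =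
     la^-1 / 2 * (h t - la * e) ^+ 2 by field; exact: lt0r_neq0.
  by move=> ?; rewrite mulr_ge0 // divr_ge0 // invr_ge0 ltW.
have q0 t : 0 <= la^-1 / 2 * h t ^+ 2.
  by rewrite mulr_ge0 ?sqr_ge0 // divr_ge0 // invr_ge0 ltW.
have q1 t : 0 <= 1 / 4 * pd t by rewrite mulr_ge0.
rewrite EI_Z ?expR_ge0 //; last 2 first.
- by apply: measurable_funD; exact: measurable_funM.
- by move=> t; rewrite addr_ge0.
rewrite EI_D //; [|exact: measurable_funM|exact: measurable_funM].
rewrite !EI_Z // ?sqr_ge0 //; last first.
- by rewrite divr_ge0 // invr_ge0 ltW.
- by move=> t; exact: sqr_ge0.
rewrite SE Epd mule1 -!EFinM lee_fin.
rewrite ler_wpM2l ?expR_ge0 // -subr_ge0.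
have -> : 2^-1 - (la^-1 / 2 * S + 1 / 4) = la^-1 / 2 by rewrite /la; field; lra.
by rewrite divr_ge0 // invr_ge0 ltW.
Qed.

End RealIntegrals.

(** * Bounded and square-summable matrix functions *)

Section Bounded.
Context {R : realType}.

(** Bounded at every point rather than essentially, because fixed points and kernels are compared
    pointwise. *)
Definition Bdd {d} {X : measurableType d} {m n} (f : X -> 'M[R[i]]_(m, n)) :=
  mxmeas f /\ exists C, forall x, nm (f x) <= C.

Context {d} {X : measurableType d}.

Lemma BddP m n (f : X -> 'M[R[i]]_(m, n)) : Bdd f ->
  exists2 C, 0 <= C & forall x, nm (f x) <= C.
Proof.
move=> [_ [C fC]]; exists `|C| => // x.
exact: le_trans (fC x) (ler_norm _).
Qed.

Lemma Bdd_cst m n (M : 'M[R[i]]_(m, n)) : Bdd (fun _ : X => M).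
Proof. by split; [exact: mxmeas_cst|exists (nm M)]. Qed.

Lemma BddD m n (f g : X -> 'M[R[i]]_(m, n)) :
  Bdd f -> Bdd g -> Bdd (fun x => f x + g x).
Proof.
move=> [mf [C fC]] [mg [D gD]]; split; first exact: mxmeasD.
by exists (C + D) => x; rewrite (le_trans (nmD _ _)) // lerD.
Qed.

Lemma BddN m n (f : X -> 'M[R[i]]_(m, n)) : Bdd f -> Bdd (fun x => - f x).
Proof.
move=> [mf [C fC]]; split; first exact: mxmeasN.
by exists C => x; rewrite nmN.
Qed.

Lemma BddB m n (f g : X -> 'M[R[i]]_(m, n)) :
  Bdd f -> Bdd g -> Bdd (fun x => f x - g x).
Proof. by move=> bf bg; apply: BddD => //; exact: BddN. Qed.

Lemma BddM m n p (f : X -> 'M[R[i]]_(m, n)) (g : X -> 'M[R[i]]_(n, p)) :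
  Bdd f -> Bdd g -> Bdd (fun x => f x *m g x).
Proof.
move=> bf bg; have [C C0 fC] := BddP bf; have [D D0 gD] := BddP bg.
split; first exact: mxmeasM bf.1 bg.1.
by exists (C * D) => x; rewrite (le_trans (nmM _ _)) // ler_pM ?nm_ge0.
Qed.

Lemma Bdd_tr m n (f : X -> 'M[R[i]]_(m, n)) : Bdd f -> Bdd (fun x => (f x)^T).
Proof.
move=> [mf [C fC]]; split; first exact: mxmeas_tr.
by exists C => x; rewrite nm_tr.
Qed.

Lemma Bdd_if m n (b : X -> bool) (f : X -> 'M[R[i]]_(m, n)) :
  measurable_fun setT b -> Bdd f -> Bdd (fun x => if b x then f x else 0).
Proof.
move=> mb bf; split; first by apply: mxmeas_if (mxmeas_cst _) => //; exact: bf.1.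
have [C C0 fC] := BddP bf.
by exists C => x; case: (b x); rewrite ?nm0.
Qed.

Lemma Bdd_comp d' (Y : measurableType d') m n (h : Y -> X)
    (f : X -> 'M[R[i]]_(m, n)) :
  measurable_fun setT h -> Bdd f -> Bdd (fun y => f (h y)).
Proof.
by move=> mh [mf [C fC]]; split; [exact: mxmeas_comp|exists C].
Qed.

End Bounded.

Section Integrable.
Context {R : realType}.
Implicit Types (g h : R -> R) (T : R).

Lemma EI_fin g h : measurable_fun setT g -> measurable_fun setT h ->
  (forall x, 0 <= g x <= h x) -> (EI h < +oo)%E -> (EI g < +oo)%E.
Proof. by move=> mg mh gh; apply: le_lt_trans; exact: EI_le. Qed.

Lemma EI_finD g h : measurable_fun setT g -> measurable_fun setT h ->
  (forall x, 0 <= g x) -> (forall x, 0 <= h x) ->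
  (EI g < +oo)%E -> (EI h < +oo)%E -> (EI (fun x => g x + h x)%R < +oo)%E.
Proof. by move=> mg mh g0 h0 gi hi; rewrite EI_D // lte_add_pinfty. Qed.

Lemma EI_finZ (c : R) g : measurable_fun setT g -> (forall x, 0 <= g x) ->
  0 <= c -> (EI g < +oo)%E -> (EI (fun x => c * g x)%R < +oo)%E.
Proof. by move=> mg g0 c0 gi; rewrite EI_Z // lte_mul_pinfty // lee_fin. Qed.

Lemma L1_dom m n (f : R -> 'M[R[i]]_(m, n)) g : mxmeas f ->
  measurable_fun setT g -> (forall x, nm (f x) <= g x) -> (EI g < +oo)%E -> L1 f.
Proof.
move=> mf mg fg gi; split=> //; apply: (@EI_fin (fun x => nm (f x)) g) => //.
  exact: measurable_nm.
by move=> x; rewrite nm_ge0 fg.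
Qed.

Lemma L1_cut m n (b : R -> bool) (f : R -> 'M[R[i]]_(m, n)) :
  measurable_fun setT b -> L1 f -> L1 (fun x => if b x then f x else 0).
Proof.
move=> mb [mf fi]; apply: (L1_dom (g := fun x => nm (f x))) => //.
- by apply: mxmeas_if => //; exact: mxmeas_cst.
- exact: measurable_nm.
- by move=> x; case: (b x); rewrite ?nm0 ?nm_ge0.
Qed.

Lemma L1_BddMl m n p (f : R -> 'M[R[i]]_(m, n)) (g : R -> 'M[R[i]]_(n, p)) :
  Bdd f -> L1 g -> L1 (fun x => f x *m g x).
Proof.
move=> bf [mg gi]; have [C C0 fC] := BddP bf.
apply: (L1_dom (g := fun x => C * nm (g x))).
- exact: mxmeasM bf.1 mg.
- by apply: measurable_funM => //; exact: measurable_nm.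
- by move=> x; rewrite (le_trans (nmM _ _)) // ler_wpM2r ?nm_ge0.
- by apply: EI_finZ => // [|x]; [exact: measurable_nm|exact: nm_ge0].
Qed.

Lemma L1_BddMr m n p (f : R -> 'M[R[i]]_(m, n)) (g : R -> 'M[R[i]]_(n, p)) :
  L1 f -> Bdd g -> L1 (fun x => f x *m g x).
Proof.
move=> /L1_tr fi /Bdd_tr bg; have := L1_tr (L1_BddMl bg fi).
by under eq_fun do rewrite trmx_mul !trmxK.
Qed.

Definition Sq {m n} (f : R -> 'M[R[i]]_(m, n)) :=
  mxmeas f /\ (EI (fun x => nm (f x) ^+ 2)%R < +oo)%E.

Lemma measurable_nm2 d (X : measurableType d) m n (f : X -> 'M[R[i]]_(m, n)) :
  mxmeas f -> measurable_fun setT (fun x => nm (f x) ^+ 2).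
Proof. by move=> mf; apply: measurable_funX; exact: measurable_nm. Qed.

Lemma Sq_dom m n (f : R -> 'M[R[i]]_(m, n)) g : mxmeas f ->
  measurable_fun setT g -> (forall x, nm (f x) ^+ 2 <= g x) ->
  (EI g < +oo)%E -> Sq f.
Proof.
move=> mf mg fg gi; split=> //.
apply: (@EI_fin (fun x => nm (f x) ^+ 2) g) => //.
  exact: measurable_nm2.
by move=> x; rewrite sqr_ge0 fg.
Qed.

Lemma SqD m n (f g : R -> 'M[R[i]]_(m, n)) : Sq f -> Sq g ->
  Sq (fun x => f x + g x).
Proof.
move=> [mf fi] [mg gi].
apply: (Sq_dom (g := fun x => 2 * nm (f x) ^+ 2 + 2 * nm (g x) ^+ 2)).
- exact: mxmeasD.
- by apply: measurable_funD; apply: measurable_funM => //; exact: measurable_nm2.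
- move=> x; apply: (@le_trans _ _ ((nm (f x) + nm (g x)) ^+ 2)).
    by rewrite ler_pXn2r ?nnegrE ?addr_ge0 ?nm_ge0 ?nmD.
  rewrite -subr_ge0.
  rewrite (_ : _ - _ = (nm (f x) - nm (g x)) ^+ 2) ?sqr_ge0 //; ring.
- apply: EI_finD => //; try (by move=> x; rewrite mulr_ge0 ?sqr_ge0);
    try (by apply: measurable_funM => //; exact: measurable_nm2).
  + by apply: EI_finZ => // [|x]; [exact: measurable_nm2|exact: sqr_ge0].
  + by apply: EI_finZ => // [|x]; [exact: measurable_nm2|exact: sqr_ge0].
Qed.

Lemma SqN m n (f : R -> 'M[R[i]]_(m, n)) : Sq f -> Sq (fun x => - f x).
Proof.
move=> [mf fi]; split; first exact: mxmeasN.
by under eq_fun do rewrite nmN.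
Qed.

Lemma Sq_tr m n (f : R -> 'M[R[i]]_(m, n)) : Sq f -> Sq (fun x => (f x)^T).
Proof.
move=> [mf fi]; split; first exact: mxmeas_tr.
by under eq_fun do rewrite nm_tr.
Qed.

Lemma Sq_BddMl m n p (f : R -> 'M[R[i]]_(m, n)) (g : R -> 'M[R[i]]_(n, p)) :
  Bdd f -> Sq g -> Sq (fun x => f x *m g x).
Proof.
move=> bf [mg gi]; have [C C0 fC] := BddP bf.
apply: (Sq_dom (g := fun x => C ^+ 2 * nm (g x) ^+ 2)).
- exact: mxmeasM bf.1 mg.
- by apply: measurable_funM => //; exact: measurable_nm2.
- move=> x; rewrite -exprMn ler_pXn2r ?nnegrE ?mulr_ge0 ?nm_ge0 //.
  by rewrite (le_trans (nmM _ _)) // ler_wpM2r ?nm_ge0.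
- by apply: EI_finZ => // [|x|]; [exact: measurable_nm2|exact: sqr_ge0|exact: sqr_ge0].
Qed.

Lemma Sq_BddMr m n p (f : R -> 'M[R[i]]_(m, n)) (g : R -> 'M[R[i]]_(n, p)) :
  Sq f -> Bdd g -> Sq (fun x => f x *m g x).
Proof.
move=> /Sq_tr fi /Bdd_tr bg; have := Sq_tr (Sq_BddMl bg fi).
by under eq_fun do rewrite trmx_mul !trmxK.
Qed.

Definition supp {m n} T (f : R -> 'M[R[i]]_(m, n)) :=
  forall x, ~~ (0 <= x <= T) -> f x = 0.

(** Vanishing outside [0, T] is part of the notion, so that integrals run over the line and
    square-integrability implies integrability. *)
Definition L2 {m n} T (f : R -> 'M[R[i]]_(m, n)) := Sq f /\ supp T f.

Lemma L2_meas m n T (f : R -> 'M[R[i]]_(m, n)) : L2 T f -> mxmeas f.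
Proof. by case=> -[]. Qed.

Lemma L2D m n T (f g : R -> 'M[R[i]]_(m, n)) : L2 T f -> L2 T g ->
  L2 T (fun x => f x + g x).
Proof.
move=> [qf sf] [qg sg]; split; first exact: SqD.
by move=> x xT; rewrite sf // sg // addr0.
Qed.

Lemma L2N m n T (f : R -> 'M[R[i]]_(m, n)) : L2 T f -> L2 T (fun x => - f x).
Proof.
move=> [qf sf]; split; first exact: SqN.
by move=> x xT; rewrite sf // oppr0.
Qed.

Lemma L2B m n T (f g : R -> 'M[R[i]]_(m, n)) : L2 T f -> L2 T g ->
  L2 T (fun x => f x - g x).
Proof. by move=> hf hg; apply: L2D => //; exact: L2N. Qed.

Lemma L2_tr m n T (f : R -> 'M[R[i]]_(m, n)) : L2 T f -> L2 T (fun x => (f x)^T).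
Proof.
move=> [qf sf]; split; first exact: Sq_tr.
by move=> x xT; rewrite sf // trmx0.
Qed.

Lemma L2Ml m n p T (f : R -> 'M[R[i]]_(m, n)) (g : R -> 'M[R[i]]_(n, p)) :
  Bdd f -> L2 T g -> L2 T (fun x => f x *m g x).
Proof.
move=> bf [qg sg]; split; first exact: Sq_BddMl.
by move=> x xT; rewrite sg // mulmx0.
Qed.

Lemma L2Mr m n p T (f : R -> 'M[R[i]]_(m, n)) (g : R -> 'M[R[i]]_(n, p)) :
  L2 T f -> Bdd g -> L2 T (fun x => f x *m g x).
Proof.
move=> [qf sf] bg; split; first exact: Sq_BddMr.
by move=> x xT; rewrite sf // mul0mx.
Qed.

Lemma measurable_itvcc (a b : R) : measurable_fun setT (fun x : R => a <= x <= b).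
Proof. by apply: measurable_and; exact: measurable_fun_ler. Qed.

Lemma measurable_itvoo (a b : R) : measurable_fun setT (fun x : R => a < x < b).
Proof. by apply: measurable_and; exact: measurable_fun_ltr. Qed.

Lemma EI_itv_fin T (c : R) : 0 <= T -> 0 <= c ->
  (EI (fun x => if (0 <= x <= T)%R then c else 0%R) < +oo)%E.
Proof. by move=> T0 c0; rewrite EI_itv // ltry. Qed.

Lemma L2_L1 m n T (f : R -> 'M[R[i]]_(m, n)) : 0 <= T -> L2 T f -> L1 f.
Proof.
move=> T0 [[mf fi] sf].
have mi : measurable_fun setT (fun x : R => if 0 <= x <= T then 1 : R else 0).
  by apply: measurable_fun_ifT => //; exact: measurable_itvcc.
apply: (L1_dom (g := fun x => (if 0 <= x <= T then 1 else 0) + nm (f x) ^+ 2)).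
- exact: mf.
- by apply: measurable_funD => //; exact: measurable_nm2.
- move=> x; have [xT|xT] := boolP (0 <= x <= T); last first.
    by rewrite sf // nm0 addr_ge0 ?sqr_ge0.
    have := sqr_ge0 (nm (f x) - 1); rewrite sqrrB expr1n mulr1 => h.
  have := nm_ge0 (f x); lra.
- apply: EI_finD => // [|x|x|]; first exact: measurable_nm2.
  + by case: ifP.
  + exact: sqr_ge0.
  + exact: EI_itv_fin.
Qed.

Lemma L2_Bdd m n T (f : R -> 'M[R[i]]_(m, n)) : 0 <= T ->
  Bdd f -> supp T f -> L2 T f.
Proof.
move=> T0 bf sf; split=> //; have [C C0 fC] := BddP bf.
apply: (Sq_dom (g := fun x => if 0 <= x <= T then C ^+ 2 else 0)).
- exact: bf.1.
- by apply: measurable_fun_ifT => //; exact: measurable_itvcc.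
- move=> x; have [xT|xT] := boolP (0 <= x <= T); last first.
    by rewrite sf // nm0 expr0n.
    by rewrite ler_pXn2r ?nnegrE ?nm_ge0.
- by apply: EI_itv_fin => //; exact: sqr_ge0.
Qed.

Definition cutoff {m n} T (f : R -> 'M[R[i]]_(m, n)) x := if 0 <= x <= T then f x else 0.

Lemma supp_cutoff m n T (f : R -> 'M[R[i]]_(m, n)) : supp T (cutoff T f).
Proof. by move=> x xT; rewrite /cutoff (negbTE xT). Qed.

Lemma cutoffE m n T (f : R -> 'M[R[i]]_(m, n)) x : 0 <= x <= T -> cutoff T f x = f x.
Proof. by rewrite /cutoff => ->. Qed.

Lemma Bdd_cutoff m n T (f : R -> 'M[R[i]]_(m, n)) : Bdd f -> Bdd (cutoff T f).
Proof. by move=> bf; apply: Bdd_if => //; exact: measurable_itvcc. Qed.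

Lemma L2_cutoff m n T (f : R -> 'M[R[i]]_(m, n)) : 0 <= T -> Bdd f -> L2 T (cutoff T f).
Proof. by move=> T0 bf; apply: L2_Bdd => //; [exact: Bdd_cutoff|exact: supp_cutoff]. Qed.

End Integrable.

(** * Primitives of integrable functions *)

Section Primitive.
Context {R : realType}.
Local Notation mu := (@lebesgue_measure R).

Implicit Types x : R.

(** An integral over the line of a cut-off integrand: the limit x may then vary measurably, and
    Fubini applies on the plane. *)
Definition prim {m n} (f : R -> 'M[R[i]]_(m, n)) (x : R) :=
  Int (fun t => if 0 <= t <= x then f t else 0).

Lemma primE m n (f : R -> 'M[R[i]]_(m, n)) x : mx_integral `[0, x] f = prim f x.
Proof.
apply: co_inj => k; rewrite co_Int.
have -> : co (mx_integral `[0, x] f) k = \int[mu]_(t in `[0, x]) co (f t) k.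
  by case: k => [[] [i j]]; rewrite /co mxE.
rewrite Rintegral_mkcond; apply: eq_Rintegral => t _; rewrite patchE.
have -> : (t \in `[0, x]%classic) = (0 <= t <= x).
  by apply/idP/idP; rewrite inE /= in_itv.
by case: ifP; rewrite ?co0.
Qed.

Lemma eq_prim m n (f g : R -> 'M[R[i]]_(m, n)) x :
  (forall t, 0 <= t <= x -> f t = g t) -> prim f x = prim g x.
Proof. by move=> fg; apply: eq_Int => t; case: ifP => // /fg. Qed.

Lemma prim0 m n x : prim (fun _ => 0 : 'M[R[i]]_(m, n)) x = 0.
Proof. by rewrite -[RHS](Int0 m n); apply: eq_Int => t; rewrite if_same. Qed.

Lemma L1_itv m n (f : R -> 'M[R[i]]_(m, n)) x :
  L1 f -> L1 (fun t => if 0 <= t <= x then f t else 0).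
Proof. by apply: L1_cut; exact: measurable_itvcc. Qed.

Lemma mxmeas_itv m n (f : R -> 'M[R[i]]_(m, n)) x :
  mxmeas f -> mxmeas (fun t : R => if 0 <= t <= x then f t else 0).
Proof.
by move=> mf; apply: mxmeas_if (mxmeas_cst _) => //; exact: measurable_itvcc.
Qed.

Lemma primD m n (f g : R -> 'M[R[i]]_(m, n)) x : L1 f -> L1 g ->
  prim (fun t => f t + g t) x = prim f x + prim g x.
Proof.
move=> fi gi; rewrite /prim -IntD; [|exact: L1_itv|exact: L1_itv].
by apply: eq_Int => t; case: ifP; rewrite ?addr0.
Qed.

Lemma primN m n (f : R -> 'M[R[i]]_(m, n)) x : L1 f ->
  prim (fun t => - f t) x = - prim f x.
Proof.
move=> fi; rewrite /prim -IntN; last exact: L1_itv.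
by apply: eq_Int => t; case: ifP; rewrite ?oppr0.
Qed.

Lemma primB m n (f g : R -> 'M[R[i]]_(m, n)) x : L1 f -> L1 g ->
  prim (fun t => f t - g t) x = prim f x - prim g x.
Proof. by move=> fi gi; rewrite primD ?primN //; exact: L1N. Qed.

Lemma primMl m n p (A : 'M[R[i]]_(m, n)) (f : R -> 'M[R[i]]_(n, p)) x : L1 f ->
  prim (fun t => A *m f t) x = A *m prim f x.
Proof.
move=> fi; rewrite /prim -IntMl; last exact: L1_itv.
by apply: eq_Int => t; case: ifP; rewrite ?mulmx0.
Qed.

Lemma primMr m n p (A : 'M[R[i]]_(n, p)) (f : R -> 'M[R[i]]_(m, n)) x : L1 f ->
  prim (fun t => f t *m A) x = prim f x *m A.
Proof.
move=> fi; rewrite /prim -IntMr; last exact: L1_itv.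
by apply: eq_Int => t; case: ifP; rewrite ?mul0mx.
Qed.

Lemma prim_tr m n (f : R -> 'M[R[i]]_(m, n)) x :
  prim (fun t => (f t)^T) x = (prim f x)^T.
Proof.
by rewrite /prim -Int_tr; apply: eq_Int => t; case: ifP; rewrite ?trmx0.
Qed.

Lemma mxmeas_prim d (X : measurableType d) m n (f : X * R -> 'M[R[i]]_(m, n))
    (h : X -> R) : mxmeas f -> measurable_fun setT h ->
  mxmeas (fun y => prim (fun t => f (y, t)) (h y)).
Proof.
move=> mf mh.
apply: (mxmeas_Int (f := fun z => if 0 <= z.2 <= h z.1 then f z else 0)).
apply: mxmeas_if (mxmeas_cst _) => //.
by apply: measurable_itv_bool => //; exact: measurableT_comp.
Qed.

Lemma mxmeas_prim1 m n (f : R -> 'M[R[i]]_(m, n)) : mxmeas f -> mxmeas (prim f).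
Proof.
move=> mf; apply: (mxmeas_prim (f := fun z => f z.2) (h := id)) => //.
exact: mxmeas_comp.
Qed.

Lemma nm_prim m n (f : R -> 'M[R[i]]_(m, n)) x : mxmeas f ->
  ((nm (prim f x))%:E <=
   EI (fun t => if (0 <= t <= x)%R then nm (f t) else 0%R))%E.
Proof.
move=> mf; rewrite (le_trans (nm_Int (mxmeas_itv x mf))) //.
rewrite le_eqVlt; apply/orP; left; apply/eqP; apply: eq_integral => t _.
by case: ifP; rewrite ?nm0.
Qed.

Lemma nm_prim_le m n (f : R -> 'M[R[i]]_(m, n)) (g : R -> R) C x : mxmeas f ->
  measurable_fun setT g -> (forall t, 0 <= g t) ->
  (forall t, 0 <= t <= x -> nm (f t) <= g t) ->
  (EI (fun t => if (0 <= t <= x)%R then g t else 0%R) <= C%:E)%E ->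
  nm (prim f x) <= C.
Proof.
move=> mf mg g0 fg gC; rewrite -lee_fin (le_trans (nm_prim x mf)) //.
apply: le_trans gC; apply: EI_le.
- apply: measurable_fun_ifT => //; [exact: measurable_itvcc|exact: measurable_nm].
- by apply: measurable_fun_ifT => //; exact: measurable_itvcc.
- by move=> t; case: ifP => [/fg ->|_]; rewrite ?nm_ge0 ?lexx.
Qed.

Lemma Bdd_prim m n (f : R -> 'M[R[i]]_(m, n)) : L1 f -> Bdd (prim f).
Proof.
move=> [mf fi]; split; first exact: mxmeas_prim1.
exists (fine (EI (fun t => nm (f t)))) => x.
rewrite -lee_fin fineK; last first.
  by rewrite ge0_fin_numE //; apply: EI_ge0 => t; exact: nm_ge0.
rewrite (le_trans (nm_prim x mf)) //; apply: EI_le.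
- apply: measurable_fun_ifT => //; [exact: measurable_itvcc|exact: measurable_nm].
- exact: measurable_nm.
- by move=> t; case: ifP; rewrite ?nm_ge0 lexx.
Qed.

Lemma prim_le0 m n (f : R -> 'M[R[i]]_(m, n)) x : mxmeas f -> x <= 0 ->
  prim f x = 0.
Proof.
move=> mf x0; rewrite -(Int0 m n); apply: eq_Int_ae.
- exact: mxmeas_itv.
- exact: mxmeas_cst.
- apply: aeS (ae_neq (0 : R)) => t t0 _.
  by case: ifPn => // /andP[t1 t2]; rewrite (_ : t = 0) ?eqxx // in t0;
    apply/le_anti; rewrite t1 (le_trans t2).
Qed.

Lemma Int_Fubini_dom m n (f : R * R -> 'M[R[i]]_(m, n)) (a : R -> R) :
  mxmeas f -> measurable_fun setT a ->
  (forall x, (EI (fun y => nm (f (x, y))) <= (a x)%:E)%E) -> (EI a < +oo)%E ->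
  Int (fun x => Int (fun y => f (x, y))) = Int (fun y => Int (fun x => f (x, y))).
Proof.
move=> mf ma fa ai; apply: Int_Fubini => //; apply: le_lt_trans ai.
apply: ge0_le_integral => //.
- by move=> x _; apply: EI_ge0 => y; exact: nm_ge0.
- apply: (measurable_fun_fubini_tonelli_F (m2 := mu) (fun z => (nm (f z))%:E)).
    by apply: measurable_EFinT; exact: measurable_nm.
  by move=> z; rewrite lee_fin nm_ge0.
- exact: measurable_EFinT.
- by move=> x _; exact: fa.
Qed.

Lemma EI_nm_cut m n p q (f : R -> 'M[R[i]]_(m, n)) (g : R -> 'M[R[i]]_(p, q))
    (c : R) : 0 <= c -> mxmeas f -> L1 g -> (forall t, nm (f t) <= c * nm (g t)) ->
  (EI (fun t => nm (f t)) <= (c * fine (EI (fun t => nm (g t))))%:E)%E.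
Proof.
move=> c0 mf [mg gi] fg.
have gnm := measurable_nm mg.
apply: (@le_trans _ _ (EI (fun t => c * nm (g t)))).
  apply: EI_le => //; first exact: measurable_nm.
    exact: measurable_funM.
  by move=> t; rewrite nm_ge0 fg.
rewrite EI_Z //; last by move=> t; exact: nm_ge0.
rewrite EFinM fineK // ge0_fin_numE //; apply: EI_ge0 => t; exact: nm_ge0.
Qed.

Lemma EI_fin_nm m n (f : R -> 'M[R[i]]_(m, n)) (c : R) : 0 <= c -> L1 f ->
  (EI (fun t => (nm (f t) * c)%R) < +oo)%E.
Proof.
move=> c0 [mf fi]; under eq_fun do rewrite mulrC.
by apply: EI_finZ => // [|t]; [exact: measurable_nm|exact: nm_ge0].
Qed.

(** Dirichlet's exchange of order on the triangle s <= t <= x. As k vanishes for t < s, both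
    iterated integrals may be taken over the square [0, x]^2. *)
Lemma prim_comp m n p q (l : R -> 'M[R[i]]_(m, n)) (k : R * R -> 'M[R[i]]_(n, p))
    (f : R -> 'M[R[i]]_(p, q)) x :
  L1 l -> Bdd k -> (forall t s, t < s -> k (t, s) = 0) -> L1 f ->
  prim (fun t => l t *m prim (fun s => k (t, s) *m f s) t) x =
  prim (fun s => prim (fun t => l t *m k (t, s)) x *m f s) x.
Proof.
move=> li bk k0 fi; have [C C0 kC] := BddP bk.
have bkl t : Bdd (fun s => k (t, s)) by exact: Bdd_comp.
have bkr s : Bdd (fun t => k (t, s)) by exact: Bdd_comp.
pose g (z : R * R) := if (0 <= z.1 <= x) && (0 <= z.2 <= x)
  then l z.1 *m (k z *m f z.2) else 0.
transitivity (Int (fun t => Int (fun s => g (t, s)))).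
  rewrite /prim; apply: eq_Int => t; case: ifPn => tx; last first.
    by rewrite -[LHS](Int0 m q); apply: eq_Int => s; rewrite /g /= (negbTE tx).
  rewrite -IntMl; last by apply: L1_itv; exact: L1_BddMl.
  apply: eq_Int => s; rewrite /g /= tx /=.
  case/andP: tx => t0 tx.
  have [s0|s0] /= := leP 0 s; last by rewrite mulmx0.
  have [st|st] := leP s t; first by rewrite (le_trans st tx).
  by rewrite k0 // mul0mx mulmx0; case: ifP.
rewrite (@Int_Fubini_dom _ _ g (fun t => nm (l t) *
    (C * fine (EI (fun s => nm (f s)))))).
- rewrite /prim; apply: eq_Int => s; case: ifPn => sx; last first.
    by rewrite -[RHS](Int0 m q); apply: eq_Int => t; rewrite /g /= (negbTE sx) andbF.
  rewrite -IntMr; last by apply: L1_itv; exact: L1_BddMr.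
  apply: eq_Int => t; rewrite /g /= sx andbT.
  by case: ifP; rewrite ?mul0mx ?mulmxA.
- apply: mxmeas_if (mxmeas_cst _).
    apply: measurable_and.
      exact: (measurable_itv_bool measurable_fst (measurable_cst x)).
    exact: (measurable_itv_bool measurable_snd (measurable_cst x)).
  apply: mxmeasM; first exact: (mxmeas_comp measurable_fst li.1).
  by apply: mxmeasM; [exact: bk.1|exact: (mxmeas_comp measurable_snd fi.1)].
- by apply: measurable_funM => //; exact: (measurable_nm li.1).
- move=> t; rewrite mulrA; apply: EI_nm_cut => //.
  + by rewrite mulr_ge0 ?nm_ge0.
  + rewrite /g /=; apply: mxmeas_if (mxmeas_cst _).
      by apply: measurable_and; [exact: measurable_cst|exact: measurable_itvcc].
    apply: mxmeasM; first exact: mxmeas_cst.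
    by apply: mxmeasM; [exact: (bkl t).1|exact: fi.1].
  + move=> s; rewrite /g /=; case: ifP => _; last first.
      by rewrite nm0 !mulr_ge0 ?nm_ge0.
    rewrite (le_trans (nmM _ _)) // -mulrA ler_wpM2l ?nm_ge0 //.
    by rewrite (le_trans (nmM _ _)) // ler_wpM2r ?nm_ge0.
- apply: EI_fin_nm => //; rewrite mulr_ge0 // fine_ge0 //.
  by apply: EI_ge0 => s; exact: nm_ge0.
Qed.

(** Absolute continuity on the whole line, with an integrable derivative defined everywhere. Such
    functions are bounded, and constant for x <= 0, so that product rules and differential equations
    need no interval. *)
Definition ACd {m n} (f f' : R -> 'M[R[i]]_(m, n)) :=
  L1 f' /\ forall x, f x = f 0 + prim f' x.

Lemma AC_Bdd m n (f f' : R -> 'M[R[i]]_(m, n)) : ACd f f' -> Bdd f.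
Proof.
move=> [fi fE]; rewrite (_ : f = fun x => f 0 + prim f' x); last exact/funext.
by apply: BddD; [exact: Bdd_cst|exact: Bdd_prim].
Qed.

Lemma AC_prim m n (c : 'M[R[i]]_(m, n)) f' : L1 f' ->
  ACd (fun x => c + prim f' x) f'.
Proof.
by move=> fi; split => // x; rewrite (prim_le0 fi.1 (lexx 0)) addr0.
Qed.

Lemma ACD m n (f f' g g' : R -> 'M[R[i]]_(m, n)) : ACd f f' -> ACd g g' ->
  ACd (fun x => f x + g x) (fun x => f' x + g' x).
Proof.
move=> [fi fE] [gi gE]; split; first exact: L1D.
by move=> x; rewrite primD // addrACA -fE -gE.
Qed.

Lemma ACN m n (f f' : R -> 'M[R[i]]_(m, n)) : ACd f f' ->
  ACd (fun x => - f x) (fun x => - f' x).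
Proof.
move=> [fi fE]; split; first exact: L1N.
by move=> x; rewrite primN // -opprD -fE.
Qed.

Lemma ACB m n (f f' g g' : R -> 'M[R[i]]_(m, n)) : ACd f f' -> ACd g g' ->
  ACd (fun x => f x - g x) (fun x => f' x - g' x).
Proof. by move=> hf hg; apply: ACD => //; exact: ACN. Qed.

Lemma AC_tr m n (f f' : R -> 'M[R[i]]_(m, n)) : ACd f f' ->
  ACd (fun x => (f x)^T) (fun x => (f' x)^T).
Proof.
move=> [fi fE]; split; first exact: L1_tr.
by move=> x; rewrite prim_tr {1}fE raddfD.
Qed.

Lemma eq_AC m n (f f' g g' : R -> 'M[R[i]]_(m, n)) : ACd f f' ->
  (forall x, f x = g x) -> (forall x, f' x = g' x) -> ACd g g'.
Proof. by move=> h /funext <- /funext <-. Qed.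

Lemma AC0 m n (f f' : R -> 'M[R[i]]_(m, n)) : ACd f f' ->
  (forall x, f' x = 0) -> forall x, f x = f 0.
Proof.
move=> [_ fE] f0 x; rewrite fE (_ : prim f' x = 0) ?addr0 //.
by rewrite -(Int0 m n); apply: eq_Int => t; rewrite f0; case: ifP.
Qed.

(** Integration by parts: the square [0, x]^2 is cut along the diagonal, which meets each section in
    a null set. *)
Lemma prim_prod m n p (f : R -> 'M[R[i]]_(m, n)) (g : R -> 'M[R[i]]_(n, p)) x :
  L1 f -> L1 g ->
  prim f x *m prim g x = prim (fun t => f t *m prim g t + prim f t *m g t) x.
Proof.
move=> fi gi.
have bf := Bdd_prim fi; have bg := Bdd_prim gi.
rewrite primD; [|exact: L1_BddMr|exact: L1_BddMl].
pose h (z : R * R) := if [&& 0 <= z.1 <= x, z.1 < z.2 & z.2 <= x]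
  then f z.1 *m g z.2 else 0.
have mh : mxmeas h.
  apply: mxmeas_if (mxmeas_cst _).
    apply: measurable_and.
      exact: (measurable_itv_bool measurable_fst (measurable_cst x)).
    by apply: measurable_and; [exact: measurable_fun_ltr|exact: measurable_fun_ler].
  by apply: mxmeasM; [exact: (mxmeas_comp measurable_fst fi.1)|exact: (mxmeas_comp measurable_snd gi.1)].
have -> : prim (fun t => prim f t *m g t) x =
    Int (fun t => Int (fun s => h (s, t))).
  rewrite /prim; apply: eq_Int => t; case: ifPn => tx; last first.
    rewrite -[LHS](Int0 m p); apply: eq_Int => s; rewrite /h /=.
    case: ifPn => // /and3P[/andP[s0 sx] st tx'].
    by rewrite (ltW (le_lt_trans s0 st)) tx' in tx.
  rewrite -IntMr; last exact: L1_itv.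
  apply: eq_Int_ae.
  - by apply: mxmeasM (mxmeas_cst _); exact: mxmeas_itv fi.1.
  - by apply: mxmeas_comp mh => //; exact: measurable_fun_pair.
  - apply: aeS (ae_neq t) => s st _; rewrite /h /=.
    case/andP: tx => t0 tx; rewrite tx andbT lt_neqAle st /=.
    have [s0|] /= := leP 0 s; last by rewrite mul0mx.
    have [st'|] := leP s t; last by rewrite andbF mul0mx.
    by rewrite (le_trans st' tx).
rewrite -(@Int_Fubini_dom _ _ h (fun s => nm (f s) * fine (EI (fun t => nm (g t))))) //.
(* Integrating f(s)g(t) first in t over s < t <= x leaves f(s) times the increment from s to x of
   the primitive of g. *)
- have -> : Int (fun s => Int (fun t => h (s, t))) =
      prim (fun s => f s *m prim g x - f s *m prim g s) x.
    rewrite /prim; apply: eq_Int => s; case: ifPn => sx; last first.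
      by rewrite -[RHS](Int0 m p); apply: eq_Int => t; rewrite /h /= (negbTE sx).
    rewrite -mulmxBr -IntB; [|exact: L1_itv|exact: L1_itv].
    rewrite -IntMl; last by apply: L1B; exact: L1_itv.
    apply: eq_Int => t; rewrite /h /= sx /=; case/andP: sx => s0 sx.
    have [st|ts] /= := ltP s t.
      rewrite (ltW (le_lt_trans s0 st)) /= subr0.
      by case: ifP; rewrite ?mulmx0.
    rewrite (le_trans ts sx) andbT.
    by case: ifP; rewrite ?subrr ?subr0 mulmx0.
  rewrite primB; [|exact: L1Mr|exact: L1_BddMr].
  by rewrite primMr // addrC subrK.
- exact: measurable_funM (measurable_nm fi.1) _.
- move=> s; apply: EI_nm_cut => //; first exact: nm_ge0.
    by apply: mxmeas_comp mh => //; exact: measurable_fun_pair.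
  move=> t; rewrite /h /=; case: ifP => _; first exact: nmM.
  by rewrite nm0 mulr_ge0 ?nm_ge0.
- apply: EI_fin_nm => //; apply: fine_ge0.
  by apply: EI_ge0 => t; exact: nm_ge0.
Qed.

Lemma ACM m n p (f f' : R -> 'M[R[i]]_(m, n)) (g g' : R -> 'M[R[i]]_(n, p)) :
  ACd f f' -> ACd g g' -> ACd (fun x => f x *m g x) (fun x => f' x *m g x + f x *m g' x).
Proof.
move=> acf acg; have bf := AC_Bdd acf; have bg := AC_Bdd acg.
case: acf acg => [fi fE] [gi gE].
have bpf := Bdd_prim fi; have bpg := Bdd_prim gi.
split; first by apply: L1D; [exact: L1_BddMr|exact: L1_BddMl].
move=> x; rewrite {1}fE {1}gE mulmxDl !mulmxDr prim_prod // -addrA.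
congr (_ + _).
have l1 : L1 (fun t => f 0 *m g' t) by exact: L1Ml.
have l2 : L1 (fun t => f' t *m g 0) by exact: L1Mr.
have l3 : L1 (fun t => f' t *m prim g' t + prim f' t *m g' t).
  by apply: L1D; [exact: L1_BddMr|exact: L1_BddMl].
rewrite -(primMl (f 0) x gi) -(primMr (g 0) x fi).
rewrite -(primD x l2 l3) -(primD x l1 (L1D l2 l3)).
apply: eq_prim => t _; rewrite (fE t) (gE t) !mulmxDl !mulmxDr.
by rewrite addrA [RHS]addrACA [X in _ = X + _]addrC.
Qed.

End Primitive.

(** * Fixed points and linear differential equations *)

Section Contraction.
Context {R : realType} d (X : measurableType d) (m n : nat).
Context (w : X -> R) (Cw : R) (Phi : (X -> 'M[R[i]]_(m, n)) -> X -> 'M[R[i]]_(m, n)).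
Hypothesis w1 : forall x, 1 <= w x.
Hypothesis wC : forall x, w x <= Cw.
Hypothesis Phi_Bdd : forall u, Bdd u -> Bdd (Phi u).
Hypothesis Phi_contract : forall u v C, Bdd u -> Bdd v -> 0 <= C ->
  (forall x, nm (u x - v x) <= C * w x) ->
  forall x, nm (Phi u x - Phi v x) <= C / 2 * w x.

Lemma le_half_pow (a K : R) : (forall k, a <= K / 2 ^+ k) -> a <= 0.
Proof.
move=> aK; rewrite leNgt; apply/negP => a0.
have := aK (Num.bound (K / a)).
rewrite ler_pdivlMr ?exprn_gt0 // leNgt => /negP; apply.
have := upper_nthrootP (leqnn (Num.bound (K / a))).
by rewrite ltr_pdivrMr // mulrC.
Qed.

Lemma contraction_iter u v C k : Bdd u -> Bdd v -> 0 <= C ->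
  (forall x, nm (u x - v x) <= C * w x) ->
  forall x, nm (iter k Phi u x - iter k Phi v x) <= C / 2 ^+ k * w x.
Proof.
move=> bu bv C0 uv.
have bi z : Bdd z -> forall k, Bdd (iter k Phi z).
  by move=> bz; elim=> [//|j IH] /=; exact: Phi_Bdd.
elim: k => [x|k IH x] /=; first by rewrite expr0 divr1.
have := Phi_contract (bi _ bu k) (bi _ bv k) _ IH x.
rewrite exprSr invfM mulrA; apply.
by rewrite divr_ge0 // exprn_ge0.
Qed.

(** Iteration leaves both fixed points unchanged, while the weighted bound on their distance is
    halved each time. *)
Lemma contraction_uniq u v : Bdd u -> Bdd v ->
  (forall x, Phi u x = u x) -> (forall x, Phi v x = v x) -> forall x, u x = v x.
Proof.
move=> bu bv fu fv x.
have [C C0 hC] := BddP (BddB bu bv).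
have fi z : (forall x, Phi z x = z x) -> forall k, iter k Phi z = z.
  by move=> fz; elim=> [//|j IH] /=; rewrite IH; exact/funext.
have uv y : nm (u y - v y) <= C * w y.
  by rewrite (le_trans (hC y)) // ler_peMr.
apply/eqP; rewrite -subr_eq0; apply/eqP/nm_le0/(@le_half_pow _ (C * w x)) => k.
have := contraction_iter k bu bv C0 uv x.
by rewrite (fi _ fu) (fi _ fv) mulrAC.
Qed.

(** Banach's theorem for the supremum norm weighted by 1/w, with explicit constants. The iterates of
    0 converge in each coordinate at every point, which keeps the limit measurable; w >= 1 turns
    ordinary bounds into weighted ones, and w <= [Cw] turns them back. *)
Lemma contraction_fixpoint : exists2 u, Bdd u & forall x, Phi u x = u x.
Proof.
pose u k := iter k Phi (fun _ => 0).
have bu k : Bdd (u k).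
  by elim: k => [|k IH] /=; [exact: Bdd_cst|exact: Phi_Bdd].
have [C C0 hC] := BddP (BddB (bu 1%N) (bu 0%N)).
(* The constant 2C reproduces itself in the induction: 2C/2 + C = 2C, the sum of the geometric
   series. *)
have u0 j x : nm (u j x - u 0%N x) <= C * 2 * w x.
  elim: j x => [|j IH] x.
    by rewrite subrr nm0 !mulr_ge0 // (le_trans _ (w1 x)).
  have -> : u j.+1 x - u 0%N x = (u j.+1 x - u 1%N x) + (u 1%N x - u 0%N x).
    by rewrite addrA subrK.
  rewrite (le_trans (nmD _ _)) //.
  have h1 : nm (u j.+1 x - u 1%N x) <= C * 2 / 2 * w x.
    by apply: (Phi_contract (bu j) (bu 0%N) _ IH); rewrite mulr_ge0.
  have h2 : nm (u 1%N x - u 0%N x) <= C * w x.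
    by rewrite (le_trans (hC x)) // ler_peMr.
  rewrite mulfK ?pnatr_eq0 // in h1.
  by rewrite (le_trans (lerD h1 h2)) // -mulrDl mulr_natr mulr2n.
have ujk k j x : nm (u (k + j)%N x - u k x) <= C * 2 / 2 ^+ k * w x.
  have := @contraction_iter (u j) (u 0%N) (C * 2) k (bu j) (bu 0%N) _ (u0 j) x.
  by rewrite /u -!iterD addn0; apply; rewrite mulr_ge0.
have w0 x : 0 <= w x by rewrite (le_trans _ (w1 x)).
have cvu x c : cvgn (fun k => co (u k x) c).
  apply/cauchy_cvgP/cauchy_exP => e e0.
  pose N := Num.bound (C * 2 * w x / e).
  exists (co (u N x) c).
  exists N => // l /= Nl; rewrite -ball_normE /ball_ /= distrC -coB.
  apply: le_lt_trans (co_le _ _) _.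
  rewrite -(subnKC Nl) (le_lt_trans (ujk _ _ _)) //.
  rewrite mulrAC ltr_pdivrMr ?exprn_gt0 //.
  have := upper_nthrootP (leqnn N); rewrite ltr_pdivrMr //.
  by rewrite [2 ^+ _ * e]mulrC.
pose ul x := of_co (fun c => limn (fun k => co (u k x) c)) : 'M[R[i]]_(m, n).
have cvul x c : (fun k => co (u k x) c) @ \oo --> co (ul x) c.
  by rewrite of_coK; exact: cvu.
(* The limit is taken in each coordinate separately; returning to [nm] by [nmS] costs the number 2mn
   of coordinates. *)
pose K := (m * n).*2%:R * (C * 2).
have K0 : 0 <= K by rewrite !mulr_ge0.
have ulk k x : nm (ul x - u k x) <= K / 2 ^+ k * w x.
  rewrite /K -!mulrA; apply: nmS => c; rewrite coB.
  have cv : (fun j => `|co (u j x) c - co (u k x) c|) @ \oo -->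
     `|co (ul x) c - co (u k x) c|.
    by apply: cvg_norm; apply: cvgB (cvul x c) _; exact: cvg_cst.
  rewrite -(cvg_lim _ cv) //; apply: limr_le; first by apply/cvg_ex; eexists; exact: cv.
  exists k => // j /= kj; rewrite -coB (le_trans (co_le _ _)) //.
  by rewrite -(subnKC kj) (le_trans (ujk _ _ _)) // !mulrA.
have bul : Bdd ul.
  split; first exact: (mxmeas_cvg (fun k => (bu k).1) cvul).
  exists (K * Cw) => x.
  have := ulk 0%N x; rewrite expr0 divr1 /u /= subr0 => h.
  by rewrite (le_trans h) // ler_wpM2l.
exists ul => // x.
apply/eqP; rewrite -subr_eq0; apply/eqP/nm_le0/(@le_half_pow _ (K * w x)) => k.
have -> : Phi ul x - ul x = (Phi ul x - u k.+1 x) + - (ul x - u k.+1 x).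
  by rewrite opprB addrA subrK.
rewrite (le_trans (nmD _ _)) // nmN.
have Kk : 0 <= K / 2 ^+ k by rewrite divr_ge0 // exprn_ge0.
have h1 := Phi_contract bul (bu k) Kk (ulk k) x.
have h2 := ulk k.+1 x.
rewrite exprSr invfM mulrA in h2.
by rewrite (le_trans (lerD h1 h2)) // -mulrDl -splitr mulrAC.
Qed.

End Contraction.

(** * Weights, and linear systems with square-summable coefficients *)

Section Weights.
Context {R : realType}.
Implicit Types x T : R.

Definition weight (w : R -> R) := [/\ measurable_fun setT w,
  forall x, 1 <= w x & exists C, forall x, w x <= C].

Definition weightfor {m n} (a : R -> 'M[R[i]]_(m, n)) (w : R -> R) := forall x,
  (EI (fun t => if (0 <= t <= x)%R then nm (a t) * w t else 0)%R <= (w x / 2)%:E)%E.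

Lemma weight_ge0 w x : weight w -> 0 <= w x.
Proof. by move=> [_ w1 _]; exact: le_trans (w1 x). Qed.

(** The exponential weight of |a| + |b| serves both functions; the kernel equation integrates
    against both of them. *)
Lemma weight2 T m n p q (a : R -> 'M[R[i]]_(m, n)) (b : R -> 'M[R[i]]_(p, q)) :
  0 <= T -> L2 T a -> L2 T b -> exists w, [/\ weight w, weightfor a w & weightfor b w].
Proof.
move=> T0 [[ma ai] sa] [[mb bi] sb].
pose h t := nm (a t) + nm (b t).
have ha t : nm (a t) <= h t by rewrite lerDl nm_ge0.
have hb t : nm (b t) <= h t by rewrite lerDr nm_ge0.
have h0 t : 0 <= h t by rewrite addr_ge0 ?nm_ge0.
have mna := measurable_nm ma; have mnb := measurable_nm mb.
have mh : measurable_fun setT h by exact: measurable_funD.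
have mh2 : measurable_fun setT (fun x => h x ^+ 2) by exact: measurable_funX.
have hi : (EI (fun x => h x ^+ 2)%R < +oo)%E.
  apply: (@EI_fin _ _ (fun x => 2 * nm (a x) ^+ 2 + 2 * nm (b x) ^+ 2)) => //.
  - by apply: measurable_funD; apply: measurable_funM => //; exact: measurable_nm2.
  - move=> x; rewrite sqr_ge0 /= -subr_ge0.
    by rewrite (_ : _ - _ = (nm (a x) - nm (b x)) ^+ 2) ?sqr_ge0 // /h; ring.
  - apply: EI_finD => //; try (by move=> x; rewrite mulr_ge0 ?sqr_ge0);
      try (by apply: measurable_funM => //; exact: measurable_nm2).
    + by apply: EI_finZ => // [|x]; [exact: measurable_nm2|exact: sqr_ge0].
    + by apply: EI_finZ => // [|x]; [exact: measurable_nm2|exact: sqr_ge0].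
have hs x : ~~ (0 <= x <= T) -> h x = 0.
  by move=> xT; rewrite /h sa // sb // !nm0 addr0.
have [w [mw w1 wC hw]] := exp_weight T0 mh h0 hs hi.
have w0 x : 0 <= w x by rewrite (le_trans _ (w1 x)).
exists w; split => //.
- move=> x; apply: le_trans (hw x); apply: EI_le.
  + by apply: measurable_fun_ifT => //; [exact: measurable_itvcc|exact: measurable_funM].
  + by apply: measurable_fun_ifT => //; [exact: measurable_itvcc|exact: measurable_funM].
  + by move=> t; case: ifP => _; rewrite ?lexx // mulr_ge0 ?nm_ge0 //= ler_wpM2r.
- move=> x; apply: le_trans (hw x); apply: EI_le.
  + by apply: measurable_fun_ifT => //; [exact: measurable_itvcc|exact: measurable_funM].
  + by apply: measurable_fun_ifT => //; [exact: measurable_itvcc|exact: measurable_funM].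
  + by move=> t; case: ifP => _; rewrite ?lexx // mulr_ge0 ?nm_ge0 //= ler_wpM2r.
Qed.

(** The estimate behind every fixed point below: integration against |a| turns a bound C w into C w
    / 2. *)
Lemma prim_weight m n p q (a : R -> 'M[R[i]]_(m, n)) (f : R -> 'M[R[i]]_(p, q))
    w C x : weight w -> mxmeas a -> weightfor a w -> mxmeas f -> 0 <= C ->
  (forall t, 0 <= t <= x -> nm (f t) <= nm (a t) * (C * w t)) ->
  nm (prim f x) <= C / 2 * w x.
Proof.
move=> ww ma aw mf C0 fa.
have [mw _ _] := ww.
have mna := measurable_nm ma.
have w0 t := weight_ge0 t ww.
have maw : measurable_fun setT (fun t => nm (a t) * w t) by exact: measurable_funM.
apply: (nm_prim_le (g := fun t => C * (nm (a t) * w t))) => //.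
- exact: measurable_funM.
- by move=> t; rewrite !mulr_ge0 ?nm_ge0.
- by move=> t /fa; rewrite mulrCA.
rewrite (_ : (fun t => _) = (fun t => C *
   (if 0 <= t <= x then nm (a t) * w t else 0))); last first.
  by apply/funext => t; case: ifP; rewrite ?mulr0.
rewrite EI_Z //; last 2 first.
- by apply: measurable_fun_ifT => //; exact: measurable_itvcc.
- by move=> t; case: ifP; rewrite // mulr_ge0 ?nm_ge0.
have -> : C / 2 * w x = C * (w x / 2) by rewrite mulrA mulrAC.
by rewrite EFinM lee_wpmul2l // lee_fin.
Qed.

Lemma ode_contract T n p (B : R -> 'M[R[i]]_n) (c : 'M[R[i]]_(n, p)) w :
  0 <= T -> L2 T B -> weight w -> weightfor B w -> forall u v C, Bdd u -> Bdd v ->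
  0 <= C -> (forall x, nm (u x - v x) <= C * w x) -> forall x,
  nm (c + prim (fun t => B t *m u t) x - (c + prim (fun t => B t *m v t) x))
    <= C / 2 * w x.
Proof.
move=> T0 lB ww Bw u v C bu bv C0 uv x.
have l1 z : Bdd z -> L1 (fun t => (B t *m z t : 'M[R[i]]_(n, p))).
  by move=> bz; apply: (@L2_L1 _ _ _ T) => //; exact: L2Mr.
rewrite opprD addrACA subrr add0r -primB; [|exact: l1|exact: l1].
apply: (prim_weight (a := B)) => //; first exact: L2_meas lB.
  by apply: mxmeasB; [exact: (l1 u bu).1|exact: (l1 v bv).1].
move=> t _; rewrite -mulmxBr (le_trans (nmM _ _)) //.
by rewrite ler_wpM2l ?nm_ge0.
Qed.

Lemma linear_ode T n p (B : R -> 'M[R[i]]_n) (c : 'M[R[i]]_(n, p)) : 0 <= T ->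
  L2 T B -> exists2 u, ACd u (fun x => B x *m u x) & u 0 = c.
Proof.
move=> T0 lB; have [w [ww Bw _]] := weight2 T0 lB lB.
have [_ w1 [Cw wC]] := ww.
have l1 z : Bdd z -> L1 (fun t => (B t *m z t : 'M[R[i]]_(n, p))).
  by move=> bz; apply: (@L2_L1 _ _ _ T) => //; exact: L2Mr.
have [u bu uE] := @contraction_fixpoint _ _ _ n p w Cw
  (fun u x => c + prim (fun t => B t *m u t) x) w1 wC
  (fun u bu => BddD (Bdd_cst c) (Bdd_prim (l1 u bu)))
  (ode_contract c T0 lB ww Bw).
exists u; last by rewrite -uE (prim_le0 (l1 u bu).1 (lexx 0)) addr0.
split; first exact: l1.
by move=> x; rewrite -{1}uE -[in RHS]uE (prim_le0 (l1 u bu).1 (lexx 0)) addr0.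
Qed.

Lemma linear_ode_uniq T n p (B : R -> 'M[R[i]]_n) (u v : R -> 'M[R[i]]_(n, p)) :
  0 <= T -> L2 T B -> ACd u (fun x => B x *m u x) -> ACd v (fun x => B x *m v x) ->
  u 0 = v 0 -> forall x, u x = v x.
Proof.
move=> T0 lB acu acv uv0; have [w [ww Bw _]] := weight2 T0 lB lB.
have [_ w1 [Cw wC]] := ww.
have l1 z : Bdd z -> L1 (fun t => (B t *m z t : 'M[R[i]]_(n, p))).
  by move=> bz; apply: (@L2_L1 _ _ _ T) => //; exact: L2Mr.
apply: (@contraction_uniq _ _ _ n p w
  (fun u x => v 0 + prim (fun t => B t *m u t) x) w1
  (fun u bu => BddD (Bdd_cst (v 0)) (Bdd_prim (l1 u bu)))
  (ode_contract (v 0) T0 lB ww Bw)).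
- exact: AC_Bdd acu.
- exact: AC_Bdd acv.
- by move=> x; rewrite -uv0 -acu.2.
- by move=> x; rewrite -acv.2.
Qed.

End Weights.

(** * The kernel N *)

Section Shift.
Context {R : realType}.
Implicit Types x T v : R.

Lemma measurable_shift v : measurable_fun setT (fun x : R => x - v).
Proof. exact: measurable_funB. Qed.

Lemma mxmeas_shift m n (f : R -> 'M[R[i]]_(m, n)) v : mxmeas f ->
  mxmeas (fun x : R => f (x - v)).
Proof. by move=> mf; exact: (mxmeas_comp (measurable_shift v) mf). Qed.

Lemma L1_shift m n (f : R -> 'M[R[i]]_(m, n)) v : L1 f -> L1 (fun x => f (x - v)).
Proof.
move=> [mf fi]; split; first exact: mxmeas_shift.
have := @EI_shift _ v (fun x => nm (f x)) (measurable_nm mf) (fun x => nm_ge0 _).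
by rewrite /EI => ->.
Qed.

Lemma Int_shift m n (f : R -> 'M[R[i]]_(m, n)) v : mxmeas f ->
  Int (fun x => f (x - v)) = Int f.
Proof.
move=> mf; rewrite (Int_reflection 0 mf) (Int_reflection v (mxmeas_shift v mf)).
by apply: eq_Int => x; congr f; ring.
Qed.

Lemma prim_shift m n (f : R -> 'M[R[i]]_(m, n)) v x : mxmeas f -> 0 <= v ->
  prim (fun y => if v <= y then f (y - v) else 0) x = prim f (x - v).
Proof.
move=> mf v0.
rewrite /prim -(@Int_shift _ _ (fun t => if 0 <= t <= x - v then f t else 0) v).
  apply: eq_Int => y; rewrite subr_ge0 lerD2r.
  by have [vy|] /= := leP v y; [rewrite (le_trans v0 vy)|case: ifP].
exact: mxmeas_itv.
Qed.

Lemma prim_reflection m n (f : R -> 'M[R[i]]_(m, n)) x : mxmeas f ->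
  prim f x = prim (fun v => f (x - v)) x.
Proof.
move=> mf; rewrite /prim (Int_reflection x (mxmeas_itv x mf)).
apply: eq_Int => v; congr (if _ then _ else _).
by rewrite subr_ge0 lerBlDr lerDl andbC.
Qed.

End Shift.

(** * Volterra operators with bounded kernels *)

Section Volterra.
Context {R : realType}.
Implicit Types x T v : R.

Definition vol {m n p} (k : R * R -> 'M[R[i]]_(m, n)) (f : R -> 'M[R[i]]_(n, p)) x :=
  prim (fun s => k (x, s) *m f s) x.

Definition triangular {m n} T (k : R * R -> 'M[R[i]]_(m, n)) :=
  forall x s, ~~ ((0 <= s <= x) && (x <= T)) -> k (x, s) = 0.

Lemma Bdd_pair1 m n (k : R * R -> 'M[R[i]]_(m, n)) x : Bdd k -> Bdd (fun s => k (x, s)).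
Proof. by move=> bk; exact: Bdd_comp. Qed.

Lemma Bdd_pair2 m n (k : R * R -> 'M[R[i]]_(m, n)) s : Bdd k -> Bdd (fun x => k (x, s)).
Proof. by move=> bk; exact: Bdd_comp. Qed.

Lemma mxmeas_vol m n p (k : R * R -> 'M[R[i]]_(m, n)) (f : R -> 'M[R[i]]_(n, p)) :
  mxmeas k -> mxmeas f -> mxmeas (vol k f).
Proof.
move=> mk mf; apply: (mxmeas_prim (f := fun z => k z *m f z.2) (h := id)) => //.
by apply: mxmeasM => //; exact: (mxmeas_comp measurable_snd mf).
Qed.

Lemma nm_vol_le m n p (k : R * R -> 'M[R[i]]_(m, n)) (f : R -> 'M[R[i]]_(n, p)) C x :
  0 <= C -> mxmeas k -> (forall z, nm (k z) <= C) -> L1 f ->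
  nm (vol k f x) <= C * fine (EI (fun t => nm (f t))).
Proof.
move=> C0 mk kC fi.
have mkx : mxmeas (fun s => k (x, s) *m f s).
  by apply: mxmeasM fi.1; exact: mxmeas_comp.
rewrite -lee_fin.
have := @EI_nm_cut _ m p n p
  (fun t => if 0 <= t <= x then k (x, t) *m f t else 0) f C C0 (mxmeas_itv x mkx) fi.
have nmx := nm_Int (mxmeas_itv x mkx) => h.
apply: le_trans nmx (h _) => t; case: ifP => _.
  by rewrite (le_trans (nmM _ _)) // ler_wpM2r ?nm_ge0.
by rewrite nm0 mulr_ge0 ?nm_ge0.
Qed.

Lemma Bdd_vol m n p (k : R * R -> 'M[R[i]]_(m, n)) (f : R -> 'M[R[i]]_(n, p)) :
  Bdd k -> L1 f -> Bdd (vol k f).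
Proof.
move=> bk fi; have [C C0 kC] := BddP bk.
split; first exact: mxmeas_vol bk.1 fi.1.
by exists (C * fine (EI (fun t => nm (f t)))) => x; apply: nm_vol_le => //; exact: bk.1.
Qed.

Lemma supp_vol T m n p (k : R * R -> 'M[R[i]]_(m, n)) (f : R -> 'M[R[i]]_(n, p)) :
  triangular T k -> supp T (vol k f).
Proof.
move=> tk x xT; rewrite /vol -(Int0 m p); apply: eq_Int => s.
case: ifP => // /andP[s0 sx]; rewrite tk ?mul0mx //.
by apply: contra xT => /andP[_ ->]; rewrite (le_trans s0 sx).
Qed.

Lemma L2_vol T m n p (k : R * R -> 'M[R[i]]_(m, n)) (f : R -> 'M[R[i]]_(n, p)) :
  0 <= T -> Bdd k -> triangular T k -> L2 T f -> L2 T (vol k f).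
Proof.
move=> T0 bk tk lf; apply: L2_Bdd => //; last exact: supp_vol.
by apply: Bdd_vol => //; exact: L2_L1 lf.
Qed.

End Volterra.

Section Kernel.
Context {R : realType} (T : R) (r p : nat).
Context (a : R -> 'M[R[i]]_(r, p)) (b : R -> 'M[R[i]]_(p, r)).
Hypothesis T0 : 0 <= T.
Hypothesis La : L2 T a.
Hypothesis Lb : L2 T b.
Implicit Types (N : R * R -> 'M[R[i]]_r).

(** The integral starts at 0 instead of s; the two agree for a kernel that vanishes for t < s, as
    the fixed point does. *)
Definition bN N (z : R * R) := prim (fun t => b t *m N (t, z.2)) z.1.
(* At z = (y, s), the kernel of f |-> int_0^y b(t) ((I + N) f)(t) dt *)
Definition kc N (z : R * R) := b z.2 + bN N z.
(** Up to sign, the right-hand side of the equation for N at the point (y, y - v) of the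
    characteristic x - s = v. The characteristic enters the triangle at y = v, where s = 0; starting
    the integral there encodes N(x, 0) = 0. *)
Definition pv N v y := if v <= y then a y *m kc N (y, y - v) else 0.
(** The value 0 off the triangle makes every fixed point triangular. *)
Definition kstep N (z : R * R) :=
  if (0 <= z.2 <= z.1) && (z.1 <= T) then - prim (pv N (z.1 - z.2)) z.1 else 0.

Let b1 : L1 b. Proof. exact: L2_L1 Lb. Qed.
Let a1 : L1 a. Proof. exact: L2_L1 La. Qed.

Lemma Bdd_bN N : Bdd N -> Bdd (bN N).
Proof.
move=> bdN; have [C C0 NC] := BddP bdN.
have mb := b1.1; split.
  apply: (mxmeas_prim (f := fun z => b z.2 *m N (z.2, z.1.2)) (h := fst)) => //.
  apply: mxmeasM; first exact: (mxmeas_comp measurable_snd mb).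
  apply: mxmeas_comp bdN.1; apply: measurable_fun_pair => //.
  exact: measurableT_comp.
exists (C * fine (EI (fun t => nm (b t)))) => z; rewrite -lee_fin.
have mz : mxmeas (fun t => b t *m N (t, z.2)).
  by apply: mxmeasM => //; exact: mxmeas_comp bdN.1.
have := @EI_nm_cut _ p r p r
  (fun t => if 0 <= t <= z.1 then b t *m N (t, z.2) else 0) b C C0 (mxmeas_itv z.1 mz) b1.
have nmx := nm_Int (mxmeas_itv z.1 mz) => h.
apply: le_trans nmx (h _) => t; case: ifP => _.
  by rewrite (le_trans (nmM _ _)) // mulrC ler_wpM2r ?nm_ge0.
by rewrite nm0 mulr_ge0 ?nm_ge0.
Qed.

Lemma mxmeas_pv N : Bdd N -> mxmeas (fun z : R * R => pv N z.1 z.2).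
Proof.
move=> bdN.
have ma := a1.1; have mb := b1.1.
have mB : measurable_fun setT (fun z : R * R => z.2 - z.1) by exact: measurable_funB.
apply: mxmeas_if (mxmeas_cst _).
  exact: measurable_fun_ler.
apply: mxmeasM; first exact: (mxmeas_comp measurable_snd ma).
apply: mxmeasD; first exact: (mxmeas_comp mB mb).
apply: (mxmeas_comp (h := fun z : R * R => (z.2, z.2 - z.1)) _ (Bdd_bN bdN).1).
exact: measurable_fun_pair.
Qed.

Lemma mxmeas_pv1 N v : Bdd N -> mxmeas (pv N v).
Proof.
move=> bdN; apply: (mxmeas_comp (h := fun y => (v, y)) _ (mxmeas_pv bdN)).
exact: measurable_fun_pair.
Qed.

(** Why N can be bounded: |a(y)||b(y - v)| <= |a(y)|^2 + |b(y - v)|^2, and the integral of the last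
    term does not depend on v. The rest of the integrand is a(y) times the bounded function [bN]. *)
Lemma EI_pv N : Bdd N -> exists2 K, 0 <= K &
  forall v, (EI (fun y => nm (pv N v y)) <= K%:E)%E.
Proof.
move=> bdN; have [C C0 NC] := BddP (Bdd_bN bdN).
have [[ma ai] _] := La; have [[mb bi] _] := Lb.
have ma2 := measurable_nm2 ma; have mb2 := measurable_nm2 mb.
have mna := measurable_nm ma.
pose K := (EI (fun x => nm (a x) ^+ 2)%R + EI (fun x => nm (b x) ^+ 2)%R +
  C%:E * EI (fun x => nm (a x)))%E.
have K0 : (0 <= K)%E.
  apply: adde_ge0; first by apply: adde_ge0; apply: EI_ge0 => x; exact: sqr_ge0.
  by apply: mule_ge0; [rewrite lee_fin|apply: EI_ge0 => x; exact: nm_ge0].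
have Kfin : (K < +oo)%E.
  apply: lte_add_pinfty; first exact: lte_add_pinfty.
  by apply: lte_mul_pinfty; rewrite ?lee_fin //; exact: a1.2.
exists (fine K); first exact: fine_ge0.
move=> v; rewrite fineK ?ge0_fin_numE //.
apply: (@le_trans _ _ (EI (fun y => nm (a y) ^+ 2 + nm (b (y - v)) ^+ 2 +
    C * nm (a y)))).
  have mbv := measurable_nm2 (mxmeas_shift v mb).
  apply: EI_le.
  - by apply: measurable_nm; exact: mxmeas_pv1.
  - by apply: measurable_funD; [exact: measurable_funD|exact: measurable_funM].
  - move=> y; rewrite nm_ge0 /= /pv; case: ifP => _; last first.
      by rewrite nm0 !addr_ge0 ?sqr_ge0 ?mulr_ge0 ?nm_ge0.
    rewrite /kc mulmxDr /= (le_trans (nmD _ _)) //; apply: lerD.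
      rewrite (le_trans (nmM _ _)) //.
      have := nm_ge0 (a y); have := nm_ge0 (b (y - v)).
      set A := nm (a y); set B := nm _ => B0 A0.
      have := sqr_ge0 (A - B); rewrite sqrrB => h.
      have : 0 <= A * B by exact: mulr_ge0.
      by lra.
    by rewrite (le_trans (nmM _ _)) // mulrC ler_wpM2r ?nm_ge0.
have mbv := measurable_nm2 (mxmeas_shift v mb).
rewrite EI_D; [|exact: measurable_funD|exact: measurable_funM| |]; last 2 first.
- by move=> x; rewrite addr_ge0 ?sqr_ge0.
- by move=> x; rewrite mulr_ge0 ?nm_ge0.
rewrite EI_D //; last 2 first.
- by move=> x; rewrite sqr_ge0.
- by move=> x; rewrite sqr_ge0.
rewrite (@EI_shift _ v (fun x => nm (b x) ^+ 2)) // => [|x]; last exact: sqr_ge0.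
by rewrite EI_Z // => x; exact: nm_ge0.
Qed.

Lemma L1_pv N v : Bdd N -> L1 (pv N v).
Proof.
move=> bdN; split; first exact: mxmeas_pv1.
have [K _ hK] := EI_pv bdN; apply: le_lt_trans (hK v) _; exact: ltry.
Qed.

Lemma Bdd_kstep N : Bdd N -> Bdd (kstep N).
Proof.
move=> bdN.
have [K K0 hK] := EI_pv bdN; split.
  apply: mxmeas_if (mxmeas_cst _).
    apply: measurable_and; last exact: measurable_fun_ler.
    exact: (measurable_itv_bool measurable_snd measurable_fst).
  apply: mxmeasN.
  have mz : mxmeas (fun z : R * R * R => pv N (z.1.1 - z.1.2) z.2); last first.
    exact: (mxmeas_prim (h := fst) mz).
  apply: (mxmeas_comp (h := fun z : R * R * R => (z.1.1 - z.1.2, z.2))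
    _ (mxmeas_pv bdN)).
  apply: measurable_fun_pair => //; apply: measurable_funB; exact: measurableT_comp.
exists K => z; rewrite /kstep; case: ifP => _; last by rewrite nm0.
rewrite nmN -lee_fin; apply: le_trans (hK (z.1 - z.2)).
have mp := mxmeas_pv1 (z.1 - z.2) bdN.
apply: le_trans (nm_prim z.1 mp) _; apply: EI_le.
- apply: measurable_fun_ifT => //; [exact: measurable_itvcc|exact: measurable_nm].
- exact: measurable_nm.
- by move=> t; case: ifP; rewrite ?nm_ge0 lexx.
Qed.

(** The term b(s) cancels in the difference, and the integrations against |b| and then against |a|
    halve the bound twice. The weight depends on the first variable of the kernel, which is the
    variable of both integrations. *)
Lemma kstep_contract w : weight w -> weightfor a w -> weightfor b w ->
  forall N N' C, Bdd N -> Bdd N' -> 0 <= C ->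
  (forall z, nm (N z - N' z) <= C * w z.1) ->
  forall z, nm (kstep N z - kstep N' z) <= C / 2 * w z.1.
Proof.
move=> ww wa wb N N' C bdN bdN' C0 hC z.
have w0 t := weight_ge0 t ww.
have C2 : 0 <= C / 2 by rewrite divr_ge0.
have kcB y s : kc N' (y, s) - kc N (y, s) = bN N' (y, s) - bN N (y, s).
  by rewrite /kc opprD addrACA subrr add0r.
rewrite /kstep.
have [_|_] := boolP ((0 <= z.2 <= z.1) && (z.1 <= T)); last first.
  by rewrite subr0 nm0 mulr_ge0.
rewrite opprK addrC -primB; [|exact: L1_pv|exact: L1_pv].
apply: (@le_trans _ _ (C / 2 / 2 * w z.1)); last first.
  by rewrite ler_wpM2r // ler_pdivrMr // ler_peMr // ler1n.
apply: (prim_weight (a := a)) => //; first exact: a1.1.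
  by apply: mxmeasB; exact: mxmeas_pv1.
move=> y _; rewrite /pv.
have [_|_] := boolP (z.1 - z.2 <= y); last first.
  by rewrite subr0 nm0 !mulr_ge0 ?nm_ge0.
rewrite -mulmxBr (le_trans (nmM _ _)) // ler_wpM2l ?nm_ge0 //.
rewrite kcB /bN /=.
have mbN (M : R * R -> 'M[R[i]]_r) s : Bdd M -> L1 (fun t => b t *m M (t, s)).
  by move=> bM; apply: L1_BddMr => //; exact: (Bdd_pair2 s bM).
rewrite -primB; [|exact: mbN|exact: mbN].
apply: (prim_weight (a := b)) => //; first exact: b1.1.
  by apply: mxmeasB; exact: (mbN _ _ _).1.
move=> t _; rewrite -mulmxBr (le_trans (nmM _ _)) // ler_wpM2l ?nm_ge0 //.
by rewrite -opprB nmN (hC (t, _)).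
Qed.

Lemma kernel_exists : exists2 N, Bdd N & forall z, kstep N z = N z.
Proof.
have [w [ww wa wb]] := weight2 T0 La Lb.
have [_ w1 [Cw wC]] := ww.
exact: (contraction_fixpoint (w := fun z : R * R => w z.1) (Cw := Cw)
  (fun z => w1 _) (fun z => wC _) Bdd_kstep (kstep_contract ww wa wb)).
Qed.

End Kernel.

(** * The intertwining relation *)

Section Intertwining.
Context {R : realType} (T : R) (r p : nat).
Context (a : R -> 'M[R[i]]_(r, p)) (b : R -> 'M[R[i]]_(p, r)).
Context (N : R * R -> 'M[R[i]]_r).
Hypothesis T0 : 0 <= T.
Hypothesis La : L2 T a.
Hypothesis Lb : L2 T b.
Hypothesis bdN : Bdd N.
Hypothesis NE : forall z, kstep T a b N z = N z.

Let b1 : L1 b. Proof. exact: L2_L1 Lb. Qed.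
Let a1 : L1 a. Proof. exact: L2_L1 La. Qed.

Lemma kernel_triangular : triangular T N.
Proof. by move=> x s xs; rewrite -NE /kstep /= (negbTE xs). Qed.

Lemma kernel_diag (v x : R) : 0 <= v <= x -> x <= T ->
  N (x, x - v) = - prim (pv a b N v) x.
Proof.
move=> /andP[v0 vx] xT; rewrite -NE /kstep /= subr_ge0 vx xT lerBlDr lerDl v0 /=.
by rewrite subKr.
Qed.

Section ProductAlongDiagonals.
Context q (F g : R -> 'M[R[i]]_(r, q)).
Hypothesis Fg : ACd F g.

Let g1 : L1 g := Fg.1.
Let bdF : Bdd F := AC_Bdd Fg.
Let H (z : R * R) := N z *m g z.2 - a z.1 *m kc b N z *m F z.2.

Let mH : mxmeas H.
Proof.
have ma := a1.1; have mb := b1.1; have mg := g1.1; have mF := bdF.1.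
apply: mxmeasB.
  by apply: mxmeasM bdN.1 _; exact: (mxmeas_comp measurable_snd mg).
apply: mxmeasM; last exact: (mxmeas_comp measurable_snd mF).
apply: mxmeasM; first exact: (mxmeas_comp measurable_fst ma).
apply: mxmeasD; first exact: (mxmeas_comp measurable_snd mb).
exact: (Bdd_bN T0 Lb bdN).1.
Qed.

(** The product rule along x - s = v for N(y, y - v) and F(y - v). Since N vanishes where the
    characteristic enters the triangle, no boundary term with F(0) appears. *)
Lemma kernel_product (v x : R) : 0 <= v <= x -> x <= T ->
  N (x, x - v) *m F (x - v) =
  prim (fun y => if v <= y then H (y, y - v) else 0) x.
Proof.
move=> vx xT; have /andP[v0 vx'] := vx.
have pv1 := L1_pv T0 La Lb v bdN.
pose P y := - (0 + prim (pv a b N v) y).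
have acP : ACd P (fun y => - pv a b N v y) by exact: ACN (AC_prim 0 pv1).
have q1 : L1 (fun y => if v <= y then g (y - v) else 0).
  by apply: L1_cut; [exact: measurable_fun_ler|exact: L1_shift].
(* This is F(y - v), which equals F(0) for y <= v because [F] is constant on the negative
   half-line. *)
pose Q y := F 0 + prim (fun y => if v <= y then g (y - v) else 0) y.
have acQ : ACd Q _ := AC_prim (F 0) q1.
have QE y : Q y = F (y - v).
  by rewrite /Q (prim_shift y g1.1 v0) [RHS]Fg.2.
have := (ACM acP acQ).2 x.
rewrite QE {1 2}/P (prim_le0 pv1.1 (lexx 0)) !add0r oppr0 mul0mx add0r.
rewrite -kernel_diag // => ->; apply: eq_prim => y /andP[y0 yx].
rewrite QE /P add0r {1}/pv.
have [vy|_] := boolP (v <= y); last by rewrite oppr0 mul0mx mulmx0 addr0.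
rewrite /H /= addrC kernel_diag ?v0 //; last exact: le_trans yx xT.
by rewrite [X in _ + X = _]mulNmx.
Qed.

(** The substitution s = x - v puts the integrand on characteristics, where [kernel_product] writes
    it as an integral in y. Exchanging v and y and putting s = y - v then identifies the derivative
    of int_0^x N(x, s)F(s) ds as int_0^x H(x, s) ds. *)
Lemma vol_primitive (x : R) : 0 <= x <= T ->
  vol N F x = prim (fun y => prim (fun s => H (y, s)) y) x.
Proof.
move=> /andP[x0 xT].
have mNx : mxmeas (fun s => N (x, s) *m F s).
  by apply: mxmeasM bdF.1; exact: (Bdd_pair1 x bdN).1.
rewrite /vol (prim_reflection x mNx).
pose h (z : R * R) := if (0 <= z.1 <= x) && ((0 <= z.2 <= x) && (z.1 <= z.2))
  then H (z.2, z.2 - z.1) else 0.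
transitivity (Int (fun v => Int (fun y => h (v, y)))).
  rewrite {1}/prim; apply: eq_Int => v; case: ifPn => vx; last first.
    by rewrite -[LHS](Int0 r q); apply: eq_Int => y; rewrite /h /= (negbTE vx).
  rewrite kernel_product // /prim; apply: eq_Int => y; rewrite /h /= vx /=.
  by case: (0 <= y <= x).
have [K K0 hK] := EI_pv T0 La Lb bdN.
have [CF CF0 hF] := BddP bdF.
have [CN CN0 hN] := BddP bdN.
have mh : mxmeas h.
  apply: mxmeas_if (mxmeas_cst _).
    apply: measurable_and; first exact: (measurable_itv_bool measurable_fst (measurable_cst x)).
    apply: measurable_and; first exact: (measurable_itv_bool measurable_snd (measurable_cst x)).
    exact: measurable_fun_ler.
  apply: (mxmeas_comp (h := fun z : R * R => (z.2, z.2 - z.1)) _ mH).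
  by apply: measurable_fun_pair => //; exact: measurable_funB.
pose G := fine (EI (fun y => nm (g y))).
have gnm := measurable_nm g1.1.
have GE : EI (fun y => nm (g y)) = G%:E.
  rewrite fineK // ge0_fin_numE; first exact: g1.2.
  by apply: EI_ge0 => y; exact: nm_ge0.
have G0 : 0 <= G by apply: fine_ge0; apply: EI_ge0 => y; exact: nm_ge0.
have KG : 0 <= CF * K + CN * G by rewrite addr_ge0 ?mulr_ge0.
(* The dominating constant is uniform in v: K comes from [EI_pv], and G is unaffected by the
   translation of g. *)
rewrite (@Int_Fubini_dom _ _ _ h (fun v => if 0 <= v <= x then CF * K + CN * G else 0)) //.
- rewrite /prim; apply: eq_Int => y; case: ifPn => yx; last first.
    by rewrite -[RHS](Int0 r q); apply: eq_Int => v; rewrite /h /= (negbTE yx) andbF.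
  have mHy : mxmeas (fun s => H (y, s)) by exact: mxmeas_comp mH.
  transitivity (prim (fun v => H (y, y - v)) y);
    last exact: (esym (prim_reflection y mHy)).
  apply: eq_Int => v; rewrite /h /= yx /=; case/andP: yx => y0 yx.
  have [v0|] //= := leP 0 v.
  have [vy|] /= := leP v y; last by rewrite andbF.
  by rewrite (le_trans vy yx).
- by apply: measurable_fun_ifT => //; exact: measurable_itvcc.
- move=> v; have [vx|vx] := boolP (0 <= v <= x); last first.
    rewrite /h /= (negbTE vx) /= nm0 /EI.
    by rewrite integral0_eq.
  have mgv := mxmeas_shift v g1.1.
  have mpv := mxmeas_pv1 T0 La Lb v bdN.
  apply: (@le_trans _ _ (EI (fun y => CF * nm (pv a b N v y) + CN * nm (g (y - v))))).
    apply: EI_le.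
    + by apply: measurable_nm; apply: mxmeas_comp mh => //; exact: measurable_fun_pair.
    + apply: measurable_funD; apply: measurable_funM => //; exact: measurable_nm.
    + move=> y; rewrite nm_ge0 /= /h /= vx /=.
      have [/andP[_ vy]|_] := boolP ((0 <= y <= x) && (v <= y)); last first.
        by rewrite nm0 addr_ge0 ?mulr_ge0 ?nm_ge0.
      rewrite /H /= (le_trans (nmB _ _)) // addrC; apply: lerD.
        by rewrite /pv vy (le_trans (nmM _ _)) // mulrC ler_wpM2r ?nm_ge0.
      by rewrite (le_trans (nmM _ _)) // ler_wpM2r ?nm_ge0.
  rewrite EI_D; last 4 first.
  + by apply: measurable_funM => //; exact: measurable_nm.
  + by apply: measurable_funM => //; exact: measurable_nm.
  + by move=> y; rewrite mulr_ge0 ?nm_ge0.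
  + by move=> y; rewrite mulr_ge0 ?nm_ge0.
  rewrite !EI_Z //; last 4 first.
  + exact: measurable_nm.
  + by move=> y; exact: nm_ge0.
  + exact: measurable_nm.
  + by move=> y; exact: nm_ge0.
  rewrite (@EI_shift _ v (fun y => nm (g y))) //; last by move=> y; exact: nm_ge0.
  rewrite GE EFinD !EFinM leeD //.
  by apply: lee_wpmul2l => //; rewrite lee_fin.
- exact: EI_itv_fin.
Qed.

End ProductAlongDiagonals.

Definition Vop {q} (u : R -> 'M[R[i]]_(r, q)) (t : R) :=
  a t *m prim (fun s => b s *m u s) t.

Lemma L2_Vop q (u : R -> 'M[R[i]]_(r, q)) : L1 (fun s => b s *m u s) -> L2 T (Vop u).
Proof. by move=> bu; apply: L2Mr => //; exact: Bdd_prim. Qed.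

(* The integrated form of (d/dx + V) (I + N) = (I + N) d/dx. *)
Lemma intertwining q (F g : R -> 'M[R[i]]_(r, q)) : ACd F g -> L2 T g ->
  forall x, 0 <= x <= T ->
  cutoff T F x + vol N (cutoff T F) x =
  F 0 + prim (fun t => g t + vol N g t -
                       Vop (fun s => cutoff T F s + vol N (cutoff T F) s) t) x.
Proof.
move=> acF Lg x xT; have /andP[x0 xT'] := xT.
have bdF := AC_Bdd acF.
(* [F] is bounded but need not be integrable on the line, so [vol] is applied to its restriction to
   [0, T]. *)
have Lf := L2_cutoff T0 bdF.
set f := cutoff T F in Lf *.
have f1 : L1 f by exact: L2_L1 Lf.
have bf : Bdd f by exact: Bdd_cutoff.
have g1 : L1 g := acF.1.
have vf : Bdd (vol N f) by exact: Bdd_vol.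
pose u s := f s + vol N f s; rewrite -/(u x) -/u.
have bu : Bdd u by exact: BddD.
have LV : L2 T (Vop u) by apply: L2_Vop; exact: L1_BddMr.
have Lv : L2 T (vol N g) by apply: L2_vol => //; exact: kernel_triangular.
have V1 := L2_L1 T0 LV; have v1 := L2_L1 T0 Lv.
have -> : prim (fun t => g t + vol N g t - Vop u t) x =
    prim g x + prim (fun t => vol N g t - Vop u t) x.
  rewrite -(primD x g1 (L1B v1 V1)).
  by apply: eq_prim => t _; rewrite addrA.
rewrite addrA -acF.2 {1}/u.
rewrite (_ : f x = F x); last by rewrite /f cutoffE.
congr (_ + _).
transitivity (vol N F x).
  apply: eq_prim => s /andP[s0 sx]; rewrite /f cutoffE // s0 /=.
  exact: le_trans sx xT'.
rewrite (vol_primitive acF xT).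
apply: eq_prim => y /andP[y0 yx].
have Ny := Bdd_pair1 y bdN.
have By : Bdd (fun s => bN b N (y, s)).
  exact: (Bdd_pair1 y (Bdd_bN T0 Lb bdN)).
have l1 : L1 (fun s => b s *m f s) by exact: L1_BddMr.
have l2 : L1 (fun s => bN b N (y, s) *m f s) by exact: L1_BddMl.
have kfE s : kc b N (y, s) *m f s = b s *m f s + bN b N (y, s) *m f s.
  by rewrite /kc mulmxDl.
have kf1 : L1 (fun s => kc b N (y, s) *m f s).
  by rewrite (funext kfE); exact: L1D.
transitivity (prim (fun s => N (y, s) *m g s - a y *m (kc b N (y, s) *m f s)) y).
  apply: eq_prim => s /andP[s0 sy]; rewrite /= mulmxA /f cutoffE //.
  by rewrite s0 (le_trans sy) // (le_trans yx).
rewrite primB; [|exact: L1_BddMl|exact: L1Ml].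
rewrite (primMl (a y) y kf1); congr (_ - _ *m _).
rewrite (eq_prim (fun t _ => kfE t)) (primD y l1 l2).
transitivity (prim (fun s => b s *m f s + b s *m vol N f s) y); last first.
  by apply: eq_prim => s _; rewrite mulmxDr.
have l3 : L1 (fun s => b s *m vol N f s) by exact: L1_BddMr.
rewrite (primD y l1 l3).
(* The kernel [bN] is the composition of b with N; reversing the order of integration gives the
   integral of b(t)(N f)(t). *)
congr (_ + _); rewrite /bN /= -prim_comp //.
by move=> t s ts; apply: kernel_triangular; rewrite [s <= t]leNgt ts andbF.
Qed.

End Intertwining.

(** * Volterra resolvents *)

Section VolterraInverse.
Context {R : realType} (T : R) (r : nat) (N : R * R -> 'M[R[i]]_r).
Hypothesis T0 : 0 <= T.
Hypothesis bdN : Bdd N.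
Hypothesis tN : triangular T N.

Lemma volD q (f g : R -> 'M[R[i]]_(r, q)) x : L1 f -> L1 g ->
  vol N (fun t => f t + g t) x = vol N f x + vol N g x.
Proof.
move=> fi gi; have Nx := Bdd_pair1 x bdN.
rewrite -(primD x (L1_BddMl Nx fi) (L1_BddMl Nx gi)).
by apply: eq_prim => t _; rewrite mulmxDr.
Qed.

Lemma volB q (f g : R -> 'M[R[i]]_(r, q)) x : L1 f -> L1 g ->
  vol N (fun t => f t - g t) x = vol N f x - vol N g x.
Proof.
move=> fi gi; have Nx := Bdd_pair1 x bdN.
rewrite -(primB x (L1_BddMl Nx fi) (L1_BddMl Nx gi)).
by apply: eq_prim => t _; rewrite mulmxBr.
Qed.

Lemma bounded_weight : exists w, weight w /\
  forall q (C x : R) (f : R -> 'M[R[i]]_(r, q)), 0 <= C -> mxmeas f ->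
  (forall t, nm (f t) <= C * w t) -> nm (vol N f x) <= C / 2 * w x.
Proof.
have [K K0 hK] := BddP bdN.
(* The bound K on the kernel is encoded as a 1 by 1 matrix function on [0, T], so that [prim_weight]
   applies. *)
pose c := cutoff T (fun _ : R => (K +i* 0)%:M : 'M[R[i]]_1).
have Lc : L2 T c by apply: L2_cutoff => //; exact: Bdd_cst.
have [w [ww cw _]] := weight2 T0 Lc Lc.
have w0 t := weight_ge0 t ww.
exists w; split => // q C x f C0 mf fC.
apply: (prim_weight (a := c)) => //; first exact: L2_meas Lc.
  by apply: mxmeasM => //; exact: (Bdd_pair1 x bdN).1.
move=> t /andP[t0 tx]; have [xT|xT] := leP x T; last first.
  by rewrite tN ?mul0mx ?nm0 ?mulr_ge0 ?nm_ge0 // [x <= T]leNgt xT andbF.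
have -> : nm (c t) = K.
  rewrite /c cutoffE ?t0 ?(le_trans tx xT) //.
  by rewrite /nm !big_ord1 mxE eqxx mulr1n /cabs /= normr0 addr0 ger0_norm.
by rewrite (le_trans (nmM _ _)) // ler_pM ?nm_ge0.
Qed.

(** A solution of u = -Nu is bounded, since [vol] maps integrable functions to bounded ones;
    uniqueness of the fixed point then identifies it with 0. *)
Lemma vol_injective q (u : R -> 'M[R[i]]_(r, q)) : L2 T u ->
  (forall x, u x + vol N u x = 0) -> forall x, u x = 0.
Proof.
move=> Lu u0; have u1 := L2_L1 T0 Lu.
have [w [ww hw]] := bounded_weight.
have [_ w1 [Cw wC]] := ww.
have cu (v : R -> 'M[R[i]]_(r, q)) : Bdd v -> L1 (cutoff T v).
  by move=> bv; apply: (L2_L1 T0); exact: L2_cutoff.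
have bu : Bdd u.
  rewrite (_ : u = fun x => - vol N u x); first by apply: BddN; exact: Bdd_vol.
  by apply/funext => x; apply/eqP; rewrite -addr_eq0 u0.
apply: (contraction_uniq (w := w) (Phi := fun v x => - vol N (cutoff T v) x)) => //.
- by move=> v bv; apply: BddN; apply: Bdd_vol => //; exact: cu.
- move=> v v' C bv bv' C0 vv' x.
  rewrite -opprD nmN -volB; [|exact: cu|exact: cu].
  apply: hw => //.
    by apply: mxmeasB; [exact: (cu v bv).1|exact: (cu v' bv').1].
  move=> t; rewrite /cutoff; have [_|_] := boolP (0 <= t <= T) => //.
  by rewrite subr0 nm0 mulr_ge0 // (le_trans _ (w1 t)).
- exact: Bdd_cst.
- move=> x; rewrite (_ : cutoff T u = u); last first.
    by apply/funext => t; rewrite /cutoff; case: ifPn => // /Lu.2 ->.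
  by apply/eqP; rewrite eq_sym -addr_eq0 u0.
- move=> x; rewrite (_ : vol N _ x = 0) ?oppr0 //.
  rewrite /vol -[RHS](prim0 r q x); apply: eq_prim => t _.
  by rewrite /cutoff if_same mulmx0.
Qed.

(** The equation says (I + N)(I + M) = I and is solved as the fixed point M = -N - NM, with s as a
    parameter. [Phi] is 0 off the triangle, where every term of the equation vanishes. *)
Lemma resolvent_exists : exists M : R * R -> 'M[R[i]]_r, [/\ Bdd M, triangular T M &
  forall x s, M (x, s) + N (x, s) + prim (fun t => N (x, t) *m M (t, s)) x = 0].
Proof.
pose Phi (M : R * R -> 'M[R[i]]_r) (z : R * R) :=
  if (0 <= z.2 <= z.1) && (z.1 <= T)
  then - N z - vol N (cutoff T (fun t => M (t, z.2))) z.1 else 0.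
have [w [ww hw]] := bounded_weight.
have [_ w1 [Cw wC]] := ww.
have cu (M : R * R -> 'M[R[i]]_r) s : Bdd M -> L1 (cutoff T (fun t => M (t, s))).
  by move=> bM; apply: (L2_L1 T0); apply: L2_cutoff => //; exact: (Bdd_pair2 s bM).
have PhiB M : Bdd M -> Bdd (Phi M).
  move=> bM; apply: Bdd_if.
    apply: measurable_and; last exact: measurable_fun_ler.
    exact: (measurable_itv_bool measurable_snd measurable_fst).
  apply: BddB; first exact: BddN.
  have [K K0 hK] := BddP bdN; have [C C0 hC] := BddP bM.
  split.
    have mz : mxmeas (fun z : R * R * R => N (z.1.1, z.2) *m
        (if 0 <= z.2 <= T then M (z.2, z.1.2) else 0)).
      apply: mxmeasM.
        apply: mxmeas_comp bdN.1; apply: measurable_fun_pair => //.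
        exact: measurableT_comp.
      apply: mxmeas_if (mxmeas_cst _).
        exact: (measurable_itv_bool measurable_snd (measurable_cst T)).
      apply: mxmeas_comp bM.1; apply: measurable_fun_pair => //.
      exact: measurableT_comp.
    exact: (mxmeas_prim (h := fst) mz).
  exists (K * (C * T)) => z.
  apply: le_trans (nm_vol_le z.1 K0 bdN.1 hK (cu M z.2 bM)) _.
  rewrite ler_wpM2l //.
  have h : (EI (fun t => nm (cutoff T (fun t => M (t, z.2)) t)) <= (C * T)%:E)%E.
    rewrite -EI_itv //; apply: EI_le.
    - exact: (measurable_nm (cu M z.2 bM).1).
    - by apply: measurable_fun_ifT => //; exact: measurable_itvcc.
    - move=> t; rewrite nm_ge0 /= /cutoff.
      by have [_|_] := boolP (0 <= t <= T); rewrite ?nm0.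
  rewrite -lee_fin fineK // ge0_fin_numE; first exact: (le_lt_trans h (ltry _)).
  by apply: EI_ge0 => t; exact: nm_ge0.
have [M bM ME] : exists2 M, Bdd M & forall z, Phi M z = M z.
  apply: (contraction_fixpoint (w := fun z : R * R => w z.1) (Cw := Cw)) => //.
  move=> M M' C bM bM' C0 MM' z; rewrite /Phi.
  have [_|_] := boolP ((0 <= z.2 <= z.1) && (z.1 <= T)); last first.
    by rewrite subr0 nm0 !mulr_ge0 // (le_trans _ (w1 _)).
  rewrite opprD addrACA subrr add0r opprK addrC.
  rewrite -volB; [|exact: cu|exact: cu].
  apply: hw => //; first by apply: mxmeasB; exact: (cu _ _ _).1.
  move=> t; rewrite /cutoff; have [_|_] := boolP (0 <= t <= T).
    by rewrite -opprB nmN (MM' (t, _)).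
  by rewrite subr0 nm0 mulr_ge0 // (le_trans _ (w1 t)).
have tM : triangular T M by move=> x s xs; rewrite -ME /Phi /= (negbTE xs).
exists M; split => // x s.
have [/andP[/andP[s0 sx] xT]|xs] := boolP ((0 <= s <= x) && (x <= T)).
  rewrite -ME {1}/Phi /= s0 sx xT /= (_ : vol N _ x =
    prim (fun t => N (x, t) *m M (t, s)) x).
    by rewrite addrAC subrK addNr.
  apply: eq_prim => t /andP[t0 tx]; rewrite cutoffE // t0 /=.
  exact: le_trans tx xT.
rewrite tM // tN // !add0r -(Int0 r r); apply: eq_Int => t.
have [/andP[t0 tx]|//] := boolP (0 <= t <= x).
have [xT|xT] := leP x T; last by rewrite tN ?mul0mx // [x <= T]leNgt xT andbF.
rewrite tM ?mulmx0 //; apply: contra xs => /andP[/andP[-> st] _].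
by rewrite (le_trans st tx) xT.
Qed.

Variable M : R * R -> 'M[R[i]]_r.
Hypothesis bdM : Bdd M.
Hypothesis tM : triangular T M.
Hypothesis ME : forall x s,
  M (x, s) + N (x, s) + prim (fun t => N (x, t) *m M (t, s)) x = 0.

Lemma resolventK q (f : R -> 'M[R[i]]_(r, q)) x : L2 T f ->
  f x + vol M f x + vol N (fun t => f t + vol M f t) x = f x.
Proof.
move=> Lf; have f1 := L2_L1 T0 Lf.
have v1 : L1 (vol M f) by apply: (L2_L1 T0); exact: L2_vol.
rewrite volD // -addrA -[RHS]addr0; congr (_ + _).
have Nx := Bdd_pair1 x bdN; have Mx := Bdd_pair1 x bdM.
have Nx1 : L1 (fun t => N (x, t)).
  apply: (L2_L1 T0); apply: L2_Bdd => // t tT; apply: tN.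
  by apply: contra tT => /andP[/andP[-> tx] xT]; rewrite (le_trans tx xT).
rewrite (_ : vol N (vol M f) x =
    prim (fun s => prim (fun t => N (x, t) *m M (t, s)) x *m f s) x); last first.
  rewrite /vol prim_comp // => t s ts; apply: tM.
  by rewrite [s <= t]leNgt ts andbF.
have E s : prim (fun t => N (x, t) *m M (t, s)) x = - (M (x, s) + N (x, s)).
  by apply/eqP; rewrite -addr_eq0 addrC ME.
have l1 : L1 (fun s => M (x, s) *m f s + N (x, s) *m f s).
  by apply: L1D; exact: L1_BddMl.
rewrite /vol addrA -(primD x (L1_BddMl Mx f1) (L1_BddMl Nx f1)) -[RHS](subrr
  (prim (fun s => M (x, s) *m f s + N (x, s) *m f s) x)) -(primN x l1).
congr (_ + _); apply: eq_prim => s _.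
by rewrite E mulNmx mulmxDl.
Qed.

(** The resolvent equation gives a right inverse of I + N. For the left inverse, [resolventK] shows
    that I + N annihilates (I + M)(I + N)f - f, and I + N is injective. *)
Lemma resolventKV q (f : R -> 'M[R[i]]_(r, q)) x : L2 T f ->
  f x + vol N f x + vol M (fun t => f t + vol N f t) x = f x.
Proof.
move=> Lf; pose g t := f t + vol N f t.
have Lg : L2 T g by apply: L2D => //; exact: L2_vol.
pose u t := g t + vol M g t.
have Lu : L2 T u by apply: L2D => //; exact: L2_vol.
rewrite -/(g x) -/g -/(u x).
apply/eqP; rewrite -subr_eq0; apply/eqP.
apply: (vol_injective (u := fun t => u t - f t)) => [|t]; first exact: L2B.
rewrite (volB t (L2_L1 T0 Lu) (L2_L1 T0 Lf)) addrACA -opprD.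
transitivity (g t - g t); last exact: subrr.
by congr (_ - _); exact: (resolventK t Lg).
Qed.

End VolterraInverse.

(** * The conjugated operator *)

Section Uniqueness.
Context {R : realType} (T : R) (r p : nat).
Context (a : R -> 'M[R[i]]_(r, p)) (b : R -> 'M[R[i]]_(p, r)).
Hypothesis T0 : 0 <= T.
Hypothesis La : L2 T a.
Hypothesis Lb : L2 T b.

Let b1 : L1 b. Proof. exact: L2_L1 Lb. Qed.

Lemma L1_bM q (u : R -> 'M[R[i]]_(r, q)) : Bdd u -> L1 (fun s => b s *m u s).
Proof. by move=> bu; exact: L1_BddMr. Qed.

Lemma L1_Vop q (u : R -> 'M[R[i]]_(r, q)) : Bdd u -> L1 (Vop a b u).
Proof.
by move=> bu; apply: (L2_L1 T0); apply: (L2_Vop La); exact: L1_bM.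
Qed.

Lemma VopB q (u v : R -> 'M[R[i]]_(r, q)) t : Bdd u -> Bdd v ->
  Vop a b (fun s => u s - v s) t = Vop a b u t - Vop a b v t.
Proof.
move=> bu bv; rewrite /Vop -mulmxBr -(primB t (L1_bM bu) (L1_bM bv)).
by congr (_ *m _); apply: eq_prim => s _; rewrite mulmxBr.
Qed.

Lemma Vop_injective q (u : R -> 'M[R[i]]_(r, q)) : Bdd u -> supp T u ->
  (forall x, 0 <= x <= T -> u x = - prim (Vop a b u) x) -> forall x, u x = 0.
Proof.
move=> bu su uE.
have [w [ww wa wb]] := weight2 T0 La Lb.
have [_ w1 [Cw wC]] := ww.
have w0 t := weight_ge0 t ww.
apply: (contraction_uniq (w := w)
   (Phi := fun v => cutoff T (fun x => - prim (Vop a b v) x))) => //.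
- move=> v bv; apply: Bdd_cutoff; apply: BddN; apply: Bdd_prim; exact: L1_Vop.
- move=> v v' C bv bv' C0 vv' x.
  have C2 : 0 <= C / 2 by rewrite divr_ge0.
  rewrite /cutoff; have [_|_] := boolP (0 <= x <= T); last first.
    by rewrite subr0 nm0 mulr_ge0.
  rewrite -opprD nmN -(primB x (L1_Vop bv) (L1_Vop bv')).
  apply: (@le_trans _ _ (C / 2 / 2 * w x)); last first.
    by rewrite ler_wpM2r // ler_pdivrMr // ler_peMr // ler1n.
  apply: (prim_weight (a := a)) => //; first exact: L2_meas La.
    by apply: mxmeasB; [exact: (L1_Vop bv).1|exact: (L1_Vop bv').1].
  move=> t _; rewrite -VopB // /Vop (le_trans (nmM _ _)) // ler_wpM2l ?nm_ge0 //.
  have bvv := BddB bv bv'.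
  apply: (prim_weight (a := b)) => //; first exact: L2_meas Lb.
    exact: (L1_bM bvv).1.
  by move=> s _; rewrite (le_trans (nmM _ _)) // ler_wpM2l ?nm_ge0.
- exact: Bdd_cst.
- move=> x; rewrite /cutoff; have [xT|xT] := boolP (0 <= x <= T); first by rewrite -uE.
  by rewrite su.
- move=> x; rewrite /cutoff; case: (0 <= x <= T) => //.
  rewrite (_ : prim _ x = 0) ?oppr0 // -[RHS](prim0 r q x).
  apply: eq_prim => t _; rewrite /Vop -[RHS](mulmx0 q (a t)); congr (_ *m _).
  by rewrite -[RHS](prim0 p q t); apply: eq_prim => s _; rewrite mulmx0.
Qed.

(** The similarity and the differentiability of E^-1 both rest on this: two functions are identified
    through a common integral equation instead of being differentiated. *)
Lemma Vop_uniq q (u v h : R -> 'M[R[i]]_(r, q)) c : L1 h -> Bdd u -> Bdd v ->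
  (forall x, 0 <= x <= T -> u x = c + prim (fun t => h t - Vop a b u t) x) ->
  (forall x, 0 <= x <= T -> v x = c + prim (fun t => h t - Vop a b v t) x) ->
  forall x, 0 <= x <= T -> u x = v x.
Proof.
move=> hi bu bv uE vE.
pose d := cutoff T (fun x => u x - v x).
have bd : Bdd d by apply: Bdd_cutoff; exact: BddB.
suff d0 : forall x, d x = 0.
  by move=> x xT; apply/eqP; rewrite -subr_eq0 -(d0 x) /d cutoffE.
apply: Vop_injective => //; first exact: supp_cutoff.
move=> x xT; rewrite /d cutoffE // uE // vE // opprD addrACA subrr add0r.
have lu := L1_Vop bu; have lv := L1_Vop bv.
rewrite -(primB x (L1B hi lu) (L1B hi lv)) -(primN x (L1_Vop bd)).
apply: eq_prim => t /andP[t0 tx].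
have -> : Vop a b (cutoff T (fun x => u x - v x)) t = Vop a b u t - Vop a b v t.
  rewrite -VopB //; congr (_ *m _); apply: eq_prim => s /andP[s0 st].
  rewrite cutoffE // s0 /= (le_trans st) // (le_trans tx) //.
  by case/andP: xT.
by rewrite !opprB addrC subrKA.
Qed.

End Uniqueness.

(** * Fundamental matrices and the operator d/dx + V *)

Section FundamentalPair.
Context {R : realType}.

(** The adjoint equation for V is a linear system after transposition. Then VU has derivative zero
    and stays equal to I, and for square matrices UV = I follows. *)
Lemma fundamental_pair (T : R) n (B : R -> 'M[R[i]]_n) : 0 <= T -> L2 T B ->
  exists U V : R -> 'M[R[i]]_n,
    [/\ ACd U (fun x => B x *m U x), ACd V (fun x => - (V x *m B x)),
        U 0 = 1%:M, forall x, V x *m U x = 1%:M & forall x, U x *m V x = 1%:M].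
Proof.
move=> T0 LB.
have [U aU U0] := linear_ode (1%:M : 'M[R[i]]_n) T0 LB.
have [V aV V0] := linear_ode (1%:M : 'M[R[i]]_n) T0 (L2N (L2_tr LB)).
have aVt : ACd (fun x => (V x)^T) (fun x => - ((V x)^T *m B x)).
  apply: eq_AC (AC_tr aV) _ _ => // x.
  by rewrite mulNmx raddfN /= trmx_mul trmxK.
have VU x : (V x)^T *m U x = 1%:M.
  rewrite (AC0 (ACM aVt aU)) ?V0 ?U0 ?trmx1 ?mul1mx // => y.
  by rewrite mulNmx mulmxA addNr.
exists U, (fun x => (V x)^T); split => // x; exact: mulmx1C.
Qed.

End FundamentalPair.

Section Similarity.
Context {R : realType} (T : R) (r p : nat).
Context (F F' : R -> 'M[R[i]]_(r, p)) (G G' : R -> 'M[R[i]]_(p, r)).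
Hypothesis T0 : 0 <= T.
Hypothesis aF : ACd F F'.
Hypothesis aG : ACd G G'.
Hypothesis LF' : L2 T F'.
Hypothesis LG' : L2 T G'.
Hypothesis FG1 : forall x, F x *m G x = 1%:M.
Context (rho sigma : R -> 'M[R[i]]_r) (W X : R -> 'M[R[i]]_p).
Hypothesis arho : ACd rho (fun x => F' x *m G x *m rho x).
Hypothesis asigma : ACd sigma (fun x => - (sigma x *m (F' x *m G x))).
Hypothesis sr1 : forall x, sigma x *m rho x = 1%:M.
Hypothesis rs1 : forall x, rho x *m sigma x = 1%:M.
Hypothesis aX : ACd X (fun x => X x *m (G x *m F' x)).
Hypothesis aW : Bdd W.
Hypothesis WX1 : forall x, W x *m X x = 1%:M.

Definition sim_a x := sigma x *m F' x *m W x.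
Definition sim_b x := X x *m (G x *m F' x *m G x + G' x) *m rho x.

Let bF := AC_Bdd aF.
Let bG := AC_Bdd aG.
Let brho := AC_Bdd arho.
Let bsigma := AC_Bdd asigma.
Let bX := AC_Bdd aX.

Lemma L2_sim_a : L2 T sim_a.
Proof. by apply: L2Mr => //; exact: L2Ml. Qed.

Lemma L2_sim_b : L2 T sim_b.
Proof.
apply: L2Mr => //; apply: L2Ml => //; apply: L2D => //.
by apply: L2Mr => //; exact: L2Ml.
Qed.

(* The conjugated operator rho^-1 K rho inverts d/dx + V. *)
Lemma conjugated_equation q (u : R -> 'M[R[i]]_(r, q)) : L1 u ->
  let Q x := sigma x *m (F x *m prim (fun t => G t *m (rho t *m u t)) x) in
  Bdd Q /\ forall x, Q x = prim (fun t => u t - Vop sim_a sim_b Q t) x.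
Proof.
move=> u1 Q.
have Gu1 : L1 (fun t => G t *m (rho t *m u t)).
  by do 2 apply: L1_BddMl => //.
pose z x : 'M[R[i]]_(p, q) := 0 + prim (fun t => G t *m (rho t *m u t)) x.
have az : ACd z _ := AC_prim 0 Gu1.
(* With y = rho Q = F z one has y' = F'G y + F'(z - G y) + rho u; conjugation by rho removes the
   term F'G y. *)
have aQ : ACd Q (fun x => sigma x *m (F' x *m (z x - G x *m (rho x *m Q x))) + u x).
  apply: eq_AC (ACM asigma (ACM aF az)) _ _ => x; first by rewrite /Q /z add0r.
  have -> : rho x *m Q x = F x *m z x.
    by rewrite /Q mulmxA rs1 mul1mx /z add0r.
  have h1 : sigma x *m (F x *m (G x *m (rho x *m u x))) = u x.
    by rewrite (mulmxA (F x)) FG1 mul1mx mulmxA sr1 mul1mx.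
  rewrite mulmxDr h1 addrA; congr (_ + _).
  by rewrite addrC !mulmxBr mulNmx !mulmxA.
have bQ := AC_Bdd aQ.
split => // x.
have z0 : z 0 = 0 by rewrite /z (prim_le0 Gu1.1 (lexx 0)) addr0.
have Q0 : Q 0 = 0.
  by rewrite /Q (prim_le0 Gu1.1 (lexx 0)) !mulmx0.
(* The defect e = z - G y, with y = rho Q, satisfies F e = 0 and e' = -GF'e - (GF'G + G')y. The
   integrating factor X = W^-1 leaves Z' = -b Q; as Z(0) = 0, the integral of b Q is -Z. *)
pose Z x := X x *m (z x - G x *m (rho x *m Q x)).
have aZ : ACd Z (fun x => - (sim_b x *m Q x)).
  apply: eq_AC (ACM aX (ACB az (ACM aG (ACM arho aQ)))) _ _ => // y.
  have zid (A B C D : 'M[R[i]]_(p, q)) :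
      A - B + (C - (D + (A + C))) = - (B + D).
    rewrite (addrA D) opprD [C + _]addrC subrK opprD addrC subrKA -opprD.
    by rewrite [D + B]addrC.
  set v := rho y *m Q y; set e := z y - G y *m v.
  have -> : F' y *m G y *m rho y *m Q y +
      rho y *m (sigma y *m (F' y *m e) + u y) = F' y *m z y + rho y *m u y.
    rewrite mulmxDr (mulmxA (rho y)) rs1 mul1mx addrA; congr (_ + _).
    by rewrite -(mulmxA _ (rho y)) -/v -mulmxA -mulmxDr addrC subrK.
  have -> : sim_b y *m Q y =
      X y *m (G y *m (F' y *m (G y *m v)) + G' y *m v).
    by rewrite /sim_b -[X y *m _ *m rho y]mulmxA -mulmxA; congr (_ *m _);
      rewrite -mulmxA -/v mulmxDl !mulmxA.
  rewrite -mulmxA -mulmxDr -mulmxN; congr (_ *m _).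
  rewrite -(zid (G y *m (F' y *m z y)) (G y *m (F' y *m (G y *m v)))
    (G y *m (rho y *m u y)) (G' y *m v)).
  by rewrite -(mulmxA (G y)) /e !mulmxBr mulmxDr.
rewrite aQ.2 Q0 add0r; apply: eq_prim => t _.
have ZE : prim (fun s => sim_b s *m Q s) t = - Z t.
  rewrite aZ.2 /Z z0 Q0 !mulmx0 subr0 mulmx0 add0r -(primN _ aZ.1).
  by apply: eq_prim => s _; rewrite opprK.
rewrite /Vop ZE mulmxN opprK addrC; congr (_ + _).
by rewrite /sim_a /Z !mulmxA -[sigma t *m F' t *m W t *m X t]mulmxA WX1 mulmx1.
Qed.

End Similarity.

(** * Transfer to functions on the open interval *)

Section Transfer.
Context {R : realType}.
Local Notation mu := (@lebesgue_measure R).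
Implicit Types T x : R.

(** For functions controlled only on the open interval, whose values at 0 and T are arbitrary;
    [cutoff] keeps these two values. *)
Definition ocut {m n} T (f : R -> 'M[R[i]]_(m, n)) x := if 0 < x < T then f x else 0.

Lemma ocutE m n T (f : R -> 'M[R[i]]_(m, n)) x : 0 < x < T -> ocut T f x = f x.
Proof. by rewrite /ocut => ->. Qed.

Lemma supp_ocut m n T (f : R -> 'M[R[i]]_(m, n)) : supp T (ocut T f).
Proof.
move=> x xT; rewrite /ocut; case: ifPn => // /andP[x0 xT'].
by rewrite (ltW x0) (ltW xT') in xT.
Qed.

Lemma co_ocut m n T (f : R -> 'M[R[i]]_(m, n)) k :
  (fun x => co (ocut T f x) k) = (fun x => co (f x) k) \_ `]0, T[.
Proof.
apply/funext => x; rewrite patchE /ocut.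
have -> : (x \in `]0, T[%classic) = (0 < x < T).
  by apply/idP/idP; rewrite inE /= in_itv.
by case: ifP => // _; rewrite co0.
Qed.

Lemma mxmeas_ocut m n T (f : R -> 'M[R[i]]_(m, n)) :
  mx_measurable `]0, T[ f <-> mxmeas (ocut T f).
Proof.
rewrite mx_measurableP; split=> mf k; have := mf k; rewrite co_ocut.
  by move/(measurable_restrictT _ (measurable_itv _)).
by move/(measurable_restrictT _ (measurable_itv _)).
Qed.

Lemma mxmeas_onD d (X : measurableType d) m n (D : set X) (f : X -> 'M[R[i]]_(m, n)) :
  mxmeas f -> mx_measurable D f.
Proof. by move=> mf; apply/mx_measurableP => k; apply: measurable_funTS. Qed.

Lemma mx_integrableP m n T (f : R -> 'M[R[i]]_(m, n)) :
  mx_integrable `]0, T[ f <-> L1 (ocut T f).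
Proof.
have e k : mu.-integrable `]0, T[ (EFin \o (fun x => co (f x) k)) <->
    mu.-integrable setT (EFin \o (fun x => co (ocut T f x) k)).
  rewrite co_ocut -restrict_EFin.
  exact: (integrable_mkcond (mu := mu) (D := `]0, T[%classic)).
split=> [fi|/L1P fi i j].
  by apply/L1P => -[[] [i j]]; apply/e; [exact: (fi i j).1|exact: (fi i j).2].
by split; [exact/(e (true, (i, j)))|exact/(e (false, (i, j)))].
Qed.

Lemma absc2_ocut m n T (f : R -> 'M[R[i]]_(m, n)) i j :
  (fun x => (absc2 (ocut T f x i j))%:E) = (fun x => (absc2 (f x i j))%:E) \_ `]0, T[.
Proof.
apply/funext => x; rewrite patchE /ocut.
have -> : (x \in `]0, T[%classic) = (0 < x < T).
  by apply/idP/idP; rewrite inE /= in_itv.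
by case: ifP => // _; rewrite mxE /absc2 /= expr0n addr0.
Qed.

Lemma measurable_absc2 d (X : measurableType d) m n (f : X -> 'M[R[i]]_(m, n)) i j :
  mxmeas f -> measurable_fun setT (fun y => absc2 (f y i j)).
Proof.
move=> mf; apply: measurable_funD; apply: measurable_funX.
  exact: (mf (true, (i, j))).
exact: (mf (false, (i, j))).
Qed.

Lemma square_summableP m n T (f : R -> 'M[R[i]]_(m, n)) :
  square_summable T f <-> L2 T (ocut T f).
Proof.
have e i j : mu.-integrable `]0, T[ (fun x => (absc2 (f x i j))%:E) <->
    mu.-integrable setT (fun x => (absc2 (ocut T f x i j))%:E).
  rewrite absc2_ocut.
  exact: (integrable_mkcond (mu := mu) (D := `]0, T[%classic)).
split=> [[/mxmeas_ocut mf fi]|[[mf fi] _]].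
  split; last exact: supp_ocut.
  pose s x := \sum_i \sum_j absc2 (ocut T f x i j).
  have ms : measurable_fun setT s.
    by do 2 apply: measurable_sum => ?; exact: measurable_absc2.
  have s0 x : 0 <= s x by rewrite !sumr_ge0 // => *; rewrite sumr_ge0 // => *; exact: absc2_ge0.
  apply: (Sq_dom (g := fun x => (m * n).*2%:R * s x)) => //.
  - exact: measurable_funM.
  - by move=> x; exact: nm_sqr_le.
  - apply: EI_finZ => //.
    have -> : EI s = (\int[mu]_x (\sum_i \sum_j (absc2 (ocut T f x i j))%:E))%E.
      apply: eq_integral => x _; rewrite /s -sumEFin.
      by apply: eq_bigr => i _; rewrite -sumEFin.
    apply: integrable_lty => //.
    apply: integrable_sum => // i _; apply: integrable_sum => // j _.
    by apply/e; exact: fi.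
split; first exact/mxmeas_ocut.
move=> i j; apply/e; apply/integrableP; split.
  by apply: measurable_EFinT; exact: measurable_absc2.
apply: le_lt_trans fi; apply: ge0_le_integral => //=.
- by apply: measurable_EFinT; apply: measurableT_comp => //; exact: measurable_absc2.
- by apply: measurable_EFinT; exact: measurable_nm2.
- by move=> x _; rewrite lee_fin ger0_norm ?absc2_ge0 ?absc2_le.
Qed.

Lemma square_summable_of m n T (f g : R -> 'M[R[i]]_(m, n)) : L2 T g ->
  (forall x, 0 < x < T -> f x = g x) -> square_summable T f.
Proof.
move=> Lg fg; apply/square_summableP.
have -> : ocut T f = ocut T g.
  by apply/funext => x; rewrite /ocut; case: ifP => // /fg.
split; last exact: supp_ocut.
have [[mg gi] _] := Lg.
apply: (Sq_dom (g := fun x => nm (g x) ^+ 2)) => //.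
- by apply: mxmeas_if (mxmeas_cst _) => //; exact: measurable_itvoo.
- exact: measurable_nm2.
- move=> x; rewrite /ocut; have [_|_] := boolP (0 < x < T) => //.
  by rewrite nm0 expr0n sqr_ge0.
Qed.

Lemma prim_ae1 m n p (k : R -> 'M[R[i]]_(m, n)) (g : R -> 'M[R[i]]_(n, p)) c M x :
  mxmeas k -> mxmeas g ->
  prim (fun t => k t *m (if t == c then M else g t)) x = prim (fun t => k t *m g t) x.
Proof.
move=> mk mg; apply: eq_Int_ae.
- apply: mxmeas_itv; apply: mxmeasM => //.
  by apply: mxmeas_if (mxmeas_cst _) _ => //; exact: measurable_fun_eqr.
- by apply: mxmeas_itv; exact: mxmeasM.
- by apply: aeS (ae_neq c) => t /negbTE tc _; rewrite tc.
Qed.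

(** f is measurable only on the open interval, while the integral runs over [0, x]. There f differs
    from its extension by zero at 0 and T at most, and single values do not affect the integral. *)
Lemma prim_ocut m n p T (k : R -> 'M[R[i]]_(m, n)) (f : R -> 'M[R[i]]_(n, p)) x :
  mxmeas k -> mx_measurable `]0, T[ f -> x <= T ->
  prim (fun t => k t *m f t) x = prim (fun t => k t *m ocut T f t) x.
Proof.
move=> mk /mxmeas_ocut mf xT.
pose f1 t := if t == T then f T else ocut T f t.
have mf1 : mxmeas f1.
  by apply: mxmeas_if (mxmeas_cst _) _ => //; exact: measurable_fun_eqr.
rewrite -(prim_ae1 T (f T) x mk mf) -/f1 -(prim_ae1 0 (f 0) x mk mf1).
apply: eq_prim => t /andP[t0 tx]; congr (_ *m _).
have [->//|tn0] := eqVneq t 0.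
rewrite /f1; have [->//|tnT] := eqVneq t T.
by rewrite ocutE // !lt_neqAle eq_sym tn0 t0 tnT (le_trans tx xT).
Qed.

Lemma prim_cutoff_ocut m n p T (k : R -> 'M[R[i]]_(m, n)) (f : R -> 'M[R[i]]_(n, p)) x :
  mxmeas k -> mxmeas f -> x <= T ->
  prim (fun t => k t *m cutoff T f t) x = prim (fun t => k t *m ocut T f t) x.
Proof.
move=> mk mf xT; rewrite -prim_ocut //; last exact: mxmeas_onD.
apply: eq_prim => t /andP[t0 tx]; rewrite cutoffE // t0.
exact: le_trans tx xT.
Qed.

Lemma eq_prim_ae m n p T (k : R -> 'M[R[i]]_(m, n)) (f g : R -> 'M[R[i]]_(n, p)) x :
  mxmeas k -> mxmeas (ocut T f) -> mxmeas (ocut T g) -> ae_eq mu `]0, T[%classic f g ->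
  prim (fun t => k t *m ocut T f t) x = prim (fun t => k t *m ocut T g t) x.
Proof.
move=> mk mf mg fg; apply: eq_Int_ae.
- by apply: mxmeas_itv; exact: mxmeasM.
- by apply: mxmeas_itv; exact: mxmeasM.
- apply: aeS fg => t fgt _; case: ifP => // _; congr (_ *m _).
  by rewrite /ocut; case: ifP => // tT; rewrite fgt //= in_itv.
Qed.

Lemma ae_eq_of (V : Type) T (f g : R -> V) :
  (forall x, 0 < x < T -> f x = g x) -> ae_eq mu `]0, T[%classic f g.
Proof.
move=> fg; exists set0; split => //.
move=> x /= nx; apply: nx => xT; apply: fg.
by move: xT; rewrite /= in_itv.
Qed.

(** The primitive is constant on each side of [0, T]; identities assumed on [0, T], such as FG = I,
    thereby extend to the line. *)
Lemma prim_clamp m n T (f : R -> 'M[R[i]]_(m, n)) x : 0 <= T -> mxmeas f -> supp T f ->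
  prim f x = prim f (Num.min (Num.max x 0) T).
Proof.
move=> T0 mf sf; have [x0|x0] := leP x 0.
  by rewrite min_l // prim_le0 // prim_le0.
have [xT|Tx] := leP x T => //.
apply: eq_Int => t; have [t0|] //= := leP 0 t.
have [tT|Tt] := leP t T; first by rewrite (le_trans tT (ltW Tx)).
by rewrite sf ?if_same // t0 /= -ltNge.
Qed.

(** The values of f outside [0, T] are unspecified; they are replaced by those of the extension that
    is constant there. *)
Lemma L2_derivativeP m n T (f f' : R -> 'M[R[i]]_(m, n)) : 0 <= T ->
  L2_derivative T f f' ->
  [/\ L2 T (ocut T f'), ACd (fun x => f 0 + prim (ocut T f') x) (ocut T f') &
      forall x, 0 <= x <= T -> f x = f 0 + prim (ocut T f') x].
Proof.
move=> T0 [[/mx_integrableP f1 fE] /square_summableP L].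
split => //; first exact: AC_prim.
move=> x xT; rewrite fE // primE; congr (_ + _).
case/andP: xT => _ xT.
transitivity (prim (fun t => 1%:M *m f' t) x).
  by apply: eq_prim => t _; rewrite mul1mx.
rewrite (prim_ocut (mxmeas_cst _) _ xT); last by apply/mxmeas_ocut; exact: f1.1.
by apply: eq_prim => t _; rewrite mul1mx.
Qed.

Lemma L2_differentiable_of m n T (f f' : R -> 'M[R[i]]_(m, n)) : ACd f f' ->
  L2 T f' -> L2_differentiable T f.
Proof.
move=> [f1 fE] L; exists f'; split; last exact: square_summable_of L _.
split; last by move=> x _; rewrite primE.
apply/mx_integrableP; apply: L1_cut => //; exact: measurable_itvoo.
Qed.

End Transfer.

(** * Bounded operators with a kernel *)

Section BoundedOperators.
Context {R : realType} (T : R) (r : nat).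
Local Notation mu := (@lebesgue_measure R).
Hypothesis T0 : 0 < T.

Definition sqint {m n} (f : R -> 'M[R[i]]_(m, n)) := fine (EI (fun x => nm (f x) ^+ 2)).

Lemma sqintE m n (f : R -> 'M[R[i]]_(m, n)) : L2 T f ->
  EI (fun x => nm (f x) ^+ 2) = (sqint f)%:E.
Proof.
move=> [[_ fi] _]; rewrite fineK // ge0_fin_numE //.
by apply: EI_ge0 => x; exact: sqr_ge0.
Qed.

(** Cauchy-Schwarz on [0, T], by integrating (|f| - s/T)^2 >= 0, where s/T is the mean of |f|. *)
Lemma sqr_L1_le m n (f : R -> 'M[R[i]]_(m, n)) : L2 T f ->
  fine (EI (fun t => nm (f t))) ^+ 2 <= T * sqint f.
Proof.
move=> Lf; have [mf fi] := L2_L1 (ltW T0) Lf.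
have mnf := measurable_nm mf; have mnf2 := measurable_nm2 mf.
set s := fine _.
have s0 : 0 <= s by apply: fine_ge0; apply: EI_ge0 => t; exact: nm_ge0.
have sE : EI (fun t => nm (f t)) = s%:E.
  by rewrite fineK // ge0_fin_numE //; apply: EI_ge0 => t; exact: nm_ge0.
have sT0 : 0 <= s / T by rewrite divr_ge0 // ltW.
have c0 : 0 <= 2 * (s / T) by rewrite mulr_ge0.
have mi : measurable_fun setT (fun t : R => if 0 <= t <= T then (s / T) ^+ 2 else 0).
  by apply: measurable_fun_ifT => //; exact: measurable_itvcc.
have h : (EI (fun t => 2 * (s / T) * nm (f t))%R <=
  EI (fun t => nm (f t) ^+ 2 + (if 0 <= t <= T then (s / T) ^+ 2 else 0))%R)%E.
  apply: EI_le.
  - exact: measurable_funM.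
  - exact: measurable_funD.
  - move=> t; rewrite mulr_ge0 ?nm_ge0 //=.
    have [tT|tT] := boolP (0 <= t <= T); last by rewrite Lf.2 // nm0 mulr0 expr0n addr0.
    rewrite -subr_ge0 (_ : _ - _ = (nm (f t) - s / T) ^+ 2) ?sqr_ge0 //.
    ring.
have := h; rewrite EI_Z //; last by move=> t; exact: nm_ge0.
rewrite EI_D //; last 2 first.
- by move=> t; exact: sqr_ge0.
- by move=> t; case: ifP => // _; exact: sqr_ge0.
rewrite sE (sqintE Lf) EI_itv ?sqr_ge0 //; last exact: ltW.
rewrite -EFinM -EFinD lee_fin.
have -> : (s / T) ^+ 2 * T = s ^+ 2 / T by field; exact: lt0r_neq0.
have -> : 2 * (s / T) * s = s ^+ 2 / T + s ^+ 2 / T by field; exact: lt0r_neq0.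
by rewrite lerD2r ler_pdivrMr // mulrC.
Qed.

Local Notation vfun := (R -> 'cV[R[i]]_r).

Lemma L2normE (f : vfun) : square_summable T f -> exists2 A, L2norm T f = Num.sqrt A &
  [/\ 0 <= A, A <= r%:R * sqint (ocut T f) & sqint (ocut T f) <= (r * 1).*2%:R * A].
Proof.
move=> /square_summableP Lf; have mf := L2_meas Lf.
pose s x := \sum_(i < r) absc2 (ocut T f x i 0).
have s0 x : 0 <= s x by rewrite sumr_ge0 // => *; exact: absc2_ge0.
have ms : measurable_fun setT s by apply: measurable_sum => ?; exact: measurable_absc2.
have mn2 := measurable_nm2 mf.
have h1 : (EI s <= (r%:R * sqint (ocut T f))%:E)%E.
  rewrite EFinM -sqintE // -EI_Z // => [|x]; last exact: sqr_ge0.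
  apply: EI_le => // [|x]; first exact: measurable_funM.
  rewrite s0 /= mulr_natl -[r in _ *+ r]card_ord -sumr_const.
  by apply: ler_sum => i _; exact: absc2_le.
have sE : EI s = (fine (EI s))%:E.
  by rewrite fineK // ge0_fin_numE ?EI_ge0 // (le_lt_trans h1) // ltry.
exists (fine (EI s)).
  rewrite /L2norm; congr Num.sqrt; rewrite Rintegral_mkcond /Rintegral; congr fine.
  apply: eq_integral => x _; rewrite patchE /s /ocut.
  have -> : (x \in `]0, T[%classic) = (0 < x < T).
    by apply/idP/idP; rewrite inE /= in_itv.
  case: ifP => // _; rewrite big1 // => i _; by rewrite mxE /absc2 /= expr0n addr0.
split.
- by apply: fine_ge0; exact: EI_ge0.
- by rewrite -lee_fin -sE.
- rewrite -lee_fin EFinM -sE -sqintE // -EI_Z //.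
  apply: EI_le => // [|x]; first exact: measurable_funM.
  rewrite sqr_ge0 /=; apply: le_trans (nm_sqr_le _) _.
  by rewrite ler_wpM2l // /s; apply: ler_sum => i _; rewrite big_ord1.
Qed.

(** A single criterion for K, A, E and E^-1, each of which is multiplication by a bounded matrix
    function plus a Volterra operator with bounded kernel. *)
Lemma kernel_operator (S : vfun -> vfun) (al : R -> 'M[R[i]]_r) (k : R * R -> 'M[R[i]]_r) :
  Bdd al -> Bdd k ->
  (forall f, square_summable T f -> forall x, 0 < x < T ->
    S f x = al x *m f x + vol k (ocut T f) x) ->
  bounded_operator T S.
Proof.
move=> bal bk SE; have T0' := ltW T0.
have L2S (f : vfun) : square_summable T f ->
    L2 T (fun x => al x *m ocut T f x + ocut T (vol k (ocut T f)) x).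
  move=> /square_summableP Lf; apply: L2D; first exact: L2Ml.
  apply: L2_Bdd => //; last exact: supp_ocut.
  apply: Bdd_if; first exact: measurable_itvoo.
  by apply: Bdd_vol => //; exact: L2_L1 Lf.
have SE' (f : vfun) : square_summable T f -> forall x, 0 < x < T ->
    S f x = al x *m ocut T f x + ocut T (vol k (ocut T f)) x.
  by move=> sf x xT; rewrite SE // !ocutE.
have SL2 (f : vfun) : square_summable T f -> square_summable T (S f).
  by move=> sf; apply: square_summable_of (L2S f sf) (SE' f sf).
split => //.
- move=> f g sf sg fg.
  have [/square_summableP Lf /square_summableP Lg] := (sf, sg).
  have kfg x : vol k (ocut T f) x = vol k (ocut T g) x.
    by apply: eq_prim_ae fg; [exact: (Bdd_pair1 x bk).1|exact: L2_meas Lf|exact: L2_meas Lg].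
  apply: aeS fg => x fgx xT.
  have xT' : 0 < x < T by move: xT; rewrite /= in_itv.
  by rewrite (SE f sf x xT') (SE g sg x xT') (fgx xT) kfg.
- move=> c f g sf sg.
  have [/square_summableP Lf /square_summableP Lg] := (sf, sg).
  have Lc : L2 T (fun x => c%:M *m ocut T f x + ocut T g x).
    by apply: L2D => //; apply: L2Ml => //; exact: Bdd_cst.
  have ce x : 0 < x < T -> c *: f x + g x = c%:M *m ocut T f x + ocut T g x.
    by move=> xT; rewrite !ocutE // mul_scalar_mx.
  have sc : square_summable T (fun x => c *: f x + g x).
    exact: square_summable_of Lc ce.
  apply: ae_eq_of => x xT; rewrite (SE f sf x xT) (SE g sg x xT) (SE _ sc x xT).
  have bkx := Bdd_pair1 x bk.
  have f1 := L1_BddMl bkx (L2_L1 T0' Lf); have g1 := L1_BddMl bkx (L2_L1 T0' Lg).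
  have -> : vol k (ocut T (fun x => c *: f x + g x)) x =
      c%:M *m vol k (ocut T f) x + vol k (ocut T g) x.
    rewrite /vol -(primMl c%:M x f1) -(primD x (L1Ml c%:M f1) g1).
    apply: eq_prim => t _; rewrite mulmxA -scalar_mxC -mulmxA -mulmxDr.
    congr (_ *m _); rewrite /ocut; case: ifP => _; rewrite mul_scalar_mx //.
    by rewrite scaler0 addr0.
  rewrite mulmxDr -!mul_scalar_mx mulmxDr !mulmxA scalar_mxC.
  exact: addrACA.
have [Ca Ca0 hCa] := BddP bal; have [Ck Ck0 hCk] := BddP bk.
(* From (Ca |f| + Ck s)^2 <= 2 Ca^2 |f|^2 + 2 Ck^2 s^2 with s = int |f|, integrated over [0, T],
   where s^2 <= T int |f|^2. *)
pose D := 2 * Ca ^+ 2 + 2 * (Ck ^+ 2 * T ^+ 2).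
have D0 : 0 <= D by rewrite addr_ge0 // mulr_ge0 // ?mulr_ge0 ?sqr_ge0.
have key (f : vfun) : square_summable T f ->
    sqint (ocut T (S f)) <= D * sqint (ocut T f).
  move=> sf; have /square_summableP Lf := sf.
  have /square_summableP LS := SL2 f sf.
  set s := fine (EI (fun t => nm (ocut T f t))).
  have sT : s ^+ 2 <= T * sqint (ocut T f) by exact: sqr_L1_le.
  have mf2 := measurable_nm2 (L2_meas Lf).
  have q0 : 0 <= 2 * (Ck ^+ 2 * s ^+ 2).
    by apply: mulr_ge0 => //; apply: mulr_ge0; exact: sqr_ge0.
  have mi : measurable_fun setT
     (fun x : R => if 0 <= x <= T then 2 * (Ck ^+ 2 * s ^+ 2) else 0).
    by apply: measurable_fun_ifT => //; exact: measurable_itvcc.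
  have Ca2 : 0 <= 2 * Ca ^+ 2 by rewrite mulr_ge0 ?sqr_ge0.
  have h : (EI (fun x => nm (ocut T (S f) x) ^+ 2)%R <= EI (fun x =>
     2 * Ca ^+ 2 * nm (ocut T f x) ^+ 2 +
     (if 0 <= x <= T then 2 * (Ck ^+ 2 * s ^+ 2) else 0))%R)%E.
    apply: EI_le.
    - exact: measurable_nm2 (L2_meas LS).
    - by apply: measurable_funD => //; exact: measurable_funM.
    - move=> x; rewrite sqr_ge0 /=.
      have [xT|xT] := boolP (0 < x < T); last first.
        rewrite {1}/ocut (negbTE xT) nm0 expr0n /=; apply: addr_ge0.
          by apply: mulr_ge0 => //; exact: sqr_ge0.
        by case: ifP.
      have xT2 : 0 <= x <= T by case/andP: xT => h1 h2; rewrite (ltW h1) (ltW h2).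
      rewrite xT2.
      rewrite (ocutE (S f) xT) (SE f sf x xT) -(ocutE f xT).
      set A := nm (ocut T f x).
      have A0 : 0 <= A by exact: nm_ge0.
      have b1 : nm (al x *m ocut T f x) <= Ca * A.
        by rewrite (le_trans (nmM _ _)) // ler_wpM2r.
      have b2 : nm (vol k (ocut T f) x) <= Ck * s.
        by apply: nm_vol_le => //; [exact: bk.1|exact: L2_L1 Lf].
      have s0 : 0 <= s by apply: fine_ge0; apply: EI_ge0 => t; exact: nm_ge0.
      apply: (@le_trans _ _ ((Ca * A + Ck * s) ^+ 2)).
        rewrite ler_pXn2r ?nnegrE ?nm_ge0 ?addr_ge0 ?mulr_ge0 //.
        by rewrite (le_trans (nmD _ _)) // lerD.
      rewrite -subr_ge0 (_ : _ - _ = (Ca * A - Ck * s) ^+ 2) ?sqr_ge0 //.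
      ring.
  rewrite -lee_fin -(sqintE LS) (le_trans h) // EI_D; last 4 first.
  - exact: measurable_funM.
  - exact: mi.
  - by move=> x; rewrite mulr_ge0 ?sqr_ge0.
  - by move=> x; case: ifP.
  rewrite EI_Z // => [|x]; last exact: sqr_ge0.
  rewrite (sqintE Lf) EI_itv // -EFinM -EFinD lee_fin /D (mulrDl (2 * Ca ^+ 2)) lerD2l.
  rewrite (_ : 2 * (Ck ^+ 2 * s ^+ 2) * T = 2 * Ck ^+ 2 * T * s ^+ 2); last by ring.
  rewrite (_ : 2 * (Ck ^+ 2 * T ^+ 2) * _ =
    2 * Ck ^+ 2 * T * (T * sqint (ocut T f))); last by ring.
  apply: ler_wpM2l => //; apply: mulr_ge0 => //; apply: mulr_ge0 => //.
  exact: sqr_ge0.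
(* The factors r and 2r come from comparing [nm] with the Euclidean norm, for the image and for the
   argument. *)
exists (Num.sqrt (r%:R * (D * (r * 1).*2%:R))) => f sf.
have [A -> [A0 _ Ah]] := L2normE sf.
have [B -> [B0 Bh _]] := L2normE (SL2 f sf).
rewrite -sqrtrM; last by rewrite !mulr_ge0.
apply: ler_wsqrtr; apply: (le_trans Bh).
rewrite -!mulrA ler_wpM2l // (le_trans (key f sf)) // ler_wpM2l //.
Qed.

End BoundedOperators.

(** * The operators E and its inverse *)

Section SimilarityOperators.
Context {R : realType} (T : R) (r p : nat).
Local Notation vfun := (R -> 'cV[R[i]]_r).
Hypothesis T0 : 0 < T.
Context (rho sigma rho' sigma' : R -> 'M[R[i]]_r) (N M : R * R -> 'M[R[i]]_r).
Hypothesis arho : ACd rho rho'.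
Hypothesis asigma : ACd sigma sigma'.
Hypothesis Lrho' : L2 T rho'.
Hypothesis Lsigma' : L2 T sigma'.
Hypothesis sr1 : forall x, sigma x *m rho x = 1%:M.
Hypothesis rs1 : forall x, rho x *m sigma x = 1%:M.
Context (a : R -> 'M[R[i]]_(r, p)) (b : R -> 'M[R[i]]_(p, r)).
Hypothesis La : L2 T a.
Hypothesis Lb : L2 T b.
Hypothesis bdN : Bdd N.
Hypothesis NE : forall z, kstep T a b N z = N z.
Hypothesis bdM : Bdd M.
Hypothesis tM : triangular T M.
Hypothesis ME : forall x s,
  M (x, s) + N (x, s) + prim (fun t => N (x, t) *m M (t, s)) x = 0.

Let T0' : 0 <= T := ltW T0.
Let tN : triangular T N := kernel_triangular NE.
Let brho : Bdd rho := AC_Bdd arho.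
Let bsigma : Bdd sigma := AC_Bdd asigma.
Local Notation E := (opE rho (fun x t => N (x, t))).

(** The operator (I + M)rho^-1. The argument of I + M is cut to the open interval, so that the
    result is square-integrable on the line. *)
Definition opEinv (f : vfun) : vfun := fun x =>
  let y := ocut T (fun t => sigma t *m f t) in y x + vol M y x.

Lemma opEE (f : vfun) x : E f x = rho x *m (f x + vol N f x).
Proof. by rewrite /opE primE. Qed.

Lemma vol_ocut (k : R * R -> 'M[R[i]]_r) (f : vfun) (x : R) : Bdd k ->
  mx_measurable `]0, T[ f -> x <= T -> vol k f x = vol k (ocut T f) x.
Proof. by move=> bk mf xT; apply: prim_ocut => //; exact: (Bdd_pair1 x bk).1. Qed.

Lemma vol_cutoff_ocut (k : R * R -> 'M[R[i]]_r) (f : vfun) (x : R) : Bdd k ->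
  mxmeas f -> x <= T -> vol k (cutoff T f) x = vol k (ocut T f) x.
Proof.
by move=> bk mf xT; apply: prim_cutoff_ocut => //; exact: (Bdd_pair1 x bk).1.
Qed.

Lemma ocut_mul m n (g : R -> 'M[R[i]]_(m, n)) q (f : R -> 'M[R[i]]_(n, q)) t :
  ocut T (fun s => g s *m f s) t = g t *m ocut T f t.
Proof. by rewrite /ocut; case: ifP => _; rewrite ?mulmx0. Qed.

Lemma bounded_opE : bounded_operator T E.
Proof.
apply: (@kernel_operator _ T r T0 _ rho (fun z => rho z.1 *m N z)) => //.
  by apply: BddM => //; exact: (Bdd_comp measurable_fst brho).
move=> f /square_summableP Lf x /andP[_ /ltW xT].
rewrite opEE (vol_ocut bdN) //; last by apply/mxmeas_ocut; exact: L2_meas Lf.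
have l1 : L1 (fun s => N (x, s) *m ocut T f s).
  by apply: L1_BddMl; [exact: (Bdd_pair1 x bdN)|exact: L2_L1 Lf].
rewrite mulmxDr; congr (_ + _); rewrite -(primMl (rho x) x l1).
by apply: eq_prim => t _; rewrite mulmxA.
Qed.

Lemma bounded_opEinv : bounded_operator T opEinv.
Proof.
apply: (@kernel_operator _ T r T0 _ sigma (fun z => M z *m sigma z.2)) => //.
  by apply: BddM => //; exact: (Bdd_comp measurable_snd bsigma).
move=> f _ x xT; rewrite /opEinv /= ocutE //; congr (_ + _).
by apply: eq_prim => t _; rewrite ocut_mul mulmxA.
Qed.

Lemma L2_opEinv f : square_summable T f -> L2 T (opEinv f).
Proof.
move=> /square_summableP Lf.
have Ly : L2 T (ocut T (fun t => sigma t *m f t)).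
  by rewrite (funext (ocut_mul sigma f)); exact: L2Ml.
by apply: L2D => //; exact: L2_vol.
Qed.

Lemma opEK f x : square_summable T f -> 0 < x < T -> E (opEinv f) x = f x.
Proof.
move=> /square_summableP Lf xT.
have Ly : L2 T (ocut T (fun t => sigma t *m f t)).
  by rewrite (funext (ocut_mul sigma f)); exact: L2Ml.
rewrite opEE /opEinv (resolventK T0' bdN tN bdM tM ME x Ly) ocutE //.
by rewrite mulmxA rs1 mul1mx.
Qed.

Lemma opEinvK f x : square_summable T f -> 0 < x < T -> opEinv (E f) x = f x.
Proof.
move=> /square_summableP Lf xT; have mf := L2_meas Lf.
pose g t := ocut T f t + vol N (ocut T f) t.
have Lg : L2 T g by apply: L2D => //; exact: L2_vol.
have -> : opEinv (E f) x = g x + vol M (ocut T g) x.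
  have e : ocut T (fun t => sigma t *m E f t) = ocut T g.
    apply/funext => t; rewrite /ocut; case: ifP => // /andP[t0 tT].
    rewrite opEE mulmxA sr1 mul1mx /g ocutE ?t0 //; congr (_ + _).
    by apply: vol_ocut => //; [exact/mxmeas_ocut|exact: ltW].
  by rewrite /opEinv e ocutE.
have /andP[_ /ltW xT'] := xT.
rewrite -vol_ocut //; last by apply: mxmeas_onD; exact: L2_meas Lg.
by rewrite (resolventKV T0' bdN tN bdM tM ME x Lf) ocutE.
Qed.

(** The intertwining relation exhibits (I + N)f as f(0) plus the primitive of h = (I + N)f' - V(I +
    N)f, which is square-summable. *)
Lemma opE_differentiable : preserves_L2_differentiable T E.
Proof.
move=> f [f' /(L2_derivativeP T0')[Lf' af fE]].
set g := fun x => _ in af; pose gc := cutoff T g.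
pose u x := gc x + vol N gc x.
have bg : Bdd g := AC_Bdd af.
have Lgc : L2 T gc by exact: L2_cutoff.
have Lu : L2 T u by apply: L2D => //; exact: L2_vol.
pose h t := ocut T f' t + vol N (ocut T f') t - Vop a b u t.
have Lh : L2 T h.
  apply: L2B; first by apply: L2D => //; exact: L2_vol.
  apply: (L2_Vop La); apply: L1_BddMr; first exact: L2_L1 Lb.
  by apply: BddD; [exact: Bdd_cutoff|apply: Bdd_vol => //; exact: L2_L1 Lgc].
have h1 := L2_L1 T0' Lh.
have aw : ACd (fun x => g 0 + prim h x) h by exact: AC_prim.
have aE := ACM arho aw.
exists (fun x => rho x *m (g 0 + prim h x)); last first.
  apply: (L2_differentiable_of aE).
  by apply: L2D; [exact: L2Mr (AC_Bdd aw)|exact: L2Ml].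
apply: ae_eq_of => x xT; have /andP[/ltW x0 /ltW xT'] := xT.
have xT2 : 0 <= x <= T by rewrite x0 xT'.
rewrite opEE -(intertwining T0' La Lb bdN NE af Lf' xT2) -/gc; congr (_ *m (_ + _)).
  by rewrite /gc cutoffE // fE.
apply: eq_prim => t /andP[t0 tx].
have tT : 0 <= t <= T by rewrite t0 (le_trans tx xT').
by rewrite /gc cutoffE // fE.
Qed.

(** The function (I + M)Y, with Y = rho^-1 f, is not differentiated directly, as nothing is known
    about derivatives of M. A primitive u is built for which (I + N)u solves the same integral
    equation as Y; by uniqueness (I + N)u = Y, hence u = (I + M)Y. *)
Lemma opEinv_differentiable : preserves_L2_differentiable T opEinv.
Proof.
move=> f [f' /(L2_derivativeP T0')[Lf' af fE]].
set g := fun x => _ in af; have bg : Bdd g := AC_Bdd af.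
have aY := ACM asigma af.
set Y := fun x => _ in aY; set Y' := fun x => _ in aY.
have bY : Bdd Y := AC_Bdd aY.
have LY' : L2 T Y' by apply: L2D; [exact: L2Mr|exact: L2Ml].
pose yc := cutoff T Y.
have byc : Bdd yc by exact: Bdd_cutoff.
have Lyc : L2 T yc by exact: L2_cutoff.
(* v is (d/dx + V)Y, and h = (I + M)v is the derivative that u must have for (d/dx + V)(I + N)u = (I
   + N)u' = v. *)
pose v t := Y' t + Vop a b yc t.
have Lv : L2 T v.
  by apply: L2D => //; apply: (L2_Vop La); exact: (L1_bM T0' Lb).
pose h t := v t + vol M v t.
have Lh : L2 T h by apply: L2D => //; exact: L2_vol.
have au : ACd (fun x => Y 0 + prim h x) h by apply: AC_prim; exact: L2_L1 Lh.
exists (fun x => Y 0 + prim h x); last exact: L2_differentiable_of au Lh.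
set u := fun x => _ in au *; have bu : Bdd u := AC_Bdd au.
pose uc := cutoff T u.
have Luc : L2 T uc by exact: L2_cutoff.
pose w x := uc x + vol N uc x.
have bw : Bdd w.
  by apply: BddD; [exact: Bdd_cutoff|apply: Bdd_vol => //; exact: L2_L1 Luc].
have u0 : u 0 = Y 0 by rewrite /u (prim_le0 (L2_meas Lh) (lexx 0)) addr0.
have wE x : 0 <= x <= T -> w x = Y 0 + prim (fun t => v t - Vop a b w t) x.
  move=> xT.
  have -> : w x = u 0 + prim (fun t => h t + vol N h t - Vop a b w t) x.
    exact: (intertwining T0' La Lb bdN NE au Lh xT).
  rewrite u0; apply: (f_equal (fun A => Y 0 + A)).
  apply: eq_prim => t _; congr (_ - _).
  exact: (resolventK T0' bdN tN bdM tM ME t Lv).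
have ycE x : 0 <= x <= T -> yc x = Y 0 + prim (fun t => v t - Vop a b yc t) x.
  move=> xT; rewrite /yc cutoffE // {1}aY.2; congr (_ + _).
  by apply: eq_prim => t _; rewrite /v addrK.
have wyc : w = yc.
  apply/funext => x; have [xT|xT] := boolP (0 <= x <= T).
    exact: (Vop_uniq T0' La Lb (L2_L1 T0' Lv) bw byc wE ycE xT).
  have h1 : uc x = 0 by exact: (@supp_cutoff _ _ _ T u).
  have h2 : vol N uc x = 0 by exact: (supp_vol uc tN xT).
  have h3 : yc x = 0 by exact: (@supp_cutoff _ _ _ T Y).
  by rewrite /w h1 h2 h3 addr0.
apply: ae_eq_of => x xT; have /andP[/ltW x0 /ltW xT'] := xT.
have xT2 : 0 <= x <= T by rewrite x0 xT'.
have e : ocut T (fun t => sigma t *m f t) = ocut T Y.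
  apply/funext => t; rewrite /ocut; case: ifP => // /andP[/ltW t0 /ltW tT].
  by rewrite /Y fE ?t0.
rewrite /opEinv e ocutE // -(vol_cutoff_ocut bdM bY.1 xT').
rewrite -[Y x](cutoffE Y xT2) -/yc -wyc.
by rewrite /w (resolventKV T0' bdN tN bdM tM ME x Luc) /uc cutoffE.
Qed.

End SimilarityOperators.

(** * The similarity *)

Section Conclusion.
Context {R : realType}.
Implicit Types T x : R.
Local Notation mu := (@lebesgue_measure R).

Lemma opK_prim T r p (F : R -> 'M[R[i]]_(r, p)) (G Ge : R -> 'M[R[i]]_(p, r))
    (f : R -> 'cV[R[i]]_r) x : Bdd Ge -> mx_measurable `]0, T[ f -> x <= T ->
  (forall t, 0 <= t <= T -> G t = Ge t) ->
  opK F G f x = F x *m prim (fun t => Ge t *m ocut T f t) x.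
Proof.
move=> bG mf xT GE; rewrite /opK primE; congr (_ *m _).
rewrite -prim_ocut //; last exact: bG.1.
by apply: eq_prim => t /andP[t0 tx]; rewrite GE // t0 (le_trans tx).
Qed.

Lemma bounded_opK T r p (F Fe : R -> 'M[R[i]]_(r, p)) (G Ge : R -> 'M[R[i]]_(p, r)) :
  0 < T -> Bdd Fe -> Bdd Ge -> (forall t, 0 <= t <= T -> F t = Fe t) ->
  (forall t, 0 <= t <= T -> G t = Ge t) -> bounded_operator T (opK F G).
Proof.
move=> T0 bF bG FE GE.
apply: (@kernel_operator _ T r T0 _ (fun _ => 0) (fun z => Fe z.1 *m Ge z.2)).
- exact: Bdd_cst.
- by apply: BddM; [exact: (Bdd_comp measurable_fst bF)|exact: (Bdd_comp measurable_snd bG)].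
move=> f /square_summableP Lf x /andP[/ltW x0 /ltW xT].
have mf : mx_measurable `]0, T[ f by apply/mxmeas_ocut; exact: L2_meas Lf.
rewrite (opK_prim F bG mf xT GE) mul0mx add0r FE ?x0 //.
have l1 : L1 (fun t => Ge t *m ocut T f t).
  by apply: L1_BddMl => //; exact: L2_L1 (ltW T0) Lf.
rewrite -(primMl (Fe x) x l1).
by apply: eq_prim => t _; rewrite mulmxA.
Qed.

Lemma bounded_opA T r : 0 < T -> bounded_operator T (@opA R r).
Proof.
move=> T0; apply: (@kernel_operator _ T r T0 _ (fun _ => 0) (fun _ => 1%:M)).
- exact: Bdd_cst.
- exact: Bdd_cst.
move=> f /square_summableP Lf x /andP[_ /ltW xT].
have mf : mx_measurable `]0, T[ f by apply/mxmeas_ocut; exact: L2_meas Lf.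
have := @prim_ocut _ _ _ _ T (fun _ => 1%:M : 'M[R[i]]_r) f x (mxmeas_cst _) mf xT.
rewrite mul0mx add0r /vol => <-.
by rewrite /opA primE; apply: eq_prim => t _; rewrite mul1mx.
Qed.

Lemma mx_bounded_Bdd d (X : measurableType d) m n (D : set X)
    (f : X -> 'M[R[i]]_(m, n)) : Bdd f -> mx_bounded D f.
Proof.
move=> bf; have [C C0 hC] := BddP bf.
exists C => y _ i j; apply: le_trans (hC y).
rewrite -(ger0_norm (nm_ge0 (f y))) -sqrtr_sqr; apply: ler_wsqrtr.
exact: absc2_le.
Qed.

(** A competitor for rho is controlled only on [0, T] and solves the equation almost everywhere. Its
    extension satisfies the integral equation at every point, since null sets disappear under the
    integral, and so falls under [linear_ode_uniq]. *)
Lemma cauchy_solution_ext T n (B : R -> 'M[R[i]]_n) (B0 rho1 : R -> 'M[R[i]]_n) :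
  0 <= T -> L2 T B0 -> (forall x, 0 < x < T -> B x = B0 x) ->
  (forall x, ~~ (0 < x < T) -> B0 x = 0) -> cauchy_solution T B rho1 ->
  exists r1, [/\ ACd r1 (fun x => B0 x *m r1 x), r1 0 = 1%:M &
    forall x, 0 <= x <= T -> rho1 x = r1 x].
Proof.
move=> T0 LB BE B00 [rho10 [q [/mx_integrableP q1 qE] qB]].
pose r1 x := 1%:M + prim (ocut T q) x.
have ar : ACd r1 (ocut T q) by exact: AC_prim.
have rE x : 0 <= x <= T -> rho1 x = r1 x.
  move=> xT; rewrite qE // rho10 primE; congr (_ + _).
  have mq : mx_measurable `]0, T[ q by apply/mxmeas_ocut; exact: q1.1.
  have /andP[_ xT'] := xT.
  have := @prim_ocut _ _ _ _ T (fun _ => 1%:M : 'M[R[i]]_n) q x (mxmeas_cst _) mq xT'.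
  rewrite (eq_prim (f := fun t => 1%:M *m q t) (g := q)); last by move=> t _; rewrite mul1mx.
  by move=> ->; apply: eq_prim => t _; rewrite mul1mx.
have br := AC_Bdd ar.
have LBr : L2 T (fun x => B0 x *m r1 x) by exact: L2Mr.
exists r1; split => //; last by rewrite /r1 (prim_le0 q1.1 (lexx 0)) addr0.
split; first exact: L2_L1 LBr.
move=> x; rewrite ar.2; congr (_ + _).
apply: eq_Int_ae.
- exact: mxmeas_itv q1.1.
- exact: mxmeas_itv (L2_meas LBr).
- apply: aeS qB => t qt _; case: ifP => // _.
  rewrite /ocut; case: ifPn => tT; last by rewrite B00 // mul0mx.
  have tT2 : 0 <= t <= T by case/andP: tT => /ltW -> /ltW ->.
  by rewrite qt ?rE ?BE //= in_itv.
Qed.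

End Conclusion.

Theorem proposition2p1 (R : realType) (T : R) (r p : nat)
    (F F' : R -> 'M[R[i]]_(r, p)) (G G' : R -> 'M[R[i]]_(p, r))
    (T_gt0 : 0 < T)
    (F_diff : L2_derivative T F F') (G_diff : L2_derivative T G G')
    (FG1 : forall x, 0 <= x <= T -> F x *m G x = 1%:M) :
  exists (rho : R -> 'M[R[i]]_r) (N : R -> R -> 'M[R[i]]_r)
         (Einv : (R -> 'cV[R[i]]_r) -> (R -> 'cV[R[i]]_r)),
    (cauchy_solution T (fun x => F' x *m G x) rho /\
     forall rho1, cauchy_solution T (fun x => F' x *m G x) rho1 ->
       forall x, 0 <= x <= T -> rho1 x = rho x) /\
    (forall x, 0 <= x <= T -> rho x \in unitmx) /\
    (mx_measurable `[0, T] rho /\ mx_bounded `[0, T] rho) /\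
    (mx_measurable `[0, T] (fun x => invmx (rho x)) /\
     mx_bounded `[0, T] (fun x => invmx (rho x))) /\
    (mx_measurable (triangle T) (fun xt => N xt.1 xt.2) /\
     mx_bounded (triangle T) (fun xt => N xt.1 xt.2)) /\
    similar_by T (opK F G) opA (opE rho N) Einv /\
    preserves_L2_differentiable T (opE rho N) /\
    preserves_L2_differentiable T Einv.
Proof.
have T0 := ltW T_gt0.
have [LF aF FE] := L2_derivativeP T0 F_diff.
have [LG aG GE] := L2_derivativeP T0 G_diff.
set Fe := fun x => _ in aF; set Ge := fun x => _ in aG.
have bF : Bdd Fe := AC_Bdd aF; have bG : Bdd Ge := AC_Bdd aG.
(* Both extensions take at x the value at the nearest point of [0, T], so FG = I holds on the whole
   line. *)
have FG x : Fe x *m Ge x = 1%:M.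
  rewrite /Fe /Ge (prim_clamp x T0 (L2_meas LF) LF.2).
  rewrite (prim_clamp x T0 (L2_meas LG) LG.2).
  have xT : 0 <= Num.min (Num.max x 0) T <= T.
    by rewrite le_min le_max lexx orbT T0 ge_min lexx orbT.
  by rewrite -FE // -GE // FG1.
pose B x := ocut T F' x *m Ge x.
have LB : L2 T B by exact: L2Mr.
have [rho [sigma [arho asigma rho0 sr rs]]] := fundamental_pair T0 LB.
have brho := AC_Bdd arho; have bsigma := AC_Bdd asigma.
have LC : L2 T (fun x => - (Ge x *m ocut T F' x)) by apply: L2N; exact: L2Ml.
have [W [X [aW aX' W0 XW WX]]] := fundamental_pair T0 LC.
have aX : ACd X (fun x => X x *m (Ge x *m ocut T F' x)).
  by apply: eq_AC aX' _ _ => // x; rewrite mulmxN opprK.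
have bW := AC_Bdd aW.
pose a := sim_a (ocut T F') sigma W.
pose b := sim_b (ocut T F') Ge (ocut T G') rho X.
have La : L2 T a by exact: (L2_sim_a LF asigma bW).
have Lb : L2 T b by exact: (L2_sim_b aG LF LG arho aX).
have [N bN NE] := kernel_exists T0 La Lb.
have tN : triangular T N := kernel_triangular NE.
have [M [bM tM ME]] := resolvent_exists T0 bN tN.
have LBrho : L2 T (fun x => B x *m rho x) by exact: L2Mr.
have LsB : L2 T (fun x => - (sigma x *m B x)) by apply: L2N; exact: L2Ml.
have invE x : invmx (rho x) = sigma x.
  have [u _] := mulmx1_unit (rs x).
  by rewrite -[RHS](mulKmx u) rs mulmx1.
have BE x : 0 < x < T -> F' x *m G x = B x.
  by move=> xT; have /andP[/ltW x0 /ltW xT'] := xT; rewrite /B ocutE // GE ?x0.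
have B0 x : ~~ (0 < x < T) -> B x = 0.
  by move=> xT; rewrite /B /ocut (negbTE xT) mul0mx.
exists rho, (fun x t => N (x, t)), (opEinv T sigma M).
split; first split.
- split => //; exists (fun x => B x *m rho x).
    split; last by move=> x _; rewrite primE arho.2.
    by apply/mx_integrableP; apply: L1_cut arho.1; exact: measurable_itvoo.
  by apply: ae_eq_of => x xT; rewrite BE.
- move=> rho1 /(cauchy_solution_ext T0 LB BE B0)[r1 [ar r10 rE]] x xT.
  by rewrite rE //; apply: (linear_ode_uniq T0 LB ar arho); rewrite r10.
split; first by move=> x _; have [] := mulmx1_unit (rs x).
split; first by split; [exact: mxmeas_onD brho.1|exact: mx_bounded_Bdd].
split.
  rewrite (funext invE).
  by split; [exact: mxmeas_onD bsigma.1|exact: mx_bounded_Bdd].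
split.
  have -> : (fun xt : R * R => N (xt.1, xt.2)) = N by apply/funext => -[].
  by split; [exact: mxmeas_onD bN.1|exact: mx_bounded_Bdd].
split; last first.
  split.
    exact: (opE_differentiable T_gt0 arho LBrho La Lb bN NE).
  exact: (opEinv_differentiable T_gt0 asigma LsB La Lb bN NE bM tM ME).
split.
- split; [exact: (bounded_opK T_gt0 bF bG FE GE)|exact: bounded_opA].
- split; [exact: (bounded_opE T_gt0 arho bN)|exact: (bounded_opEinv T_gt0 asigma bM)].
- move=> f sf; split; apply: ae_eq_of => x xT.
    exact: (opEK T_gt0 asigma rs bN NE bM tM ME sf xT).
  exact: (opEinvK T_gt0 sr bN NE bM tM ME sf xT).
move=> f sf; apply: ae_eq_of => x xT.
have /andP[/ltW x0 /ltW xT'] := xT.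
have xT2 : 0 <= x <= T by rewrite x0 xT'.
have /square_summableP Lf := sf.
pose g := opEinv T sigma M f.
have Lg : L2 T g by exact: (L2_opEinv T_gt0 asigma bM tM sf).
have g1 := L2_L1 T0 Lg.
(* u = (I + N)E^-1 f equals rho^-1 f on (0, T). On [0, T], [Q] below is rho^-1 K f and [w] is (I +
   N)A E^-1 f = rho^-1 E A E^-1 f; both solve y = int_0^x (u - V y). *)
pose u t := g t + vol N g t.
have Lu : L2 T u by apply: L2D => //; exact: L2_vol.
have u1 := L2_L1 T0 Lu.
have Ly : L2 T (ocut T (fun t => sigma t *m f t)).
  by rewrite (funext (ocut_mul T sigma f)); exact: L2Ml.
have ruE t : rho t *m u t = ocut T f t.
  rewrite /u /g (resolventK T0 bN tN bM tM ME t Ly) ocut_mul.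
  by rewrite mulmxA rs mul1mx.
have [bQ QE] := conjugated_equation aF aG FG arho asigma sr rs aX WX u1.
set Q := fun x => _ in bQ QE.
have ag : ACd (fun x => 0 + prim g x) g by exact: AC_prim.
pose P := cutoff T (fun x => 0 + prim g x).
have bP : Bdd P by apply: Bdd_cutoff; exact: AC_Bdd ag.
pose w t := P t + vol N P t.
have bw : Bdd w.
  apply: BddD => //; apply: Bdd_vol => //; apply: (L2_L1 T0).
  by apply: L2_cutoff => //; exact: AC_Bdd ag.
have wE y : 0 <= y <= T -> w y = 0 + prim (fun t => u t - Vop a b w t) y.
  move=> yT; rewrite -[X in X + prim _ y](_ : 0 + prim g 0 = 0).
    exact: (intertwining T0 La Lb bN NE ag Lg yT).
  by rewrite (prim_le0 g1.1 (lexx 0)) addr0.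
have QE' y : 0 <= y <= T -> Q y = 0 + prim (fun t => u t - Vop a b Q t) y.
  by move=> _; rewrite add0r -QE.
have Qw := Vop_uniq T0 La Lb u1 bQ bw QE' wE xT2.
have mf : mx_measurable `]0, T[ f by apply/mxmeas_ocut; exact: L2_meas Lf.
rewrite (opK_prim F bG mf xT' GE) FE // -/(Fe x).
have -> : opE rho (fun x t => N (x, t)) (opA (opEinv T sigma M f)) x = rho x *m w x.
  rewrite opEE /w; congr (_ *m (_ + _)).
    by rewrite /P cutoffE // add0r /opA primE.
  apply: eq_prim => t /andP[t0 tx]; congr (_ *m _).
  by rewrite /P cutoffE ?t0 ?(le_trans tx) // add0r /opA primE.
rewrite -Qw /Q mulmxA rs mul1mx; congr (_ *m _).
by apply: eq_prim => t _; rewrite ruE.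
Qed.
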